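(* Let $D\ge 5$ and let $n\ge 2$ be a curvature order. There exist exactly $n-1$ inequivalent generalized quasi-topological densities of order $n$ in $D$ spacetime dimensions: exactly one inequivalent quasi-topological density, and exactly $n-2$ inequivalent genuine (that is, not quasi-topological) generalized quasi-topological densities.
   Context: An order-$n$ density $\mathfrak{R}^{(n)}$ is a scalar built from contractions of $n$ Riemann tensors with metrics (no covariant derivatives). Consider the static, spherically symmetric ansatz $ds^2=-N(r)^2f(r)\,dt^2+\frac{dr^2}{f(r)}+r^2d\Omega_{D-2}^2$ (the sphere may be replaced by a planar or hyperbolic transverse space). Let $L_{N,f}=N r^{D-2}\,\mathfrak{R}^{(n)}|_{N,f}$ be the density evaluated on this ansatz times the radial volume factor, and $L_f=L_{1,f}$. Generalized quasi-topological (GQT): $\mathfrak{R}^{(n)}$ is GQT if the Euler-Lagrange equation of $L_f$ vanishes identically, $\frac{\partial L_f}{\partial f}-\frac{d}{dr}\frac{\partial L_f}{\partial f'}+\frac{d^2}{dr^2}\frac{\partial L_f}{\partial f''}-\dots=0$ for all functions $f$; equivalently $L_f=T_0'$ is a total derivative. Integrated equation: for a GQT density one has $L_{N,f}=N\,T_0'+N'\,T_1+N''\,T_2+O(N'^2/N)$, where $T_0,T_1,T_2$ depend only on $r$, $f$ and derivatives of $f$, and $O(N'^2/N)$ denotes terms at least quadratic in derivatives of $N$. Varying with respect to $N$, setting $N=1$ and integrating once in $r$ gives the integrated equation of motion of $f$, namely $\mathcal{F}_{\mathfrak{R}^{(n)}}(r,f,f',f'')\equiv T_0-T_1+T_2'=\text{constant}$.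 Quasi-topological (QT): a GQT density whose integrated equation of motion for $f$ is algebraic in $f$ (it contains no derivatives of $f$), rather than a second-order differential equation. Inequivalent: two GQT densities $\mathfrak{R}^{(n)}_{\rm I}$ and $\mathfrak{R}^{(n)}_{\rm II}$ of order $n$ are inequivalent if the quotient $\mathcal{F}_{\mathfrak{R}^{(n)}_{\rm I}}(r,f,f',f'')/\mathcal{F}_{\mathfrak{R}^{(n)}_{\rm II}}(r,f,f',f'')$ of their integrated equations of motion is not a constant; if it is constant they are equivalent.
   Formalization: The count is of linearly independent integrated equations (quotient classes are infinite in general); densities with constant equation are not counted as further QT ones; for D=2n the QT density has constant equation, so its independence is claimed only for D≠2n. *)

(* Defs.v *)
From HB Require Import structures.
From mathcomp Require Import all_boot all_order all_algebra all_fingroup.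
From mathcomp Require Import all_classical all_reals all_analysis.
Set Implicit Arguments.
Unset Strict Implicit.
Unset Printing Implicit Defensive.
Import Order.TTheory GRing.Theory Num.Theory.
Import numFieldNormedType.Exports.

Local Open Scope ring_scope.

Section Curvature.
Context {R : realType} {D : nat}.
Implicit Types (g : 'rV[R]_D -> 'M[R]_D) (x : 'rV[R]_D) (a b c d e : 'I_D).

Definition pderiv a (F : 'rV[R]_D -> R) x : R := 'D_(delta_mx 0 a) F x.

Definition ginv g x : 'M[R]_D := invmx (g x).

(* Levi-Civita connection: Gamma^a_{bc} *)
Definition christoffel g a b c x : R :=
  2^-1 * \sum_e ginv g x a e *
    (pderiv b (fun y => g y e c) x + pderiv c (fun y => g y e b) x
     - pderiv e (fun y => g y b c) x).

(* R^a_{bcd} = d_c Gamma^a_{db} - d_d Gamma^a_{cb}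
               + Gamma^a_{ce} Gamma^e_{db} - Gamma^a_{de} Gamma^e_{cb} *)
Definition riemann_up g a b c d x : R :=
  pderiv c (christoffel g a d b) x - pderiv d (christoffel g a c b) x
  + \sum_e (christoffel g a c e x * christoffel g e d b x
            - christoffel g a d e x * christoffel g e c b x).

Definition riemann g a b c d x : R :=
  \sum_e g x a e * riemann_up g e b c d x.

End Curvature.

(* Slot (l, j) is the j-th lower index of the l-th Riemann tensor.  A
   permutation s of the 4n slots describes a complete contraction: the slots
   s (l, 0), s (l, 1) are contracted with one inverse metric and
   s (l, 2), s (l, 3) with another, for each l < n.  Every way of pairing off
   the 4n indices arises in this way. *)
Definition slot (n : nat) : finType := ('I_n * 'I_4)%type.

Definition contraction {R : realType} {D n : nat}
    (g : 'rV[R]_D -> 'M[R]_D) (x : 'rV[R]_D) (s : {perm slot n}) : R :=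
  \sum_(v : {ffun slot n -> 'I_D}) \prod_(l < n)
    (riemann g (v (l, inord 0)) (v (l, inord 1))
               (v (l, inord 2)) (v (l, inord 3)) x
     * ginv g x (v (s (l, inord 0))) (v (s (l, inord 1)))
     * ginv g x (v (s (l, inord 2))) (v (s (l, inord 3)))).

(* A density is a real linear combination of complete contractions, given by
   its coefficients. *)
Definition density (R : realType) (n : nat) := {ffun {perm slot n} -> R^o}.

Definition density_at {R : realType} {D n : nat} (c : density R n)
    (g : 'rV[R]_D -> 'M[R]_D) (x : 'rV[R]_D) : R :=
  \sum_s c s * contraction g x s.

Section Ansatz.
Context {R : realType}.
Implicit Types (N f : R -> R) (k r : R).

(* Coordinate 0 is t, coordinate 1 is r, the others are isotropic coordinates
   on the transverse space of constant curvature k, whose metric is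
   |dx|^2 / (1 + k |x|^2 / 4)^2: round unit sphere for k = 1 (stereographic
   coordinates), plane for k = 0, unit hyperbolic space for k = -1. *)
Definition radius {D : nat} (x : 'rV[R]_D) : R :=
  \sum_(i < D | i == 1%N :> nat) x 0 i.

Definition ansatz (D : nat) k N f (x : 'rV[R]_D) : 'M[R]_D :=
  let r := radius x in
  let rho2 := \sum_(i < D | (1 < i)%N) x 0 i ^+ 2 in
  \matrix_(a, b)
    if a != b then 0
    else if a == 0%N :> nat then - (N r ^+ 2 * f r)
    else if a == 1%N :> nat then (f r)^-1
    else r ^+ 2 / (1 + k * rho2 / 4) ^+ 2.

(* The ansatz is invariant under time translations and its transverse space is
   homogeneous, so scalars depend on r only; they are evaluated at t = 0 and
   at the origin of the transverse space. *)
Definition base_point (D : nat) r : 'rV[R]_D :=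
  \row_(i < D) if i == 1%N :> nat then r else 0.

(* L_{N,f}, with L_f the case N = 1. *)
Definition lagrangian (D n : nat) k (c : density R n) N f r : R :=
  N r * r ^+ (D - 2) * density_at c (ansatz k N f) (base_point D r).

(* The functions N and f range over the smooth positive functions on r > 0
   (positivity: t is timelike and the metric nondegenerate). *)
Definition admissible f :=
  forall r, 0 < r -> 0 < f r /\ forall m : nat, derivable (derive1n m f) r 1.

(* Applied to r, f, f', f''. *)
Definition jetfun : Type := R -> R -> R -> R -> R.

Definition along (T : jetfun) f : R -> R :=
  fun r => T r (f r) (derive1 f r) (derive1n 2 f r).

Definition euler_lagrange (L : jetfun) f r : R :=
  let f1 := derive1 f in
  let f2 := derive1n 2 f in
  let L0 s := derive1 (fun y => L s y (f1 s) (f2 s)) (f s) in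
  let L1 s := derive1 (fun y => L s (f s) y (f2 s)) (f1 s) in
  let L2 s := derive1 (fun y => L s (f s) (f1 s) y) (f2 s) in
  L0 r - derive1 L1 r + derive1n 2 L2 r.

End Ansatz.

Arguments jetfun : clear implicits.

Section GQT.
Context {R : realType} (D : nat) (k : R) {n : nat}.
Implicit Types (c : density R n) (F : jetfun R).

Definition GQT c : Prop :=
  exists L : jetfun R,
    (forall f r, admissible f -> 0 < r ->
       lagrangian D k c (fun=> 1) f r = along L f r) /\
    (forall f r, admissible f -> 0 < r -> euler_lagrange L f r = 0).

(* [integrated c F]: F = T0 - T1 + T2' where
     L_{N,f} = N T0' + N' T1 + N'' T2 + O(N'^2 / N).
   The remainder is N times a polynomial in N'/N and N''/N, without terms of
   degree less than 2, whose coefficients E i j depend on f only.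
   T0, hence F, is determined up to an additive constant. *)
Definition integrated c F : Prop :=
  exists (T0 T1 T2 : jetfun R) (E : nat -> nat -> jetfun R),
    [/\ forall f r, admissible f -> 0 < r ->
          derivable (along T0 f) r 1 /\ derivable (along T2 f) r 1,
        forall N f r, admissible N -> admissible f -> 0 < r ->
          lagrangian D k c N f r =
            N r * derive1 (along T0 f) r + derive1 N r * along T1 f r
            + derive1n 2 N r * along T2 f r
            + N r * \sum_(i < n.+1) \sum_(j < n.+1 | (2 <= i + j)%N)
                along (E i j) f r * (derive1 N r / N r) ^+ i
                                  * (derive1n 2 N r / N r) ^+ j
      & forall f r, admissible f -> 0 < r ->
          along F f r = along T0 f r - along T1 f r + derive1 (along T2 f) r].

Definition algebraic F : Prop :=
  exists phi : R -> R -> R, forall r y0 y1 y2,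
    0 < r -> 0 < y0 -> F r y0 y1 y2 = phi r y0.

Definition QT c : Prop :=
  GQT c /\ exists F, integrated c F /\ algebraic F.

Definition genuine c : Prop := GQT c /\ ~ QT c.

(* The quotient of the integrated equations is a (nonzero) constant, for some
   choice of the additive constants in the two equations. *)
Definition equivalent c1 c2 : Prop :=
  exists (F1 F2 : jetfun R) (lambda : R),
    [/\ integrated c1 F1, integrated c2 F2, lambda != 0
      & forall r y0 y1 y2, 0 < r -> 0 < y0 ->
          F1 r y0 y1 y2 = lambda * F2 r y0 y1 y2].

Definition same_equation c1 c2 : Prop :=
  exists F, integrated c1 F /\ integrated c2 F.

(* As the additive constant is free, this says that F is constant: the
   integrated equation puts no condition on f. *)
Definition trivial_equation c : Prop := integrated c (fun _ _ _ _ => 0).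

Definition nonvanishing c : Prop :=
  exists f r, [/\ admissible f, 0 < r & lagrangian D k c (fun=> 1) f r != 0].

End GQT.

(* Main.v *)
Require Import Defs.
From HB Require Import structures.
From mathcomp Require Import all_boot all_order all_algebra all_fingroup.
From mathcomp Require Import all_classical all_reals all_analysis.
From mathcomp Require Import ring lra zify.
Set Implicit Arguments.
Unset Strict Implicit.
Unset Printing Implicit Defensive.
Import Order.TTheory GRing.Theory Num.Theory.
Import numFieldNormedType.Exports.
Local Open Scope ring_scope.

(* Write D = m + 2.  The curvature of the ansatz with N = 1 is diagonal on
   bivectors, with eigenvalues A = - f'' / 2, B = - f' / (2 r) and
   psi = (k - f) / r^2, so a density of order n reduces to a form
   P (A, B, psi) of degree n.

   Upper bound.  If the Euler-Lagrange expression of r^m P vanishes then P is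
   affine in A and r^m P is the derivative of r^(m + 1) G (B, psi) for a binary
   form G, with dehomogenization g (X) = G (X, 1).  Switching on N splits B into
   two eigenvalues, and all of these are entries of one D x D matrix of which
   the density is a permutation invariant function.  The expansion of such a
   function to second order at constant curvature has few free coefficients;
   this forces g''(1) = 0 and D g'(1) = 2 n g(1), hence g is a combination of
   D + 2 n (X - 1) and (X - 1)^j with 3 <= j <= n.

   Existence.  On the ansatz every scalar is a polynomial in the scalar
   curvature and in one amplitude for each of the traceless Ricci and the Weyl
   tensor.  Contractions of order at most 4 and their products give all
   monomials of degree at least 3 in the two amplitudes, and their squares.
   The reduced densities attached to (X - 1)^j, j >= 3, vanish to third order at
   constant curvature, and the one attached to D + 2 n (X - 1) has no mixed
   term at second order, so all of them are realized.

   The integrated equation is linear in g.  It involves f'' unless g has degree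
   at most 1, in which case it is g(0) r^(m + 1) psi^n; this separates the
   quasi-topological density from the genuine ones. *)

(** The curvature eigenvalues form a matrix K, and a density is a polynomial [phi c] in K whose
    weights see index values only through equalities. Hence time, radial and transverse indices may
    be permuted freely, whatever the signature. At unit constant curvature the Hessian of [phi c]
    then takes three values, according to whether two index pairs coincide, share one index or are
    disjoint; Euler's identity ties them to the gradient, which leaves one linear relation.
    Exchanging t and r also makes the response to N' computable at N = 1, so the form P alone fixes
    the integrated equation. Positivity of f restricts the values of (A, B, psi) that occur. At r =
    2, however, f = k + 4 is positive and gives psi = -1 with A and B free, and forms of known
    degree are determined on that slice. One traceless Ricci tensor and one Weyl tensor have no
    nonzero contraction, which explains the exclusion of mixed terms at second order. The monomials
    tric^3 weyl and tric weyl^3 are not products of lower realizable ones; this is why order 4 is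
    needed. *)

(** * Differentiation on the line and along coordinate axes *)

Section RealDerivatives.
Context {R : realType}.
Implicit Types (f g : R -> R) (x a b : R) (p : {poly R}).

Lemma is_derive_add f g x a b : is_derive x 1 f a -> is_derive x 1 g b ->
  is_derive x 1 (fun t => f t + g t) (a + b).
Proof. exact: is_deriveD. Qed.

Lemma is_derive_sub f g x a b : is_derive x 1 f a -> is_derive x 1 g b ->
  is_derive x 1 (fun t => f t - g t) (a - b).
Proof. exact: is_deriveB. Qed.

Lemma is_derive_opp f x a : is_derive x 1 f a ->
  is_derive x 1 (fun t => - f t) (- a).
Proof. exact: is_deriveN. Qed.

Lemma is_derive_mul f g x a b : is_derive x 1 f a -> is_derive x 1 g b ->
  is_derive x 1 (fun t => f t * g t) (f x * b + g x * a).
Proof. exact: is_deriveM. Qed.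

Lemma is_derive_cast f x a b : is_derive x 1 f a -> a = b -> is_derive x 1 f b.
Proof. by move=> fa <-. Qed.

Lemma is_derive_exp f n x a : is_derive x 1 f a ->
  is_derive x 1 (fun t => f t ^+ n) (n%:R * f x ^+ n.-1 * a).
Proof.
move=> fa; elim: n => [|n IHn].
  by rewrite !mul0r; exact: is_derive_cst.
have -> : (fun t => f t ^+ n.+1) = (fun t => f t * f t ^+ n).
  by apply/funext => t; rewrite exprS.
refine (is_derive_cast (is_derive_mul fa IHn) _).
by case: n {IHn} => [|n] /=; rewrite ?expr0 -?natr1 ?exprS; ring.
Qed.

Lemma is_derive_inv f x a : f x != 0 -> is_derive x 1 f a ->
  is_derive x 1 (fun t => (f t)^-1) (- a / f x ^+ 2).
Proof.
move=> fx0 fa; refine (is_derive_cast (is_deriveV fx0 fa) _).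
by rewrite /GRing.scale /= !mulNr mulrC.
Qed.

Lemma is_derive_const c x : is_derive x 1 (fun=> c : R) 0.
Proof. exact: is_derive_cst. Qed.

Lemma is_derive_var x : is_derive x 1 (fun t : R => t) 1.
Proof. exact: is_derive_id. Qed.

Lemma is_derive_compose f g x a b : is_derive (g x) 1 f a ->
  is_derive x 1 g b -> is_derive x 1 (fun t => f (g t)) (a * b).
Proof. exact: is_derive1_comp. Qed.

Lemma is_derive_invr x : x != 0 -> is_derive x 1 (@GRing.inv R) (- 1 / x ^+ 2).
Proof. by move=> x0; apply: is_derive_inv (is_derive_var x). Qed.

Lemma is_derive_mull c x : is_derive x 1 (@GRing.mul R c) c.
Proof.
refine (is_derive_cast (is_derive_mul (is_derive_const c x) (is_derive_var x)) _).
by rewrite mulr1 mulr0 addr0.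
Qed.

Lemma is_derive_addl c x : is_derive x 1 (@GRing.add R c) 1.
Proof.
refine (is_derive_cast (is_derive_add (is_derive_const c x) (is_derive_var x)) _).
by rewrite add0r.
Qed.

Lemma is_derive_oppr x : is_derive x 1 (@GRing.opp R) (- 1).
Proof. exact: is_derive_opp (is_derive_var x). Qed.

Lemma derive1_is f x a : is_derive x 1 f a -> derive1 f x = a.
Proof. by move=> [_ <-]; rewrite derive1E. Qed.

Lemma derivable_is f x : derivable f x 1 -> is_derive x 1 f (derive1 f x).
Proof. by move=> fx; rewrite derive1E; apply: derivableP. Qed.

Lemma is_derive_near f g x a : (\near x, f x = g x) ->
  is_derive x 1 f a -> is_derive x 1 g a.
Proof. exact: near_eq_is_derive. Qed.

Lemma is_derive_pos f g x a : 0 < x -> (forall y, 0 < y -> f y = g y) ->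
  is_derive x 1 f a -> is_derive x 1 g a.
Proof.
move=> x0 fg; apply: is_derive_near.
by near=> y; apply: fg; near: y; exact: lt_nbhsr.
Unshelve. all: by end_near. Qed.

End RealDerivatives.

(** Differentiation directed by the syntax of the function. [derive_to] postpones the comparison of
    the derivative found with the one claimed. The clauses for bare operations serve functions that
    occur eta-reduced. *)
Ltac derivation :=
  first [exact (is_derive_const _ _) | lazymatch goal with
  | |- is_derive _ _ (fun t => t) _ => exact (is_derive_var _)
  | |- is_derive _ _ (fun t => - _) _ => notypeclasses refine (is_derive_opp _); derivation
  | |- is_derive _ _ (fun t => _ - _) _ => notypeclasses refine (is_derive_sub _ _); derivation
  | |- is_derive _ _ (fun t => _ + _) _ => notypeclasses refine (is_derive_add _ _); derivation
  | |- is_derive _ _ (fun t => _ * _) _ => notypeclasses refine (is_derive_mul _ _); derivation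
  | |- is_derive _ _ (fun t => _ ^+ _) _ => notypeclasses refine (is_derive_exp _ _); derivation
  | |- is_derive _ _ GRing.inv _ => notypeclasses refine (is_derive_invr _)
  | |- is_derive _ _ (GRing.mul _) _ => exact (is_derive_mull _ _)
  | |- is_derive _ _ (GRing.add _) _ => exact (is_derive_addl _ _)
  | |- is_derive _ _ GRing.opp _ => exact (is_derive_oppr _)
  | |- is_derive _ _ (fun t => _^-1) _ =>
      notypeclasses refine (is_derive_inv _ _); [| derivation]
  | _ => first [eassumption | idtac]
  end].
Ltac derive_to := notypeclasses refine (is_derive_cast _ _); [derivation|].

Arguments derive1n : simpl never.

(* ring and field compare atoms up to conversion, which is very slow on derivatives. *)
Ltac gen_derive := repeat match goal with
  | |- context [derive1n ?n ?h ?x] => generalize (derive1n n h x); intro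
  | |- context [derive1 ?h ?x] => generalize (derive1 h x); intro
  end.

Lemma sum_delta (R : realType) (D : nat) (a : 'I_D) (F : 'I_D -> R) :
  \sum_e (a == e)%:R * F e = F a.
Proof.
rewrite (bigD1 a) //= eqxx mul1r big1 ?addr0 // => e.
by rewrite eq_sym => /negbTE ->; rewrite mul0r.
Qed.

(** Only the germ of [F] on a coordinate line matters; the formulas for the connection hold only
    where the radius is positive and the conformal factor is nonzero. *)
Lemma pderiv_line (R : realType) (D : nat) (F : 'rV[R]_D -> R) b y (p : R -> R) d :
  (\forall t \near (0 : R), F (t *: delta_mx 0 b + y) = p t) ->
  is_derive (0 : R) 1 p d -> pderiv b F y = d.
Proof.
move=> Fp [_ <-]; rewrite /pderiv /derive; congr (lim _).
have F0 : F y = p 0 by have := nbhs_singleton Fp; rewrite scale0r add0r.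
have H : \forall h \near (0 : R), h^-1 *: (F (h *: delta_mx 0 b + y) - F y) =
    h^-1 *: (p (h *: 1 + 0) - p 0).
  by apply: filterS Fp => h /= ->; rewrite -F0 /GRing.scale /= mulr1 addr0.
rewrite eqEsubset; split; apply/near_eq_cvg/cvg_within => //.
by apply: filterS H => h /= ->.
Qed.

Lemma pderiv_lineW (R : realType) (D : nat) (F : 'rV[R]_D -> R) b y (p : R -> R) d :
  (forall t : R, F (t *: delta_mx 0 b + y) = p t) ->
  is_derive (0 : R) 1 p d -> pderiv b F y = d.
Proof. by move=> Fp; apply: pderiv_line; near=> t; exact: Fp.
Unshelve. all: by end_near. Qed.

Lemma near_add_gt0 (R : realType) (r : R) : 0 < r -> \forall t \near (0 : R), 0 < r + t.
Proof.
move=> r0; apply: filterS (@nbhs0_lt R R r r0) => t.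
by rewrite ltr_norml => /andP[rt _]; rewrite -[t]opprK subr_gt0 ltrNl.
Qed.

Lemma near_quadratic_neq0 (R : realType) (k : R) :
  \forall t \near (0 : R), 1 + k * t ^+ 2 / 4 != 0.
Proof.
have k1 : 0 < 1 + `|k| by rewrite ltr_pwDl.
have k2 : 0 < (1 + `|k|)^-1 by rewrite invr_gt0.
apply: filterS2 (@nbhs0_lt R R 1 ltr01) (@nbhs0_lt R R _ k2) => t t1 tk.
have kt : `|k * t ^+ 2 / 4| < 1.
  rewrite !normrM normfV (ger0_norm (ler0n _ 4)) ltr_pdivrMr // mul1r mulrA.
  have : `|k| * `|t| <= 1.
    rewrite ltW // (le_lt_trans (y := (1 + `|k|) * `|t|)) //.
      by rewrite ler_wpM2r // lerDr.
    by rewrite -ltr_pdivlMl // mulr1.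
  have := normr_ge0 t; have := normr_ge0 k; nra.
by move: kt; rewrite ltr_norml => /andP[kt _]; rewrite gt_eqF //; lra.
Qed.

(** * Curvature of the ansatz *)

Section AnsatzGeometry.
Context {R : realType} (m : nat) (k : R) (N f : R -> R).
Hypotheses (hN : admissible N) (hf : admissible f).
Local Notation D := m.+2.
Local Notation radius := Defs.radius.
Implicit Types (a b c d e : 'I_D) (x y : 'rV[R]_D) (r t : R).

Definition idx1 : 'I_D := Ordinal (isT : (1 < m.+2)%N).

Definition conf x : R := 1 + k * (\sum_(i < D | (1 < i)%N) x 0 i ^+ 2) / 4.

Definition hdiag a x : R :=
  if a == 0%N :> nat then - (N (radius x) ^+ 2 * f (radius x))
  else if a == 1%N :> nat then (f (radius x))^-1
  else radius x ^+ 2 / conf x ^+ 2.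

(* The coefficient d_b (log |g_aa|) / 2. *)
Definition loghalf a b x : R :=
  let r := radius x in
  if b == 1%N :> nat then
    if a == 0%N :> nat then derive1 N r / N r + derive1 f r / (2 * f r)
    else if a == 1%N :> nat then - derive1 f r / (2 * f r) else r^-1
  else if (1 < a)%N && (1 < b)%N then - k * x 0 b / (2 * conf x) else 0.

Lemma ansatzE a b x : ansatz k N f x a b = (a == b)%:R * hdiag a x.
Proof.
rewrite /ansatz /hdiag mxE; have [_|_] /= := eqVneq a b; last by rewrite mul0r.
by rewrite mul1r.
Qed.

Lemma radiusE x : radius x = x 0 idx1.
Proof. by rewrite /radius (big_pred1 idx1). Qed.

Lemma line_coord b x t a : (t *: delta_mx 0 b + x) 0 a = x 0 a + t * (a == b)%:R.
Proof. by rewrite !mxE /= addrC. Qed.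

Lemma radius_line b x t :
  radius (t *: delta_mx 0 b + x) = radius x + t * (b == 1%N :> nat)%:R.
Proof. by rewrite !radiusE line_coord eq_sym. Qed.

Lemma conf_line_small b x t : (b <= 1)%N -> conf (t *: delta_mx 0 b + x) = conf x.
Proof.
move=> b1; congr (1 + k * _ / 4); apply: eq_bigr => i i1.
rewrite line_coord (_ : (i == b) = false) ?mulr0 ?addr0 //.
by apply/negbTE; apply: contraTneq i1 => ->; rewrite -leqNgt.
Qed.

Lemma conf_line b x t : (1 < b)%N ->
  conf (t *: delta_mx 0 b + x) = conf x + k * (2 * t * x 0 b + t ^+ 2) / 4.
Proof.
move=> b1; rewrite /conf (bigD1 b) //= [in RHS](bigD1 b) //= line_coord eqxx mulr1.
rewrite (eq_bigr (fun i : 'I_D => x 0 i ^+ 2)); first by field.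
by move=> i /andP[_ /negbTE ib]; rewrite line_coord ib mulr0 addr0.
Qed.

Lemma admissible_gt0 (h : R -> R) r : admissible h -> 0 < r -> 0 < h r.
Proof. by move=> hh r0; case: (hh r r0). Qed.

Lemma admissible_neq0 (h : R -> R) r : admissible h -> 0 < r -> h r != 0.
Proof. by move=> hh r0; rewrite gt_eqF // admissible_gt0. Qed.

Lemma admissible_der (h : R -> R) n r : admissible h -> 0 < r ->
  is_derive r 1 (derive1n n h) (derive1n n.+1 h r).
Proof. by move=> hh r0; apply: derivable_is; case: (hh r r0). Qed.

Lemma admissible_der0 (h : R -> R) r : admissible h -> 0 < r ->
  is_derive r 1 h (derive1 h r).
Proof. exact: (@admissible_der h 0). Qed.

Lemma admissible_der1 (h : R -> R) r : admissible h -> 0 < r ->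
  is_derive r 1 (derive1 h) (derive1n 2 h r).
Proof. exact: (@admissible_der h 1). Qed.

Lemma is_derive_shift0 (h : R -> R) r (l : R) :
  is_derive r 1 h l -> is_derive (0 : R) 1 (fun t => h (r + t)) l.
Proof.
move=> hl; rewrite -[l]mulr1; apply: is_derive_compose; last exact: is_derive_addl.
by rewrite addr0.
Qed.

Lemma pderiv_hdiag a b x : 0 < radius x -> conf x != 0 ->
  pderiv b (hdiag a) x = 2 * hdiag a x * loghalf a b x.
Proof.
move=> r0 c0; set r := radius x.
have f0 := admissible_neq0 hf r0; have N0 := admissible_neq0 hN r0.
have fd := is_derive_shift0 (admissible_der0 hf r0).
have Nd := is_derive_shift0 (admissible_der0 hN r0).
have r_neq0 : r != 0 by rewrite gt_eqF.
rewrite -/r in f0 N0 fd Nd.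
have [b1|b1] := leqP b 1; last first.
  apply: (@pderiv_lineW _ _ _ _ _
    (fun t => if a == 0%N :> nat then - (N r ^+ 2 * f r)
      else if a == 1%N :> nat then (f r)^-1
      else r ^+ 2 / (conf x + k * (2 * t * x 0 b + t ^+ 2) / 4) ^+ 2)).
    move=> t; rewrite /hdiag radius_line conf_line //.
    by rewrite (gtn_eqF b1) mulr0 addr0.
  rewrite /hdiag /loghalf -/r (gtn_eqF b1) b1 andbT.
  case: a => [[|[|a]] ha] /=.
  - by derive_to; rewrite mulr0.
  - by derive_to; rewrite mulr0.
  - have c1 : conf x + k * (2 * 0 * x 0 b + 0 ^+ 2) / 4 != 0.
      by rewrite expr0n /= mulr0 mul0r addr0 mulr0 mul0r addr0.
    by derive_to; rewrite ?expf_neq0 //= ?expr0n /=; field.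
rewrite /hdiag /loghalf; apply: (@pderiv_lineW _ _ _ _ _
    (fun t => if a == 0%N :> nat then
                - (N (r + t * (b == 1%N :> nat)%:R) ^+ 2 * f (r + t * (b == 1%N :> nat)%:R))
      else if a == 1%N :> nat then (f (r + t * (b == 1%N :> nat)%:R))^-1
      else (r + t * (b == 1%N :> nat)%:R) ^+ 2 / conf x ^+ 2)).
  by move=> t; rewrite /hdiag radius_line conf_line_small.
case: b b1 => [[|[|b]] hb] //= _.
  rewrite andbF mulr0 /=.
  under eq_fun do rewrite mulr0 addr0.
  by case: a => [[|[|a]] ha] /=; derive_to.
under eq_fun do rewrite mulr1.
rewrite -/r; case: a => [[|[|a]] ha] /=.
- by derive_to; rewrite /= ?addr0 //; field; rewrite N0 f0.
- by derive_to; rewrite /= ?addr0 //; field.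
- by derive_to; rewrite /= ?addr0 //; field; rewrite r_neq0 c0.
Qed.

Lemma hdiag_neq0 a x : 0 < radius x -> conf x != 0 -> hdiag a x != 0.
Proof.
move=> r0 c0; have f0 := admissible_neq0 hf r0; have N0 := admissible_neq0 hN r0.
rewrite /hdiag; case: ifP => _; first by rewrite oppr_eq0 mulf_neq0 ?expf_neq0.
by case: ifP => _; rewrite ?invr_eq0 // mulf_neq0 ?invr_eq0 ?expf_neq0 // gt_eqF.
Qed.

Lemma ginv_ansatz a b x : 0 < radius x -> conf x != 0 ->
  ginv (ansatz k N f) x a b = (a == b)%:R * (hdiag a x)^-1.
Proof.
move=> r0 c0; pose B : 'M[R]_D := \matrix_(i, j) ((i == j)%:R * (hdiag i x)^-1).
have AB : ansatz k N f x *m B = 1%:M.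
  apply/matrixP => i j; rewrite !mxE.
  under eq_bigr do rewrite ansatzE -mulrA.
  by rewrite sum_delta mxE mulrCA mulfV ?hdiag_neq0 // mulr1.
have [uA _] := mulmx1_unit AB.
by rewrite /ginv -[invmx _]mulmx1 -AB mulKmx // mxE.
Qed.

Lemma pderiv_ansatz e b c x : 0 < radius x -> conf x != 0 ->
  pderiv b (fun y => ansatz k N f y e c) x =
  (e == c)%:R * (2 * hdiag e x * loghalf e b x).
Proof.
move=> r0 c0; have -> : (fun y => ansatz k N f y e c) =
    (fun y => (e == c)%:R * hdiag e y) by apply/funext => y; rewrite ansatzE.
have [_|_] /= := eqVneq e c.
  under eq_fun do rewrite mul1r.
  by rewrite mul1r pderiv_hdiag.
under eq_fun do rewrite mul0r.
by rewrite mul0r /pderiv derive_cst.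
Qed.

Definition christ a b c x : R :=
  (a == c)%:R * loghalf a b x + (a == b)%:R * loghalf a c x
  - (b == c)%:R * (hdiag b x / hdiag a x * loghalf b a x).

Lemma christoffel_ansatz a b c x : 0 < radius x -> conf x != 0 ->
  christoffel (ansatz k N f) a b c x = christ a b c x.
Proof.
move=> r0 c0; rewrite /christoffel (eq_bigr (fun e => (a == e)%:R * ((hdiag a x)^-1 *
    ((e == c)%:R * (2 * hdiag e x * loghalf e b x)
     + (e == b)%:R * (2 * hdiag e x * loghalf e c x)
     - (b == c)%:R * (2 * hdiag b x * loghalf b e x))))); last first.
  move=> e _; rewrite ginv_ansatz // (pderiv_ansatz e b c) //.
  by rewrite (pderiv_ansatz e c b) // (pderiv_ansatz b e c) // [RHS]mulrA.
have ha := hdiag_neq0 a r0 c0.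
by rewrite sum_delta /christ; field.
Qed.

Section BasePoint.
Variable r : R.
Hypothesis r0 : 0 < r.
Local Notation x0 := (base_point D r).

Let r_neq0 : r != 0. Proof. by rewrite gt_eqF. Qed.

(* Values of loghalf a 1 and of - Gamma^1_{aa} along the radial line. *)
Definition mu a (s : R) : R :=
  if a == 0%N :> nat then derive1 N s / N s + derive1 f s / (2 * f s)
  else if a == 1%N :> nat then - derive1 f s / (2 * f s) else s^-1.
Definition theta a (s : R) : R :=
  if a == 0%N :> nat then
    - f s * (N s * derive1 N s * f s + N s ^+ 2 * derive1 f s / 2)
  else if a == 1%N :> nat then - derive1 f s / (2 * f s) else s * f s.

Definition dmu a : R :=
  if a == 0%N :> nat then
    derive1n 2 N r / N r - (derive1 N r / N r) ^+ 2
    + derive1n 2 f r / (2 * f r) - (derive1 f r / f r) ^+ 2 / 2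
  else if a == 1%N :> nat then
    - derive1n 2 f r / (2 * f r) + (derive1 f r / f r) ^+ 2 / 2
  else - (r ^+ 2)^-1.
Definition dtheta a : R :=
  if a == 0%N :> nat then
    - derive1 f r * (N r * derive1 N r * f r + N r ^+ 2 * derive1 f r / 2)
    - f r * (derive1 N r ^+ 2 * f r + N r * derive1n 2 N r * f r
       + N r * derive1 N r * derive1 f r + N r * derive1 N r * derive1 f r
       + N r ^+ 2 * derive1n 2 f r / 2)
  else if a == 1%N :> nat then
    - derive1n 2 f r / (2 * f r) + (derive1 f r / f r) ^+ 2 / 2
  else f r + r * derive1 f r.

Lemma is_derive_mu a : is_derive r 1 (mu a) (dmu a).
Proof.
have f0 := admissible_neq0 hf r0; have N0 := admissible_neq0 hN r0.
have fd := admissible_der0 hf r0; have Nd := admissible_der0 hN r0.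
have fd1 := admissible_der1 hf r0; have Nd1 := admissible_der1 hN r0.
have f20 : 2 * f r != 0 by rewrite mulf_neq0 // pnatr_eq0.
rewrite /mu /dmu; case: a => [[|[|a]] ha] /=.
- by derive_to => //=; gen_derive; field; rewrite f0.
- by derive_to => //=; gen_derive; field.
- by derive_to => //=; field.
Qed.

Lemma is_derive_theta a : is_derive r 1 (theta a) (dtheta a).
Proof.
have f0 := admissible_neq0 hf r0; have N0 := admissible_neq0 hN r0.
have fd := admissible_der0 hf r0; have Nd := admissible_der0 hN r0.
have fd1 := admissible_der1 hf r0; have Nd1 := admissible_der1 hN r0.
have f20 : 2 * f r != 0 by rewrite mulf_neq0 // pnatr_eq0.
rewrite /theta /dtheta; case: a => [[|[|a]] ha] /=.
- by derive_to => //=; gen_derive; field.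
- by derive_to => //=; gen_derive; field.
- by derive_to => //=; gen_derive; ring.
Qed.

Lemma radius_base : radius x0 = r.
Proof. by rewrite radiusE mxE. Qed.

Lemma conf_base : conf x0 = 1.
Proof.
rewrite /conf big1 ?mulr0 ?mul0r ?addr0 // => i i1.
by rewrite mxE gtn_eqF // expr0n.
Qed.

Definition christ0 a b c (s : R) : R :=
  (a == c)%:R * ((b == 1%N :> nat)%:R * mu a s)
  + (a == b)%:R * ((c == 1%N :> nat)%:R * mu a s)
  - (b == c)%:R * ((a == 1%N :> nat)%:R * theta b s).

(** Where the transverse coordinates vanish, [loghalf a b] survives for the radial b alone. *)
Lemma christ_radial a b c x : 0 < radius x -> conf x = 1 ->
  (forall i : 'I_D, (1 < i)%N -> x 0 i = 0) -> christ a b c x = christ0 a b c (radius x).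
Proof.
move=> s0 c1 xi; have f0 := admissible_neq0 hf s0; have N0 := admissible_neq0 hN s0.
have s_neq0 : radius x != 0 by rewrite gt_eqF.
have lamE (a' b' : 'I_D) : loghalf a' b' x = (b' == 1%N :> nat)%:R * mu a' (radius x).
  rewrite /loghalf /mu; case: b' => [[|[|b']] hb] /=; rewrite ?andbF ?mul1r ?mul0r //.
  by rewrite andbT xi // mulr0 mul0r if_same.
rewrite /christ /christ0 !lamE; congr (_ - _ * _).
case: a => [[|[|a]] ha] /=; rewrite ?mul0r ?mulr0 //.
rewrite !mul1r /hdiag /theta /mu c1 /=; case: b => [[|[|b]] hb] /=; gen_derive; field;
by rewrite ?N0 ?f0 ?s_neq0.
Qed.

Lemma christ_base a b c : christ a b c x0 = christ0 a b c r.
Proof.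
by rewrite christ_radial ?radius_base ?conf_base // => i i1; rewrite mxE gtn_eqF.
Qed.

Definition dchrist0 (e a b c : 'I_D) : R :=
  if e == 1%N :> nat then
    (a == c)%:R * ((b == 1%N :> nat)%:R * dmu a)
    + (a == b)%:R * ((c == 1%N :> nat)%:R * dmu a)
    - (b == c)%:R * ((a == 1%N :> nat)%:R * dtheta b)
  else if (1 < e)%N then
    - (k / 2) * ((a == c)%:R * ((1 < a)%N && (b == e))%:R
       + (a == b)%:R * ((1 < a)%N && (c == e))%:R
       - (b == c)%:R * ((1 < b)%N && (a == e))%:R)
  else 0.

(** A step in t or r stays where the transverse coordinates vanish, so [christ0] can be
    differentiated. A transverse step keeps the radius and changes only the conformal factor, whose
    second derivative contributes the terms in k / 2. *)
Lemma pderiv_christoffel e a b c :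
  pderiv e (christoffel (ansatz k N f) a b c) x0 = dchrist0 e a b c.
Proof.
have f0 := admissible_neq0 hf r0; have N0 := admissible_neq0 hN r0.
have [e1|e1] := leqP e 1.
  have rad t : radius (t *: delta_mx 0 e + x0) = r + t * (e == 1%N :> nat)%:R.
    by rewrite radius_line radius_base.
  have cf t : conf (t *: delta_mx 0 e + x0) = 1 by rewrite conf_line_small // conf_base.
  have zz t (i : 'I_D) : (1 < i)%N -> (t *: delta_mx 0 e + x0) 0 i = 0.
    move=> i1; rewrite line_coord mxE gtn_eqF // add0r (_ : (i == e) = false) ?mulr0 //.
    by apply/negbTE; apply: contraTneq i1 => ->; rewrite -leqNgt.
  apply: (@pderiv_line _ _ _ _ _ (fun t => christ0 a b c (r + t * (e == 1%N :> nat)%:R))).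
    apply: filterS (near_add_gt0 r0) => t rt.
    have {}rt : 0 < r + t * (e == 1%N :> nat)%:R.
      by case: (_ == _); rewrite /= ?mulr0 ?addr0 // mulr1.
    rewrite christoffel_ansatz ?rad ?cf ?oner_eq0 //.
    by rewrite christ_radial ?rad ?cf // => i; exact: zz.
  case: e e1 {rad cf zz} => [[|[|e]] he] e1; rewrite /dchrist0 /=; last by case/negP: e1.
    by under eq_fun do rewrite mulr0 addr0; exact: is_derive_const.
  under eq_fun do rewrite mulr1.
  apply: (is_derive_shift0 (h := christ0 a b c)).
  have dm := is_derive_mu a; have dt := is_derive_theta b.
  by rewrite /christ0; derive_to; ring.
have rad t : radius (t *: delta_mx 0 e + x0) = r.
  by rewrite radius_line radius_base (gtn_eqF e1) mulr0 addr0.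
have xe : x0 0 e = 0 by rewrite mxE (gtn_eqF e1).
have cf t : conf (t *: delta_mx 0 e + x0) = 1 + k * t ^+ 2 / 4.
  by rewrite conf_line // conf_base xe mulr0 add0r.
have xi t (i : 'I_D) : (1 < i)%N -> (t *: delta_mx 0 e + x0) 0 i = t * (i == e)%:R.
  by move=> i1; rewrite line_coord mxE gtn_eqF // add0r.
pose q t := 1 + k * t ^+ 2 / 4.
pose l (i j : 'I_D) t : R := (j == 1%N :> nat)%:R * mu i r
  + ((1 < i)%N && (j == e))%:R * (- k * t / (2 * q t)).
have q0 : q 0 = 1 by rewrite /q expr0n /= mulr0 mul0r addr0.
have dq : is_derive (0 : R) 1 q 0.
  by rewrite /q; derive_to; rewrite /= !(mulr0, mul0r, addr0).
have dl i j : is_derive (0 : R) 1 (l i j) (- (k / 2) * ((1 < i)%N && (j == e))%:R).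
  rewrite /l; derive_to; first by rewrite q0 mulr1 pnatr_eq0.
  by rewrite /= q0; field.
(* [w a b t] is the factor [hdiag b / hdiag a * loghalf b a] of [christ] on this line. *)
pose w (i j : 'I_D) t : R := if i == 1%N :> nat then
    (if j == 0%N :> nat then - (N r ^+ 2 * f r)
     else if j == 1%N :> nat then (f r)^-1 else r ^+ 2 / q t ^+ 2) * f r * mu j r
  else ((1 < j)%N && (i == e))%:R * (- k * t / (2 * q t)).
have dw i j : is_derive (0 : R) 1 (w i j)
    (- (k / 2) * ((1 < j)%N && (i == e))%:R).
  have q20 : 2 * q 0 != 0 by rewrite q0 mulr1 pnatr_eq0.
  rewrite /w; case: i => [[|[|i]] hi] /=.
  - by derive_to => //; rewrite /= q0; field.
  - rewrite (_ : (_ == e) = false) ?andbF ?mulr0; last first.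
      by apply/negbTE; apply: contraTneq e1 => <-.
    case: j => [[|[|j]] hj] /=; derive_to; rewrite /= ?q0 ?expf_neq0 ?oner_eq0 //;
    gen_derive; by field.
  - by derive_to => //; rewrite /= q0; field.
apply: (@pderiv_line _ _ _ _ _ (fun t => (a == c)%:R * l a b t
    + (a == b)%:R * l a c t - (b == c)%:R * w a b t)).
  have lE t i j : loghalf i j (t *: delta_mx 0 e + x0) = l i j t.
    rewrite /loghalf rad cf /l /mu; case: j => [[|[|j]] hj] /=.
    + rewrite andbF (_ : (_ == e) = false) ?andbF ?mul0r ?addr0 //.
      by apply/negbTE; apply: contraTneq e1 => <-.
    + rewrite mul1r (_ : (_ == e) = false) ?andbF ?mul0r ?addr0 //.
      by apply/negbTE; apply: contraTneq e1 => <-.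
    + rewrite andbT mul0r add0r xi //.
      by case: ltnP => _ /=; rewrite ?mul0r //; ring.
  apply: filterS (near_quadratic_neq0 k) => t qt.
  rewrite christoffel_ansatz ?rad ?cf // /christ !lE; congr (_ - _).
  have [bc|] /= := eqVneq b c; last by rewrite !mul0r.
  have e01 (j : 'I_D) : (j <= 1)%N -> (j == e) = false.
    by move=> j1; apply/negbTE; apply: contraTneq e1 => <-; rewrite -leqNgt.
  rewrite !mul1r /hdiag rad cf /w /l -/(q t); case: a {dl dw} => [[|[|a]] ha] /=.
  - by rewrite (e01 (Ordinal ha) isT) andbF !mul0r addr0 mulr0.
  - by rewrite (e01 (Ordinal ha) isT) andbF mul0r addr0 mul1r invrK.
  rewrite mul0r add0r; case: b {bc} => [[|[|b]] hb] /=; rewrite ?mul0r ?mulr0 //.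
  by rewrite divff ?mul1r // mulf_neq0 ?invr_eq0 ?expf_neq0.
have dl1 := dl a b; have dl2 := dl a c; have dw1 := dw a b.
by derive_to; rewrite /dchrist0 (gtn_eqF e1) e1; ring.
Qed.

Lemma christoffel_base a b c :
  christoffel (ansatz k N f) a b c x0 = christ0 a b c r.
Proof.
by rewrite christoffel_ansatz ?radius_base ?conf_base ?oner_eq0 // christ_base.
Qed.

Lemma sum_christ0 a b c d :
  \sum_e christ0 a c e r * christ0 e d b r =
  (c == 1%N :> nat)%:R * mu a r * christ0 a d b r
  + (a == c)%:R * mu a r * christ0 idx1 d b r
  - (a == 1%N :> nat)%:R * theta c r * christ0 c d b r.
Proof.
rewrite (eq_bigr (fun e =>
   (a == e)%:R * ((c == 1%N :> nat)%:R * mu a r * christ0 e d b r)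
   + (idx1 == e)%:R * ((a == c)%:R * mu a r * christ0 e d b r)
   - (c == e)%:R * ((a == 1%N :> nat)%:R * theta c r * christ0 e d b r))).
  by rewrite sumrB big_split /= !sum_delta.
move=> e _; rewrite {1}/christ0 (_ : (e == 1%N :> nat) = (idx1 == e)); first by ring.
by rewrite eq_sym.
Qed.

End BasePoint.

End AnsatzGeometry.

Ltac decide_eqs := repeat match goal with |- context [@eq_op _ ?x ?y] =>
  is_var x; is_var y; have [?|_] := eqVneq x y; [subst y|]; rewrite ?eqxx /= end.

Section AnsatzRiemann.
Context {R : realType} (m : nat) (k : R) (N f : R -> R) (r : R).
Hypotheses (hN : admissible N) (hf : admissible f) (r0 : 0 < r).
Local Notation D := m.+2.
Local Notation x0 := (base_point D r).
Implicit Types (a b c d e : 'I_D).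

Definition curv (a b : 'I_D) : R :=
  if (a <= 1)%N && (b <= 1)%N then
    - (derive1n 2 N r * f r + 3 / 2 * derive1 N r * derive1 f r
       + N r * derive1n 2 f r / 2) / N r
  else if (a == 0%N :> nat) || (b == 0%N :> nat) then
    - derive1 f r / (2 * r) - f r * derive1 N r / (r * N r)
  else if (a == 1%N :> nat) || (b == 1%N :> nat) then - derive1 f r / (2 * r)
  else (k - f r) / r ^+ 2.

(** Only the type of each index (time, radial, transverse) and coincidences of transverse indices
    matter; each of the 81 type patterns reduces to rational identities in the jets of N and f. *)
Lemma riemann_up_base a b c d :
  riemann_up (ansatz k N f) a b c d x0 = hdiag k N f b x0 * curv a b *
    (((a == c) && (b == d))%:R - ((a == d) && (b == c))%:R).
Proof.
have f0 := admissible_neq0 hf r0; have N0 := admissible_neq0 hN r0.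
have r_neq0 : r != 0 by rewrite gt_eqF.
rewrite /riemann_up !(pderiv_christoffel _ hN hf r0).
rewrite (eq_bigr (fun e => christ0 N f a c e r * christ0 N f e d b r
   - christ0 N f a d e r * christ0 N f e c b r)); last first.
  by move=> e _; rewrite !(christoffel_base _ hN hf r0).
rewrite sumrB !sum_christ0 /hdiag radius_base conf_base // expr1n divr1.
have ltE (n p : nat) (hn : (n.+2 < D)%N) (hp : (p.+2 < D)%N) :
  (Ordinal hn == Ordinal hp) = (n == p) by [].
rewrite /dchrist0 /christ0 /curv /mu /theta /dmu /dtheta.
gen_derive.
have simp0 := (mul1r, mulr1, addr0, add0r, mul0r, mulr0, subr0, sub0r, oppr0, subrr).
move: (N r) (f r) N0 f0 => N0 f0 N_neq0 f_neq0.
case: a => [[|[|a]] ha]; case: b => [[|[|b]] hb]; case: c => [[|[|c]] hc];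
  case: d => [[|[|d]] hd]; rewrite /= ?ltE ?mul0r ?mulr0.
all: rewrite ?simp0 //; decide_eqs; rewrite ?simp0 //.
all: by field; rewrite ?r_neq0 ?N_neq0 ?f_neq0.
Qed.

Lemma riemann_base a b c d :
  riemann (ansatz k N f) a b c d x0 =
  hdiag k N f a x0 * hdiag k N f b x0 * (curv a b *
    (((a == c) && (b == d))%:R - ((a == d) && (b == c))%:R)).
Proof.
rewrite /riemann (eq_bigr (fun e => (a == e)%:R *
  (hdiag k N f a x0 * riemann_up (ansatz k N f) e b c d x0))); last first.
  by move=> e _; rewrite ansatzE mulrA.
by rewrite sum_delta riemann_up_base !mulrA.
Qed.

Lemma ginv_base a b :
  ginv (ansatz k N f) x0 a b = (a == b)%:R / hdiag k N f a x0.
Proof. by rewrite ginv_ansatz ?radius_base ?conf_base ?oner_eq0. Qed.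

Lemma hdiag_base_neq0 a : hdiag k N f a x0 != 0.
Proof. by rewrite hdiag_neq0 ?radius_base ?conf_base ?oner_eq0. Qed.

End AnsatzRiemann.

(** * Contractions as polynomials in the sectional curvatures *)

Section CurvatureContraction.
Context {R : realType} {D n : nat}.
Implicit Types (K : 'I_D -> 'I_D -> R) (s : {perm slot n}) (v : {ffun slot n -> 'I_D}).

Definition sl (l : 'I_n) (j : nat) : slot n := (l, inord j).

Definition rdelta v l : R :=
  ((v (sl l 0) == v (sl l 2)) && (v (sl l 1) == v (sl l 3)))%:R
  - ((v (sl l 0) == v (sl l 3)) && (v (sl l 1) == v (sl l 2)))%:R.

Definition pairing s v : R := \prod_(l < n)
  ((v (s (sl l 0)) == v (s (sl l 1)))%:R * (v (s (sl l 2)) == v (s (sl l 3)))%:R).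

(** A contraction at a point where the curvature is diagonal on bivectors, with all metric factors
    removed. *)
Definition ctr s K : R :=
  \sum_v (\prod_l rdelta v l) * pairing s v * \prod_l K (v (sl l 0)) (v (sl l 1)).

Lemma sum_ord4 (V : nmodType) (F : 'I_4 -> V) :
  \sum_j F j = F (inord 0) + F (inord 1) + F (inord 2) + F (inord 3).
Proof.
rewrite !big_ord_recr big_ord0 /= add0r.
by congr (_ + _ + _ + _); congr F; apply/val_inj; rewrite /= inordK.
Qed.

Lemma sum_slot (F : slot n -> nat) :
  (\sum_x F x = \sum_l F (sl l 0) + \sum_l F (sl l 1)
              + \sum_l F (sl l 2) + \sum_l F (sl l 3))%N.
Proof.
rewrite -!big_split /= (eq_bigr (fun x => F (x.1, x.2))); last by case.
rewrite -(pair_bigA _ (fun l j => F (l, j))) /=.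
by apply: eq_bigr => l _; rewrite (sum_ord4 (fun j => F (l, j))).
Qed.

Lemma prod_count (h : 'I_D -> R) (u : 'I_n -> 'I_D) :
  \prod_l h (u l) = \prod_a h a ^+ (\sum_l (u l == a))%N.
Proof.
under [RHS]eq_bigr do rewrite expr_sum.
rewrite exchange_big /=; apply: eq_bigr => l _.
rewrite (bigD1 (u l)) //= eqxx expr1 big1 ?mulr1 // => a.
by rewrite eq_sym => /negbTE ->.
Qed.

(* Each index value occurs equally often among the slots (l, 0), (l, 1) and
   among the first members of the contracted pairs, so the metric factors
   cancel, signs included. *)
Lemma metric_factors_cancel (h : 'I_D -> R) s v :
  \prod_l rdelta v l * pairing s v != 0 ->
  \prod_l (h (v (sl l 0)) * h (v (sl l 1))) =
  \prod_l (h (v (s (sl l 0))) * h (v (s (sl l 2)))).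
Proof.
rewrite mulf_eq0 negb_or => /andP[/prodf_neq0 rv /prodf_neq0 pv].
rewrite !big_split /= !(prod_count h) -!big_split /=; apply: eq_bigr => a _.
rewrite -!exprD; congr (_ ^+ _).
(* A nonzero curvature factor forces its first and second index pairs to agree as multisets. *)
have e1 : (\sum_l (v (sl l 0) == a) + \sum_l (v (sl l 1) == a) =
           \sum_l (v (sl l 2) == a) + \sum_l (v (sl l 3) == a))%N.
  rewrite -!big_split /=; apply: eq_bigr => l _; have := rv l isT; rewrite /rdelta.
  case: andP => [[/eqP -> /eqP ->] //|_]; case: andP => [[/eqP -> /eqP ->]|_].
    by rewrite addnC.
  by rewrite subr0 eqxx.
have e2 : (\sum_l (v (s (sl l 0)) == a) = \sum_l (v (s (sl l 1)) == a))%N.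
  apply: eq_bigr => l _; have := pv l isT.
  by case: (v (s (sl l 0)) =P _) => [->|_] //; rewrite mul0r eqxx.
have e3 : (\sum_l (v (s (sl l 2)) == a) = \sum_l (v (s (sl l 3)) == a))%N.
  apply: eq_bigr => l _; have := pv l isT.
  by case: (v (s (sl l 2)) =P _) => [->|_] //; rewrite mulr0 eqxx.
(* The slots with value a, counted directly and through [s], number twice the left and twice the
   right exponent. *)
have := sum_slot (fun x => v x == a : nat).
rewrite (reindex_inj (@perm_inj _ s)) (sum_slot (fun x => v (s x) == a : nat)).
rewrite -e2 -e3; move: e1.
do !move: (bigop _ _ _) => ?; lia.
Qed.

Lemma contraction_ctr (g : 'rV[R]_D -> 'M[R]_D) x (h : 'I_D -> R) K s :
  (forall a, h a != 0) ->
  (forall a b, ginv g x a b = (a == b)%:R / h a) ->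
  (forall a b c d, riemann g a b c d x = h a * h b * (K a b *
    (((a == c) && (b == d))%:R - ((a == d) && (b == c))%:R))) ->
  Defs.contraction g x s = ctr s K.
Proof.
move=> h0 gE RE; apply: eq_bigr => v _; rewrite -!/(sl _ _).
have [w0|w0] := eqVneq (\prod_l rdelta v l * pairing s v) 0.
  rewrite w0 mul0r; apply/eqP; move/eqP: w0.
  rewrite mulf_eq0 => /orP[/prodf_eq0[l _ /eqP l0]|/prodf_eq0[l _]].
    apply/prodf_eq0; exists l => //; rewrite RE -!/(sl _ _).
    by rewrite -/(rdelta v l) l0 !(mulr0, mul0r).
  rewrite mulf_eq0 => /orP[]/eqP l0; apply/prodf_eq0; exists l => //;
  by rewrite !gE -!/(sl _ _) l0 !(mulr0, mul0r).
rewrite -[RHS]mul1r.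
rewrite -[X in _ = X * _](divff (x := \prod_l (h (v (sl l 0)) * h (v (sl l 1))))); last first.
  by apply/prodf_neq0 => l _; rewrite mulf_neq0.
rewrite [X in _ / X](metric_factors_cancel h w0) /pairing -prodfV -!big_split /=.
apply: eq_bigr => l _.
rewrite RE !gE -!/(sl _ _) -/(rdelta v l); field.
by rewrite !h0.
Qed.

End CurvatureContraction.

(** * Polynomial identities and products of linear factors *)

Lemma horner_inj (R : numDomainType) (p q : {poly R}) :
  (forall x, p.[x] = q.[x]) -> p = q.
Proof.
move=> pq; apply/eqP; rewrite -subr_eq0; apply/eqP.
pose rs := [seq i%:R : R | i <- iota 0 (size (p - q))].
apply: (@roots_geq_poly_eq0 _ _ rs).
- by apply/allP => x _; rewrite /root hornerD hornerN pq subrr.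
- by rewrite map_inj_uniq ?iota_uniq // => i j /eqP; rewrite eqr_nat => /eqP.
- by rewrite size_map size_iota.
Qed.

Lemma coef_inj_wide (R : numDomainType) n (x y : nat -> R) :
  (forall t, \sum_(i < n) x i * t ^+ i = \sum_(i < n) y i * t ^+ i) ->
  forall i, (i < n)%N -> x i = y i.
Proof.
move=> xy i ni; have : \poly_(i < n) x i = \poly_(i < n) y i.
  by apply: horner_inj => t; rewrite !horner_poly.
by move/(congr1 (fun p : {poly R} => p`_i)); rewrite !coef_poly ni.
Qed.

Section LinearFactors.
Context {R : numFieldType} {I : Type}.
Implicit Types (r : seq I) (a b x : I -> R).

Definition linprod r a b : {poly R} := \prod_(l <- r) ((a l)%:P + b l *: 'X).

Lemma horner_linprod r a b t :
  (linprod r a b).[t] = \prod_(l <- r) (a l + t * b l).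
Proof.
by rewrite horner_prod; apply: eq_bigr => l _; rewrite !hornerE mulrC.
Qed.

Lemma coef_linfactor (a b : R) :
  ((a%:P + b *: 'X)`_0 = a) * ((a%:P + b *: 'X)`_1 = b) * ((a%:P + b *: 'X)`_2 = 0).
Proof. by rewrite !coefE /=; do !split; rewrite ?coefE /= ?mulr0 ?mulr1 ?addr0 ?add0r. Qed.

Lemma coef0_linprod r a b : (linprod r a b)`_0 = \prod_(l <- r) a l.
Proof.
rewrite -horner_coef0 horner_linprod; apply: eq_bigr => l _.
by rewrite mul0r addr0.
Qed.

Lemma coef1_linprodD r a b b' (x y : R) :
  (linprod r a (fun l => x * b l + y * b' l))`_1 =
  x * (linprod r a b)`_1 + y * (linprod r a b')`_1.
Proof.
elim: r => [|l r IHr]; rewrite /linprod ?big_nil ?big_cons.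
  by rewrite coef1 /= !mulr0 addr0.
rewrite -!/(linprod _ _ _) !coefM !big_ord_recr !big_ord0 /= !add0r.
by rewrite !coef_linfactor IHr !coef0_linprod; ring.
Qed.

Lemma coef1_linprod1 r x : (linprod r (fun=> 1) x)`_1 = \sum_(l <- r) x l.
Proof.
elim: r => [|l r IHr]; rewrite /linprod ?big_nil ?big_cons ?coef1 //.
rewrite -!/(linprod _ _ _) !coefM !big_ord_recr !big_ord0 /= !add0r.
by rewrite !coef_linfactor IHr !coef0_linprod big1_eq; ring.
Qed.

Lemma coef2_linprod1 r x : (linprod r (fun=> 1) x)`_2 =
  ((\sum_(l <- r) x l) ^+ 2 - \sum_(l <- r) x l ^+ 2) / 2.
Proof.
elim: r => [|l r IHr]; rewrite /linprod ?big_nil ?big_cons.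
  by rewrite coef1 /= expr0n subrr mul0r.
rewrite -!/(linprod _ _ _) !coefM !big_ord_recr !big_ord0 /= !add0r.
rewrite !coef_linfactor IHr coef1_linprod1 coef0_linprod.
by field.
Qed.

Lemma size_linfactor (S : nzRingType) (x y : S) : (size (x%:P + y *: 'X)%R <= 2)%N.
Proof.
rewrite (leq_trans (size_polyD _ _)) // geq_max.
rewrite (leq_trans (size_polyC_leq1 _)) //=.
by rewrite (leq_trans (size_scale_leq _ _)) // size_polyX.
Qed.

(** The outer variable goes with [b] and the inner one with [c]: the coefficient of u^i w^j has
    outer index i and inner index j. *)
Definition linprod2 r a b c : {poly {poly R}} :=
  \prod_(l <- r) (((a l)%:P + c l *: 'X)%:P + (b l)%:P *: 'X).

Lemma linprod2_expand r a b c u w :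
  \prod_(l <- r) (a l + u * b l + w * c l) =
  \sum_(i < (size r).+1) \sum_(j < (size r).+1)
    (linprod2 r a b c)`_i`_j * u ^+ i * w ^+ j.
Proof.
have [s1 s2] : (size (linprod2 r a b c) <= (size r).+1)%N /\
    forall i : nat, (size ((linprod2 r a b c)`_i)%R <= (size r).+1)%N.
  elim: r => [|l r [IH1 IH2]]; rewrite /linprod2 ?big_nil ?big_cons.
    split=> [|i]; first by rewrite size_poly1.
    by rewrite coef1; case: i => [|i] /=; rewrite ?size_poly1 ?size_poly0.
  rewrite -!/(linprod2 _ _ _ _); split=> [|i].
    rewrite (leq_trans (size_polyMleq _ _)) //.
    have := size_linfactor ((a l)%:P + c l *: 'X) (b l)%:P.
    by move=> h; rewrite -subn1 leq_subLR (leq_trans (leq_add h IH1)).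
  rewrite mulrDl mul_polyC -scalerAl mulrC coefD !coefZ coefMX.
  rewrite (leq_trans (size_polyD _ _)) // geq_max; apply/andP; split.
    rewrite (leq_trans (size_polyMleq _ _)) //.
    have := size_linfactor (a l) (c l).
    by move=> h; rewrite -subn1 leq_subLR (leq_trans (leq_add h (IH2 i))).
  case: ifP => _; first by rewrite mulr0 size_poly0.
  rewrite mul_polyC (leq_trans (size_scale_leq _ _)) //.
  by rewrite (leq_trans (IH2 _)).
have -> : \prod_(l <- r) (a l + u * b l + w * c l) = (linprod2 r a b c).[u%:P].[w].
  rewrite /linprod2 !horner_prod; apply: eq_bigr => l _.
  by rewrite !hornerE /=; ring.
rewrite (horner_coef_wide _ s1) horner_sum; apply: eq_bigr => i _.
rewrite hornerM -polyC_exp hornerC (horner_coef_wide _ (s2 i)) mulr_suml.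
by apply: eq_bigr => j _; rewrite mulrAC.
Qed.

End LinearFactors.

(** * Densities as permutation invariant forms in the curvature matrix *)

Section CurvaturePolynomial.
Context {R : realType} {D n : nat}.
Implicit Types (K X Y : 'I_D -> 'I_D -> R) (c : density R n).
Implicit Types (v : {ffun slot n -> 'I_D}) (a b : 'I_D).

Definition wt c v : R := \sum_s c s * ((\prod_l rdelta v l) * pairing s v).

Definition edge v X (l : 'I_n) : R := X (v (sl l 0)) (v (sl l 1)).

(** The weights do not depend on [K], so the density can be evaluated and differentiated at
    arbitrary matrices, not only at curvatures of the ansatz. *)
Definition phi c K : R := \sum_v wt c v * \prod_l edge v K l.

Definition phiP c K X : {poly R} :=
  \sum_v wt c v *: linprod (index_enum _) (edge v K) (edge v X).

Lemma phi_ctr c K : phi c K = \sum_s c s * ctr s K.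
Proof.
rewrite /phi; under eq_bigr do rewrite mulr_suml.
rewrite exchange_big; apply: eq_bigr => s _; rewrite mulr_sumr.
by apply: eq_bigr => v _; rewrite !mulrA.
Qed.

Lemma phiZD x y c1 c2 K : phi (x *: c1 + y *: c2) K = x * phi c1 K + y * phi c2 K.
Proof.
rewrite !phi_ctr !mulr_sumr -big_split; apply: eq_bigr => s _.
by rewrite !ffunE mulrDl !mulrA.
Qed.

Lemma horner_phiP c K X t :
  (phiP c K X).[t] = phi c (fun a b => K a b + t * X a b).
Proof.
rewrite horner_sum; apply: eq_bigr => v _.
by rewrite hornerZ horner_linprod.
Qed.

Lemma coef1_phiPD c K X Y x y :
  (phiP c K (fun a b => x * X a b + y * Y a b))`_1 =
  x * (phiP c K X)`_1 + y * (phiP c K Y)`_1.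
Proof.
rewrite !coef_sum !mulr_sumr -big_split; apply: eq_bigr => v _.
by rewrite !coefZ /edge coef1_linprodD /=; ring.
Qed.

Definition phiE c K X Y (i j : nat) : R := \sum_v wt c v *
  (linprod2 (index_enum _) (edge v K) (edge v X) (edge v Y))`_i`_j.

Lemma phi_expand2 c K X Y u w :
  phi c (fun a b => K a b + u * X a b + w * Y a b) =
  \sum_(i < n.+1) \sum_(j < n.+1) phiE c K X Y i j * u ^+ i * w ^+ j.
Proof.
have sz : size (index_enum 'I_n) = n by rewrite /index_enum -enumT size_enum_ord.
rewrite /phi (eq_bigr (fun v => \sum_(i < n.+1) \sum_(j < n.+1)
    wt c v * (linprod2 (index_enum _) (edge v K) (edge v X) (edge v Y))`_i`_j
      * u ^+ i * w ^+ j)); last first.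
  move=> v _; rewrite (linprod2_expand (index_enum _) (edge v K) (edge v X) (edge v Y)) sz.
  rewrite mulr_sumr; apply: eq_bigr => i _; rewrite mulr_sumr; apply: eq_bigr => j _.
  by rewrite !mulrA.
rewrite exchange_big; apply: eq_bigr => i _ /=.
rewrite exchange_big; apply: eq_bigr => j _ /=.
by rewrite /phiE !mulr_suml.
Qed.

(** Antisymmetry in the first index pair. Because of it, curvature matrices need only be compared
    off the diagonal. *)
Lemma wt_diag c v l : v (sl l 0) = v (sl l 1) -> wt c v = 0.
Proof.
move=> vl; rewrite /wt big1 // => s _; rewrite (bigD1 l) //= /rdelta vl.
by rewrite [(v (sl l 1) == v (sl l 3)) && _]andbC subrr !mul0r mulr0.
Qed.

(** Index values enter only through equality tests. This is the source of all later symmetry, in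
    particular between t and r. *)
Lemma wt_perm c v (s : {perm 'I_D}) : wt c [ffun x => s (v x)] = wt c v.
Proof.
apply: eq_bigr => t _; congr (_ * (_ * _)); apply: eq_bigr => l _.
  by rewrite /rdelta !ffunE !(inj_eq perm_inj).
by rewrite !ffunE !(inj_eq perm_inj).
Qed.

Lemma sum_perm (s : {perm 'I_D}) (F : {ffun slot n -> 'I_D} -> R) :
  \sum_v F v = \sum_(v : {ffun slot n -> 'I_D}) F [ffun x => s (v x)].
Proof.
rewrite (reindex_onto (fun v => [ffun x => s (v x)]) (fun v : {ffun slot n -> 'I_D} => [ffun x => s^-1%g (v x)])).
  apply: eq_bigl => v /=; apply/eqP/ffunP => x.
  by rewrite !ffunE permK.
by move=> v _ /=; apply/ffunP => x; rewrite !ffunE permKV.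
Qed.

Lemma phi_perm c K (s : {perm 'I_D}) :
  phi c (fun a b => K (s a) (s b)) = phi c K.
Proof.
rewrite [RHS]/phi (sum_perm s); apply: eq_bigr => v _; rewrite wt_perm.
by congr (_ * _); apply: eq_bigr => l _; rewrite /edge !ffunE.
Qed.

Lemma eq_phi c K K' : (forall a b, a != b -> K a b = K' a b) -> phi c K = phi c K'.
Proof.
move=> KK; apply: eq_bigr => v _.
have [/existsP[l /eqP vl]|] := boolP [exists l, v (sl l 0) == v (sl l 1)].
  by rewrite (wt_diag _ vl) !mul0r.
by move/existsPn => vl; congr (_ * _); apply: eq_bigr => l _; apply: KK.
Qed.

(* First and second derivatives of phi at the matrix with all entries 1,
   that is, at unit constant curvature. *)
Definition phi1 c X : R := \sum_v wt c v * \sum_l edge v X l.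
Definition phi2 c X Y : R := \sum_v wt c v *
  ((\sum_l edge v X l) * (\sum_l edge v Y l) - \sum_l edge v X l * edge v Y l).

Lemma coef1_phiP1 c X : (phiP c (fun _ _ => 1) X)`_1 = phi1 c X.
Proof. by rewrite coef_sum; apply: eq_bigr => v _; rewrite coefZ coef1_linprod1. Qed.

Lemma coef2_phiP1 c X : (phiP c (fun _ _ => 1) X)`_2 = phi2 c X X / 2.
Proof.
rewrite coef_sum /phi2 mulr_suml; apply: eq_bigr => v _.
by rewrite coefZ coef2_linprod1 mulrA; congr (_ * (_ - _) / _); apply: eq_bigr.
Qed.

Lemma phi2C c X Y : phi2 c X Y = phi2 c Y X.
Proof.
apply: eq_bigr => v _; rewrite [X in _ * (X - _)]mulrC; congr (_ * (_ - _)).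
by apply: eq_bigr => l _; rewrite mulrC.
Qed.

Lemma phi1_sum c (I : Type) (r : seq I) P (F : I -> 'I_D -> 'I_D -> R) :
  phi1 c (fun a b => \sum_(i <- r | P i) F i a b) = \sum_(i <- r | P i) phi1 c (F i).
Proof.
rewrite /phi1 exchange_big; apply: eq_bigr => v _ /=.
by rewrite -mulr_sumr exchange_big.
Qed.

Lemma phi2_sum c (I : Type) (r : seq I) P (F : I -> 'I_D -> 'I_D -> R) Y :
  phi2 c (fun a b => \sum_(i <- r | P i) F i a b) Y = \sum_(i <- r | P i) phi2 c (F i) Y.
Proof.
rewrite /phi2 exchange_big; apply: eq_bigr => v _ /=.
rewrite -mulr_sumr; congr (_ * _).
rewrite sumrB -mulr_suml; congr (_ * _ - _); first by rewrite exchange_big.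
rewrite [RHS]exchange_big; apply: eq_bigr => l _.
by rewrite /edge mulr_suml.
Qed.

Lemma phi2D c X X' Y : phi2 c (fun a b => X a b + X' a b) Y = phi2 c X Y + phi2 c X' Y.
Proof.
rewrite /phi2 -big_split; apply: eq_bigr => v _ /=; rewrite -mulrDr; congr (_ * _).
rewrite [\sum_l edge v (fun _ _ => _) l]big_split.
rewrite [X in _ - X](eq_bigr (fun l => edge v X l * edge v Y l + edge v X' l * edge v Y l)).
  by rewrite big_split /= -!/(edge _ _ _); ring.
by move=> l _; rewrite /edge mulrDl.
Qed.

Lemma eq_phi1 c X X' : (forall a b, a != b -> X a b = X' a b) -> phi1 c X = phi1 c X'.
Proof.
move=> XX; apply: eq_bigr => v _.
have [/existsP[l /eqP vl]|] := boolP [exists l, v (sl l 0) == v (sl l 1)].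
  by rewrite (wt_diag _ vl) !mul0r.
by move/existsPn => vl; congr (_ * _); apply: eq_bigr => l _; apply: XX.
Qed.

Lemma eq_phi2 c X X' Y Y' : (forall a b, a != b -> X a b = X' a b) ->
  (forall a b, a != b -> Y a b = Y' a b) -> phi2 c X Y = phi2 c X' Y'.
Proof.
move=> XX YY; apply: eq_bigr => v _.
have [/existsP[l /eqP vl]|] := boolP [exists l, v (sl l 0) == v (sl l 1)].
  by rewrite (wt_diag _ vl) !mul0r.
move/existsPn => vl; have eX l : edge v X l = edge v X' l by apply: XX.
have eY l : edge v Y l = edge v Y' l by apply: YY.
congr (_ * (_ * _ - _)); apply: eq_bigr => l _; rewrite ?eX ?eY //.
Qed.

Lemma phi1_perm c X (s : {perm 'I_D}) : phi1 c (fun a b => X (s a) (s b)) = phi1 c X.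
Proof.
rewrite [RHS]/phi1 (sum_perm s); apply: eq_bigr => v _; rewrite wt_perm.
by congr (_ * _); apply: eq_bigr => l _; rewrite /edge !ffunE.
Qed.

Lemma phi2_perm c X Y (s : {perm 'I_D}) :
  phi2 c (fun a b => X (s a) (s b)) (fun a b => Y (s a) (s b)) = phi2 c X Y.
Proof.
rewrite [RHS]/phi2 (sum_perm s); apply: eq_bigr => v _; rewrite wt_perm.
by congr (_ * (_ * _ - _)); apply: eq_bigr => l _; rewrite /edge !ffunE.
Qed.

(** Euler's identity for the gradient, which is homogeneous of degree n - 1. *)
Lemma phi2_const1 c X : phi2 c X (fun _ _ => 1) = (n%:R - 1) * phi1 c X.
Proof.
rewrite /phi2 mulr_sumr; apply: eq_bigr => v _.
rewrite /edge sumr_const card_ord.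
under [\sum_(i < n) _ * 1]eq_bigr do rewrite mulr1.
by ring.
Qed.

End CurvaturePolynomial.

(** * The block matrix of the ansatz and its index symmetry *)

Section BlockCurvature.
Context {R : realType} (m n : nat).
Local Notation D := m.+2.
Implicit Types (c : density R n) (a b i j : 'I_D) (A B psi : R).

(** The mixed pairs with t and with r have separate entries because of the two only [Bt] responds to
    N'. *)
Definition kmat (A Bt Br psi : R) a b : R :=
  if (a <= 1)%N && (b <= 1)%N then A
  else if (a == 0%N :> nat) || (b == 0%N :> nat) then Bt
  else if (a == 1%N :> nat) || (b == 1%N :> nat) then Br else psi.

Lemma lagrangian_phi c k (N f : R -> R) r : admissible N -> admissible f -> 0 < r ->
  lagrangian D k c N f r = N r * r ^+ m *
    phi c (kmat
      (- (derive1n 2 N r * f r + 3 / 2 * derive1 N r * derive1 f r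
          + N r * derive1n 2 f r / 2) / N r)
      (- derive1 f r / (2 * r) - f r * derive1 N r / (r * N r))
      (- derive1 f r / (2 * r)) ((k - f r) / r ^+ 2)).
Proof.
move=> hN hf r0; rewrite /lagrangian !subSS subn0; congr (_ * _).
rewrite phi_ctr; apply: eq_bigr => s _; congr (_ * _).
apply: (@contraction_ctr _ _ _ _ _ (hdiag k N f ^~ (base_point D r))).
- by move=> a; apply: hdiag_base_neq0.
- by move=> a b; apply: ginv_base.
- by move=> a b c' d; apply: riemann_base.
Qed.

Lemma kmatD A Bt Br psi A' Bt' Br' psi' t a b :
  kmat A Bt Br psi a b + t * kmat A' Bt' Br' psi' a b =
  kmat (A + t * A') (Bt + t * Bt') (Br + t * Br') (psi + t * psi') a b.
Proof. by rewrite /kmat; do 3!case: ifP => _ //. Qed.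

Definition i0 : 'I_D := ord0.
Definition i1 : 'I_D := Ordinal (isT : (1 < m.+2)%N).

Lemma tperm01_val a :
  tperm i0 i1 a = (if a == 0%N :> nat then 1 else if a == 1%N :> nat then 0 else a)%N :> nat.
Proof.
case: tpermP => [->|->|/eqP a0 /eqP a1] //.
by move: a0 a1; rewrite -!(inj_eq val_inj) /= => /negbTE -> /negbTE ->.
Qed.

Lemma phi_kmat_swap c A Bt Br psi : phi c (kmat A Bt Br psi) = phi c (kmat A Br Bt psi).
Proof.
rewrite -[RHS](phi_perm _ _ (tperm i0 i1)); apply: eq_phi => a b _.
by rewrite /kmat !tperm01_val; case: a b => [[|[|a]] ha] [[|[|b]] hb].
Qed.

(* On a symmetric index pair (i, j) this is the elementary symmetric matrix;
   the diagonal value 2 at a = b = i = j plays no role in curvatures. *)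
Definition elem a b i j : R := (i == a)%:R * (j == b)%:R + (i == b)%:R * (j == a)%:R.

Lemma elem_perm a b (s : {perm 'I_D}) i j :
  elem a b (s i) (s j) = elem (s^-1%g a) (s^-1%g b) i j.
Proof. by rewrite /elem -!(can2_eq (permK s) (permKV s)). Qed.

Section Second.
Variable c : density R n.
Let M a b i j := phi2 c (elem a b) (elem i j).

Let M_tperm x y a b i j :
  M a b i j = M (tperm x y a) (tperm x y b) (tperm x y i) (tperm x y j).
Proof.
rewrite /M -(phi2_perm c _ _ (tperm x y)).
by apply: eq_phi2 => a' b' _; rewrite elem_perm tpermV.
Qed.

Let M_diag a b i : M a b i i = 0.
Proof.
rewrite /M phi2C (@eq_phi2 _ _ _ _ _ (fun _ _ => 0) _ (elem a b)) //.
  rewrite /phi2 big1 // => v _; rewrite /edge sumr_const mul0rn mul0r big1 ?subr0 ?mulr0 // => l _.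
  by rewrite mul0r.
move=> a' b' ab; rewrite /elem; case: (a' =P i) ab => [->|_]; rewrite ?mul0r ?mulr0 ?addr0 //.
by rewrite eq_sym => /negbTE ->; rewrite /= !mulr0 addr0.
Qed.

Let MC a b i j : M a b i j = M b a i j.
Proof. by apply: eq_phi2 => a' b' _ //; rewrite /elem addrC. Qed.

Let MC2 a b i j : M a b i j = M a b j i.
Proof. by apply: eq_phi2 => a' b' _ //; rewrite /elem addrC. Qed.

Let sumI (F : 'I_D -> R) := \sum_(i < D | (1 < i)%N) F i.

Let sum_tperm i (F : 'I_D -> R) : (1 < i)%N ->
  sumI (fun j => F (tperm i1 i j)) = sumI F - F i + F i1.
Proof.
move=> hi; rewrite /sumI (bigD1 i) //= tpermR [in RHS](bigD1 i) //=.
rewrite (eq_bigr F); first by ring.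
move=> j /andP[j1 ji]; rewrite tpermD // 1?eq_sym //.
by apply: contraTneq j1 => ->.
Qed.

Let card_I : \sum_(i < D | (1 < i)%N) (1 : R) = m%:R.
Proof.
rewrite big_mkcond !big_ord_recl /= !add0r -[m in RHS]card_ord -sumr_const.
by apply: eq_bigr => i _.
Qed.

Let tp0 i : (1 < i)%N -> tperm i1 i i0 = i0.
Proof. by move=> hi; rewrite tpermD //; apply: contraTneq hi => ->. Qed.

Let tpI i : (1 < i)%N -> tperm i0 i1 i = i.
Proof. by move=> hi; rewrite tpermD //; apply: contraTneq hi => <-. Qed.

Lemma kmatE_elem a b : a != b -> kmat 1 0 0 0 a b = elem i0 i1 a b.
Proof.
by rewrite /elem; case: a b => [[|[|a]] ha] [[|[|b]] hb] //= _;
  rewrite /kmat /= ?(mul0r, mulr0, mul1r, addr0, add0r).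
Qed.

Lemma sum_delta_gt1 a (F : 'I_D -> R) :
  \sum_(i < D | (1 < i)%N) (a == i)%:R * F i = (1 < a)%:R * F a.
Proof.
have [ha|ha] := ltnP 1 a.
  rewrite (bigD1 a) //= eqxx !mul1r big1 ?addr0 // => i /andP[_].
  by rewrite eq_sym => /negbTE ->; rewrite mul0r.
rewrite big1 ?mul0r // => i hi.
by rewrite (_ : (a == i) = false) ?mul0r //; apply: contra_leqF ha => /eqP ->.
Qed.

Lemma sum_elem (i : 'I_D) a b : \sum_(j < D | (1 < j)%N) elem i j a b =
  (a == i)%:R * (1 < b)%:R + (1 < a)%:R * (b == i)%:R.
Proof.
rewrite big_split /=.
rewrite (eq_bigr (fun j => (b == j)%:R * (a == i)%:R)); last by move=> j _; rewrite mulrC.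
by rewrite sum_delta_gt1 (sum_delta_gt1 a (fun=> _)) mulrC.
Qed.

Lemma kmatU_elem a b : a != b -> kmat 0 1 1 0 a b =
  \sum_(i < D | (1 < i)%N) (elem i0 i a b + elem i1 i a b).
Proof.
rewrite big_split /= !sum_elem.
by case: a b => [[|[|a]] ha] [[|[|b]] hb] //= _;
  rewrite /kmat /= ?(mul0r, mulr0, mul1r, addr0, add0r).
Qed.

Lemma kmatT_elem a b : a != b -> kmat 0 0 0 2 a b =
  \sum_(i < D | (1 < i)%N) \sum_(j < D | (1 < j)%N) elem i j a b.
Proof.
move=> ab; under eq_bigr do rewrite sum_elem.
rewrite big_split /= sum_delta_gt1.
rewrite [X in _ + X](eq_bigr (fun i => (b == i)%:R * (1 < a)%:R)); last first.
  by move=> j _; rewrite mulrC.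
rewrite sum_delta_gt1.
by case: a b ab => [[|[|a]] ha] [[|[|b]] hb] //= _;
  rewrite /kmat /= ?(mul0r, mulr0, mul1r, addr0, add0r).
Qed.

(** By permutation invariance the Hessian on two elementary matrices is alpha, beta or gamma
    according as their index pairs coincide, share one index or are disjoint. Then EE = alpha, EU =
    2 m beta and UU = 2 m alpha + 2 m^2 beta + 2 m (m - 1) gamma, while Euler's identity gives (n -
    1) phi1(E) = alpha + 2 m beta + m (m - 1) gamma / 2. Eliminating beta and gamma leaves this
    relation. *)
Lemma second_order_symmetry :
  let E := kmat 1 0 0 0 in let U := kmat 0 1 1 0 in
  phi2 c U U = 2 * m%:R * phi2 c E E + m%:R * phi2 c E U
    + 4 * ((n%:R - 1) * phi1 c E - phi2 c E E - phi2 c E U).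
Proof.
move=> E U; pose e := M i0 i1.
have phE Y : phi2 c E Y = phi2 c (elem i0 i1) Y by apply: eq_phi2 => // a b /kmatE_elem.
have phU Y : phi2 c U Y = sumI (fun i => phi2 c (elem i0 i) Y + phi2 c (elem i1 i) Y).
  rewrite (eq_phi2 c kmatU_elem (fun a b _ => erefl (Y a b))) phi2_sum.
  by apply: eq_bigr => i _; rewrite phi2D.
have phT Y : phi2 c (kmat 0 0 0 2) Y = sumI (fun i => sumI (fun j => phi2 c (elem i j) Y)).
  rewrite (eq_phi2 c kmatT_elem (fun a b _ => erefl (Y a b))) phi2_sum.
  by apply: eq_bigr => i _; rewrite phi2_sum.
have EE : phi2 c E E = e i0 i1 by rewrite phE phi2C phE.
have bb : sumI (e i1) = sumI (e i0).
  by apply: eq_bigr => i hi; rewrite /e (M_tperm i0 i1) tpermL !tpermR tpI // MC.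
have EU : phi2 c E U = 2 * sumI (e i0).
  have S a : sumI (fun i => phi2 c (elem a i) E) = sumI (e a).
    by apply: eq_bigr => i _; rewrite phi2C phE.
  by rewrite phi2C phU /sumI big_split /= -!/(sumI _) !S bb; ring.
have ET : phi2 c E (kmat 0 0 0 2) = sumI (fun i => sumI (e i)).
  rewrite phi2C phT; apply: eq_bigr => i _; apply: eq_bigr => j _.
  by rewrite phi2C phE.
(* Euler's identity on the matrix of ones, E + U + T / 2: the double sum T counts each transverse
   pair twice. *)
have E1 : (n%:R - 1) * phi1 c E = e i0 i1 + 2 * sumI (e i0) + sumI (fun i => sumI (e i)) / 2.
  have T2 : phi2 c (kmat 0 0 0 2) E = 2 * phi2 c (kmat 0 0 0 1) E.
    rewrite (@eq_phi2 _ _ _ _ _ (fun a b => kmat 0 0 0 1 a b + kmat 0 0 0 1 a b) E E) //.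
      by rewrite phi2D; ring.
    by move=> a b _; rewrite /kmat; do !case: ifP => _; rewrite ?addr0 ?addr0 //; ring.
  rewrite -phi2_const1 -EE -EU -ET phi2C (phi2C c E (kmat 0 0 0 2)) T2.
  rewrite (@eq_phi2 _ _ _ _ _ (fun a b => E a b + (U a b + (kmat 0 0 0 1) a b)) E E) //.
    by rewrite 2!phi2D (phi2C c U E); field.
  by move=> a b _; rewrite /E /U /kmat; do !case: ifP => _; rewrite ?addr0 ?add0r.
(* The transposition of r and i brings the pair (0, i) to the reference pair (0, 1). *)
have X00 : sumI (fun i => sumI (M i0 i i0)) = m%:R * (sumI (e i0) + e i0 i1) - sumI (e i0).
  rewrite /sumI (eq_bigr (fun i => (sumI (e i0) + e i0 i1) * 1 - e i0 i)).
    by rewrite sumrB -mulr_sumr card_I mulrC.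
  move=> i hi; rewrite -/(sumI _) mulr1 addrAC -sum_tperm //; apply: eq_bigr => j _.
  by rewrite /e (M_tperm i1 i) tp0 // tpermR.
have X01 : sumI (fun i => sumI (M i0 i i1)) = sumI (fun i => sumI (e i)) + sumI (e i0).
  rewrite -bb /sumI -big_split /=; apply: eq_bigr => i hi.
  rewrite -!/(sumI _) (_ : e i1 i = - e i i + e i i1); last by rewrite /e M_diag oppr0 add0r MC2.
  rewrite addrA -sum_tperm //; apply: eq_bigr => j _.
  by rewrite /e (M_tperm i1 i) tp0 // tpermR tpermL.
have UU : phi2 c U U = sumI (fun i => sumI (M i0 i i0)) + sumI (fun i => sumI (M i0 i i1))
    + (sumI (fun i => sumI (M i0 i i0)) + sumI (fun i => sumI (M i0 i i1))).
  rewrite phU /sumI -!big_split /=; apply: eq_bigr => i hi; rewrite -!/(sumI _).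
  rewrite phi2C phU [X in _ + X]phi2C phU /sumI -!big_split /=; apply: eq_bigr => j hj.
  rewrite !(phi2C _ (elem _ j)) -!/(M _ _ _ _) (M_tperm i0 i1 i1 i) (M_tperm i0 i1 i1 i i1).
  by rewrite tpermL tpermR !tpI //; ring.
by rewrite UU X00 X01 E1 EE EU; field.
Qed.

(** All off-diagonal elementary matrices are conjugate under permutations, and the matrix on the
    left is a sum of 2 m of them. *)
Lemma first_order_symmetry : phi1 c (kmat 0 1 1 0) = 2 * m%:R * phi1 c (kmat 1 0 0 0).
Proof.
have eqE (x y a b : 'I_D) (s : {perm 'I_D}) : s a = x -> s b = y ->
    phi1 c (elem a b) = phi1 c (elem x y).
  move=> <- <-; rewrite -(phi1_perm c (elem (s a) (s b)) s); apply: eq_phi1 => i j _.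
  by rewrite elem_perm !permK.
have phi1D X Y : phi1 c (fun a b => X a b + Y a b) = phi1 c X + phi1 c Y.
  rewrite /phi1 -big_split; apply: eq_bigr => v _ /=.
  by rewrite -mulrDr -big_split.
rewrite (eq_phi1 c kmatU_elem) phi1_sum (eq_phi1 c kmatE_elem).
rewrite (eq_bigr (fun i => 2 * phi1 c (elem i0 i1) * 1)).
  by rewrite -mulr_sumr card_I; ring.
move=> i hi; rewrite phi1D (eqE i0 i1 i0 i (tperm i1 i)) ?tp0 ?tpermR //.
rewrite (eqE i1 i0 i1 i (tperm i0 i)) ?tpermR //; last first.
  by rewrite tpermD //; apply: contraTneq hi => ->.
rewrite (eqE i0 i1 i1 i0 (tperm i0 i1)) ?tpermL ?tpermR //; ring.
Qed.


End Second.
End BlockCurvature.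

(** * Total derivatives *)

Section BinaryForms.
Context {R : realType}.
Implicit Types (p q : {poly R}) (x y t : R).

(* The binary form of degree n with dehomogenization p at y = 1. *)
Definition hom n p x y : R := \sum_(j < n.+1) p`_j * x ^+ j * y ^+ (n - j).

(* The form hom n (dhom n.+1 p) is the partial derivative in y of hom n.+1 p. *)
Definition dhom n p : {poly R} := n%:R *: p - 'X * p^`().

Lemma coef_dhom n p j : (dhom n p)`_j = (n%:R - j%:R) * p`_j.
Proof.
rewrite coefB coefZ coefXM coef_deriv mulrBl; congr (_ - _).
by case: j => [|j] /=; rewrite ?mul0r // mulr_natl.
Qed.

Lemma homD n p q x y : hom n (p + q) x y = hom n p x y + hom n q x y.
Proof. by rewrite -big_split; apply: eq_bigr => j _; rewrite coefD !mulrDl. Qed.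

Lemma homZ n a p x y : hom n (a *: p) x y = a * hom n p x y.
Proof. by rewrite mulr_sumr; apply: eq_bigr => j _; rewrite coefZ !mulrA. Qed.

Lemma homB n p q x y : hom n (p - q) x y = hom n p x y - hom n q x y.
Proof. by rewrite -[- q]scaleN1r homD homZ mulN1r. Qed.

Lemma hom0 n x y : hom n 0 x y = 0.
Proof. by rewrite -(scale0r (0 : {poly R})) homZ mul0r. Qed.

Lemma homMx n p x y : x * hom n p x y = hom n.+1 ('X * p) x y.
Proof.
rewrite /hom [RHS]big_ord_recl coefXM mul0r mul0r add0r mulr_sumr.
by apply: eq_bigr => j _; rewrite coefXM /= exprS subSS; ring.
Qed.

Lemma homMy n p x y : p`_n.+1 = 0 -> y * hom n p x y = hom n.+1 p x y.
Proof.
move=> p0; rewrite /hom [RHS]big_ord_recr /= p0 !mul0r addr0 mulr_sumr.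
by apply: eq_bigr => j _; rewrite subSn ?exprS -1?ltnS //; ring.
Qed.

Lemma hom_euler n p x y :
  x * hom n p^`() x y + y * hom n (dhom n.+1 p) x y = n.+1%:R * hom n.+1 p x y.
Proof.
rewrite homMx homMy ?coef_dhom ?subrr ?mul0r // -homD -homZ; congr (hom _ _ _ _).
by rewrite /dhom addrC subrK.
Qed.

Lemma hom1 n p x : (size p <= n.+1)%N -> hom n p x 1 = p.[x].
Proof.
move=> sp; rewrite (horner_coef_wide _ sp); apply: eq_bigr => j _.
by rewrite expr1n mulr1.
Qed.

(** A form is determined on any line y = const other than y = 0; identities known on the slice psi =
    -1 extend in this way. *)
Lemma hom_inj n p q y : y != 0 -> (forall x, hom n p x y = hom n q x y) ->
  forall j, (j <= n)%N -> p`_j = q`_j.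
Proof.
move=> y0 pq j jn.
have := @coef_inj_wide _ n.+1 (fun i => p`_i * y ^+ (n - i)) (fun i => q`_i * y ^+ (n - i)).
move=> /(_ _ j jn) h; apply: (mulIf (expf_neq0 (n - j) y0)); apply: h => t.
have := pq t; rewrite /hom => e.
by etransitivity; [|etransitivity; [exact: e|]]; apply: eq_bigr => i _; rewrite mulrAC.
Qed.

Lemma eq_hom n p q x y : (forall j, (j <= n)%N -> p`_j = q`_j) -> hom n p x y = hom n q x y.
Proof. by move=> pq; apply: eq_bigr => j _; rewrite pq // -ltnS. Qed.

Lemma is_derive_bigsum (I : Type) (r : seq I) (F : I -> R -> R) (d : I -> R) (s : R) :
  (forall i, is_derive s 1 (F i) (d i)) ->
  is_derive s 1 (fun t => \sum_(i <- r) F i t) (\sum_(i <- r) d i).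
Proof.
move=> Fd; elim: r => [|i r IHr].
  by rewrite big_nil; under eq_fun do rewrite big_nil; apply: is_derive_const.
rewrite big_cons; under eq_fun do rewrite big_cons.
exact: is_derive_add.
Qed.

Lemma is_derive_hom n p (a b : R -> R) (s a' b' : R) :
  is_derive s 1 a a' -> is_derive s 1 b b' ->
  is_derive s 1 (fun t => hom n.+1 p (a t) (b t))
    (hom n p^`() (a s) (b s) * a' + hom n (dhom n.+1 p) (a s) (b s) * b').
Proof.
move=> da db; rewrite /hom.
notypeclasses refine (is_derive_cast _ _).
  apply: is_derive_bigsum => j.
  by notypeclasses refine (is_derive_mul _ _);
    [derivation | notypeclasses refine (is_derive_exp _ db)].
rewrite /= big_split /= addrC; congr (_ + _).
  rewrite big_ord_recl /= !mul0r !mulr0 addr0 mulr0 add0r mulr_suml.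
  by apply: eq_bigr => j _; rewrite coef_deriv /bump /= add1n subSS -mulr_natl; ring.
rewrite big_ord_recr /= subnn !mul0r mulr0 addr0 mulr_suml.
apply: eq_bigr => j _; have jn : (j <= n)%N by rewrite -ltnS.
have -> : (dhom n.+1 p)`_j = (n - j).+1%:R * p`_j.
  by rewrite coef_dhom -subSn // natrB // ltnW.
by rewrite subSn //=; move: ((n - j).+1%:R : R) => e; ring.
Qed.

End BinaryForms.

(** * The two constraints on g *)

Section SymmetryConstraints.
Context {R : realType} (m n : nat).
Local Notation D := m.+2.
Implicit Types (c : density R n.+1) (g : {poly R}) (A B psi : R).

Definition reduced c A B psi : R := phi (D := D) c (kmat A B B psi).

(* With G = hom n.+1 g (B, psi), the derivative of r ^ (D - 1) G along the
   ansatz is r ^ (D - 2) times this polynomial. *)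
Definition total g A B psi : R :=
  m.+1%:R * hom n.+1 g B psi + (A - B) * hom n g^`() B psi
  + 2 * (B - psi) * hom n (dhom n.+1 g) B psi.

(** Expand at unit constant curvature in the direction (a, 1, 1, 0). As [total] is affine in A, the
    Hessian is 0 on EE and g''(1) on EU. The second order relation then collapses to g''(1) = 0, and
    the first order one to the relation between g'(1) and g(1). *)
Lemma reduced_total_constraints c g : (size g <= n.+2)%N ->
  (forall A B psi, reduced c A B psi = total g A B psi) ->
  g^`()^`().[1] = 0 /\ D%:R * g^`().[1] = 2 * n.+1%:R * g.[1].
Proof.
move=> sg cg; pose h := g \Po ('X + 1%:P).
pose X a := kmat a 1 1 0 : 'I_D -> 'I_D -> R.
have sg' : (size g^`() <= n.+1)%N.
  by apply/leq_sizeP => j nj; move/leq_sizeP: sg => sg; rewrite coef_deriv sg ?mul0rn.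
(* [total g] along this direction, with h(t) = g(1 + t). *)
pose P a : {poly R} := m.+1%:R *: h + (a - 1) *: ('X * h^`())
   + 2 *: ('X * (n.+1%:R *: h - ('X * h^`() + h^`()))).
have dh : h^`() = g^`() \Po ('X + 1%:P).
  by rewrite /h deriv_comp derivD derivX derivC addr0 mulr1.
have eP a : phiP c (fun _ _ => 1) (X a) = P a.
  apply: horner_inj => t; rewrite horner_phiP.
  rewrite (@eq_phi _ _ _ _ _ (kmat (1 + t * a) (1 + t) (1 + t) 1)); last first.
    by move=> i j _; rewrite /X /kmat; do !case: ifP => _; rewrite ?mulr1 ?mulr0 ?addr0.
  have := cg (1 + t * a) (1 + t) 1; rewrite /reduced => ->; rewrite /total !hom1 //; last first.
    apply/leq_sizeP => j nj; rewrite coef_dhom; move: nj.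
    rewrite leq_eqVlt => /orP[/eqP <-|nj]; first by rewrite subrr mul0r.
    by move/leq_sizeP: sg => ->; rewrite ?mulr0.
  rewrite /P dh /h /dhom !(hornerE, horner_comp) /= (addrC t 1).
  by ring.
have hh (q : {poly R}) : (q \Po ('X + 1%:P))`_0 = q.[1].
  by rewrite -[LHS]horner_coef0 horner_comp !hornerE.
have h0 : h`_0 = g.[1] by rewrite hh.
have h1 : h`_1 = g^`().[1] by rewrite -hh -dh coef_deriv mulr1n.
have h2 : 2 * h`_2 = g^`()^`().[1].
  have ddh : h^`()^`() = g^`()^`() \Po ('X + 1%:P).
    by rewrite dh deriv_comp derivD derivX derivC addr0 mulr1.
  by rewrite -hh -ddh !coef_deriv mulr1n mulr_natl.
have c1 a : phi1 c (X a) = m.+1%:R * h`_1 + (a - 1) * h`_1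
    + 2 * (n.+1%:R * h`_0 - h`_1).
  rewrite -coef1_phiP1 eP /P !(coefD, coefN, coefZ, coefXM) /= coef_deriv add0r.
  by rewrite mulr1n.
have c2 a : phi2 c (X a) (X a) = 2 * (m.+1%:R * h`_2 + (a - 1) * (2 * h`_2)
    + 2 * (n.+1%:R * h`_1 - h`_1 - 2 * h`_2)).
  have -> : phi2 c (X a) (X a) = 2 * (phi2 c (X a) (X a) / 2) by field.
  rewrite -coef2_phiP1 eP /P !(coefD, coefN, coefZ, coefXM) /= !coef_deriv.
  by ring.
pose E := kmat 1 0 0 0 : 'I_D -> 'I_D -> R.
have ext1 a (Y : 'I_D -> 'I_D -> R) : phi2 c (X (a + 1)) Y = phi2 c E Y + phi2 c (X a) Y.
  rewrite -phi2D; apply: eq_phi2 => // i j _.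
  by rewrite /X /E /kmat; do !case: ifP => _; rewrite ?add0r ?addr0 // addrC.
have ext2 a : phi2 c (X (a + 1)) (X (a + 1)) =
    phi2 c E E + 2 * phi2 c E (X a) + phi2 c (X a) (X a).
  rewrite ext1 (phi2C c E) ext1 (phi2C c (X a) (X _)) ext1 (phi2C c (X a) E); ring.
have e1 : phi1 c (X (0 + 1)) = phi1 c E + phi1 c (X 0).
  rewrite /phi1 -big_split; apply: eq_bigr => v _ /=; rewrite -mulrDr -big_split /=.
  congr (_ * _); apply: eq_bigr => l _.
  by rewrite /edge /X /E /kmat; do !case: ifP => _; rewrite ?add0r ?addr0.
have e11 := ext2 1; have e10 := ext1 0 E; have e00 := ext2 0.
have dE : phi1 c E = h`_1 by move: e1; rewrite !c1 => e; lra.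
rewrite add0r in e10; move: e11 e00; rewrite (phi2C c E (X 1)) e10 (phi2C c (X 0)).
rewrite !c2 => e11 e00.
have EE : phi2 c E E = 0 by lra.
have EU : phi2 c E (X 0) = 2 * h`_2 by lra.
have := second_order_symmetry m c; rewrite /= -/E -/(X 0) c2 EE EU dE => so.
have := first_order_symmetry m c; rewrite -/E -/(X 0) c1 dE => fo.
rewrite -h0 -h1 -h2; move: so fo; rewrite -!natr1 => so fo.
by split; lra.
Qed.

End SymmetryConstraints.

(** * Monomial expansion of the reduced density *)

Section MonomialSums.
Context {R : realType} {I : Type}.
Implicit Types (r : seq I) (w : I -> R) (a b c : I -> nat) (A B psi : R).

Definition msum r w a b c A B psi : R :=
  \sum_(v <- r) w v * A ^+ a v * B ^+ b v * psi ^+ c v.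

(* H has partial derivatives HA, HB, Hp, in the form of the chain rule. *)
Definition chain3 (H HA HB Hp : R -> R -> R -> R) :=
  forall (x y z : R -> R) (s x' y' z' : R),
    is_derive s 1 x x' -> is_derive s 1 y y' -> is_derive s 1 z z' ->
    is_derive s 1 (fun t => H (x t) (y t) (z t))
      (HA (x s) (y s) (z s) * x' + HB (x s) (y s) (z s) * y'
       + Hp (x s) (y s) (z s) * z').

Lemma chain3_msum r w a b c : chain3 (msum r w a b c)
  (msum r (fun v => w v * (a v)%:R) (fun v => (a v).-1) b c)
  (msum r (fun v => w v * (b v)%:R) a (fun v => (b v).-1) c)
  (msum r (fun v => w v * (c v)%:R) a b (fun v => (c v).-1)).
Proof.
move=> x y z s x' y' z' dx dy dz; rewrite /msum.
notypeclasses refine (is_derive_cast _ _).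
  by apply: is_derive_bigsum => v; derivation.
rewrite !mulr_suml -!big_split; apply: eq_bigr => v _ /=.
by rewrite !mulr0 !addr0; ring.
Qed.

Lemma chain3_exists r w a b c : exists HA HB Hp, chain3 (msum r w a b c) HA HB Hp.
Proof. by do 3!eexists; exact: chain3_msum. Qed.

End MonomialSums.

Section ReducedExpansion.
Context {R : realType} (m n : nat).
Local Notation D := m.+2.
Implicit Types (c : density R n) (v : {ffun slot n -> 'I_D}).

(** Counts the Riemann factors whose first index pair lies in the (t, r) plane; [nB] counts the
    mixed pairs. *)
Definition nA v : nat := \sum_(l < n) ((v (sl l 0) <= 1) && (v (sl l 1) <= 1))%N.
Definition nB v : nat := \sum_(l < n) ((v (sl l 0) <= 1) (+) (v (sl l 1) <= 1)).

Lemma nAB_le v : (nA v + nB v <= n)%N.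
Proof.
rewrite -big_split -[n in leqRHS]card_ord -sum1_card; apply: leq_sum => l _ /=.
by case: (v _ <= 1)%N; case: (v _ <= 1)%N.
Qed.

Lemma phi_kmat_msum c A B psi : phi (D := D) c (kmat A B B psi) =
  msum (index_enum _) (wt c) nA nB (fun v => n - nA v - nB v)%N A B psi.
Proof.
apply: eq_bigr => v _; rewrite -!mulrA; congr (_ * _).
have -> : (n - nA v - nB v = \sum_(l < n) ((1 < v (sl l 0)) && (1 < v (sl l 1))))%N.
  rewrite -[n in LHS](_ : \sum_(l < n) 1 = n)%N; last by rewrite sum1_card card_ord.
  apply/eqP; rewrite -subnDA; apply/eqP.
  rewrite -[X in (X - _)%N](_ : (nA v + nB v
     + \sum_(l < n) ((1 < v (sl l 0)) && (1 < v (sl l 1))) = _)%N) ?addKn //.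
  rewrite -!big_split; apply: eq_bigr => l _ /=.
  by rewrite !(ltnNge 1); case: (v _ <= 1)%N; case: (v _ <= 1)%N.
rewrite !expr_sum -!big_split; apply: eq_bigr => l _ /=; rewrite /edge /kmat.
move: (v (sl l 0)) (v (sl l 1)) => i j; case: i j => [[|[|i]] hi] [[|[|j]] hj] /=;
by rewrite ?(expr0, expr1, mulr1, mul1r).
Qed.

Definition coefA c i : {poly R} :=
  \sum_(v : {ffun slot n -> 'I_D} | nA v == i) wt c v *: 'X^(nB v).

Lemma phi_kmat_hom c A B psi : phi (D := D) c (kmat A B B psi) =
  \sum_(i < n.+1) A ^+ i * hom (n - i) (coefA c i) B psi.
Proof.
rewrite phi_kmat_msum /msum.
have vn v : (nA v < n.+1)%N by rewrite ltnS (leq_trans _ (nAB_le v)) // leq_addr.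
rewrite (partition_big (fun v => Ordinal (vn v)) predT) //=.
apply: eq_bigr => i _.
have homX j x y : (j <= n - i)%N -> hom (n - i) 'X^j x y = x ^+ j * y ^+ (n - i - j) :> R.
  move=> ji; rewrite /hom (bigD1 (Ordinal (ji : (j < (n - i).+1)%N))) //= coefXn eqxx mul1r.
  rewrite big1 ?addr0 // => l /eqP li; rewrite coefXn; case: eqP => [lj|_]; last by rewrite !mul0r.
  by case: li; apply/val_inj.
have -> : hom (n - i) (coefA c i) B psi =
    \sum_(v | nA v == i) wt c v * (B ^+ nB v * psi ^+ (n - i - nB v)).
  rewrite /coefA; elim/big_rec2: _ => [|v x p vi <-]; first by rewrite hom0.
  rewrite homD homZ homX // -(eqP vi) leq_subRL ?nAB_le //.
  by rewrite (leq_trans _ (nAB_le v)) // leq_addr.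
rewrite mulr_sumr; apply: eq_big => [v|v /eqP vi]; first by rewrite -(inj_eq val_inj).
by rewrite -vi /=; ring.
Qed.

End ReducedExpansion.

(** * Vanishing Euler-Lagrange expressions *)

Section ExponentialJets.
Context {R : realType}.
Implicit Types (p q : {poly R}) (r s x y : R).

(** Exponentials of polynomials are positive and smooth, as [admissible] demands, and realize every
    jet with positive value. *)
Definition exppoly p (s : R) : R := expR p.[s].

Fixpoint expder p n : {poly R} :=
  if n is n'.+1 then (expder p n')^`() + expder p n' * p^`() else 1.

Lemma derive1n_exppoly p n s : derive1n n (exppoly p) s = (expder p n).[s] * exppoly p s.
Proof.
elim: n s => [|n IHn] s; first by rewrite /= hornerC mul1r.
have -> : derive1n n.+1 (exppoly p) = derive1 (derive1n n (exppoly p)) by [].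
have -> : derive1n n (exppoly p) = (fun s => (expder p n).[s] * expR p.[s]).
  by apply/funext => t; rewrite IHn.
apply: derive1_is; notypeclasses refine (is_derive_cast _ _).
  notypeclasses refine (is_derive_mul _ _); first exact: is_derive_poly.
  notypeclasses refine (is_derive_compose _ _); first exact: is_derive_expR.
  exact: is_derive_poly.
by rewrite /exppoly /= hornerD hornerM; ring.
Qed.

Lemma admissible_exppoly p : admissible (exppoly p).
Proof.
move=> r r0; split=> [|n]; first exact: expR_gt0.
have -> : derive1n n (exppoly p) = (fun s => (expder p n).[s] * expR p.[s]).
  by apply/funext => t; rewrite derive1n_exppoly.
by have [] := is_derive_mul (is_derive_poly (expder p n) r)
  (is_derive_compose (is_derive_expR p.[r]) (is_derive_poly p r)).
Qed.

Lemma exppoly_jet p s : (derive1 (exppoly p) s = p^`().[s] * exppoly p s) *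
  (derive1n 2 (exppoly p) s = (p^`()^`().[s] + p^`().[s] ^+ 2) * exppoly p s).
Proof.
have e1 := derive1n_exppoly p 1 s; have e2 := derive1n_exppoly p 2 s.
split; last by rewrite e2 /= !(derivD, derivM, derivC, hornerE) /=; ring.
by move: e1; rewrite /= !(derivD, derivM, derivC, hornerE) => <-.
Qed.

(** Hermite interpolation: the factor X1^3 leaves the jet at r1 untouched, and e0, e1, e2 are solved
    successively from the value and the two derivatives at r2. *)
Lemma interpolate2 r1 r2 a0 a1 a2 b0 b1 b2 : r1 != r2 ->
  exists p : {poly R},
    [/\ p.[r1] = a0, p^`().[r1] = a1, p^`()^`().[r1] = a2 &
     [/\ p.[r2] = b0, p^`().[r2] = b1 & p^`()^`().[r2] = b2]].
Proof.
move=> r12; pose d := r2 - r1; have d0 : d != 0 by rewrite subr_eq0 eq_sym.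
pose X1 : {poly R} := 'X - r1%:P; pose X2 : {poly R} := 'X - r2%:P.
pose e0 := (b0 - (a0 + a1 * d + a2 / 2 * d ^+ 2)) / d ^+ 3.
pose e1 := (b1 - (a1 + a2 * d) - 3 * d ^+ 2 * e0) / d ^+ 3.
pose e2 := (b2 - a2 - 6 * d * e0 - 6 * d ^+ 2 * e1) / (2 * d ^+ 3).
exists (a0%:P + a1 *: X1 + (a2 / 2) *: (X1 * X1)
  + X1 * X1 * X1 * (e0%:P + e1 *: X2 + e2 *: (X2 * X2))).
have h1 : (X1.[r1] = 0) * (X2.[r2] = 0) * (X1.[r2] = d).
  by rewrite /X1 /X2 !hornerE !subrr.
have h2 : (X1^`() = 1) * (X2^`() = 1) by rewrite !derivB !derivC !derivX !subr0.
have deriv1 : (1 : {poly R})^`() = 0 by rewrite -polyC1 derivC.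
move: X1 X2 h1 h2 => X1 X2 h1 h2.
have hornerRE := (hornerD, hornerM, hornerZ, hornerC, hornerX).
have simp0 := (mul1r, mulr1, addr0, add0r, mul0r, mulr0).
have derivRE := (derivD, derivM, derivZ, derivC, h2, deriv1).
have horner1 s : (1 : {poly R}).[s] = 1 by rewrite -polyC1 hornerC.
split; [| | |split]; rewrite ?(derivRE, simp0) ?(hornerRE, horner1, h1, simp0) //.
all: rewrite ?/e2 ?/e1 ?/e0; field.
all: by rewrite ?d0.
Qed.

Lemma admissible_interpolation r1 r2 y0 y1 y2 z0 z1 z2 : r1 != r2 -> 0 < y0 -> 0 < z0 ->
  exists f : R -> R, [/\ admissible f,
    [/\ f r1 = y0, derive1 f r1 = y1 & derive1n 2 f r1 = y2] &
    [/\ f r2 = z0, derive1 f r2 = z1 & derive1n 2 f r2 = z2]].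
Proof.
move=> r12 y0p z0p; have y0n : y0 != 0 by rewrite gt_eqF.
have z0n : z0 != 0 by rewrite gt_eqF.
have [p [p0 p1 p2 [q0 q1 q2]]] := interpolate2 (ln y0) (y1 / y0) (y2 / y0 - (y1 / y0) ^+ 2)
  (ln z0) (z1 / z0) (z2 / z0 - (z1 / z0) ^+ 2) r12.
exists (exppoly p); split; first exact: admissible_exppoly.
- have ye : exppoly p r1 = y0 by rewrite /exppoly p0 lnK // posrE.
  by rewrite !exppoly_jet p1 p2 ye; split=> //; field.
- have ze : exppoly p r2 = z0 by rewrite /exppoly q0 lnK // posrE.
  by rewrite !exppoly_jet q1 q2 ze; split=> //; field.
Qed.

Lemma admissible_jet r y0 y1 y2 : 0 < y0 -> exists f : R -> R, [/\ admissible f,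
  f r = y0, derive1 f r = y1 & derive1n 2 f r = y2].
Proof.
move=> y0p; have r1 : r != r + 1 by rewrite eq_sym -subr_eq0 addrAC subrr add0r oner_eq0.
have [f [fa [f0 f1 f2] _]] := admissible_interpolation y1 y2 0 0 r1 y0p y0p.
by exists f.
Qed.

Lemma admissible_jet4 r y0 y1 y2 : 0 < y0 -> exists f g : R -> R,
  [/\ admissible f, admissible g,
   [/\ f r = y0, derive1 f r = y1 & derive1n 2 f r = y2],
   [/\ g r = y0, derive1 g r = y1 & derive1n 2 g r = y2] &
   derive1n 3 f r = derive1n 3 g r /\ derive1n 4 f r != derive1n 4 g r].
Proof.
move=> y0p; have y0n : y0 != 0 by rewrite gt_eqF.
have r1 : r != r + 1 by rewrite eq_sym -subr_eq0 addrAC subrr add0r oner_eq0.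
have [p [p0 p1 p2 _]] := interpolate2 (ln y0) (y1 / y0) (y2 / y0 - (y1 / y0) ^+ 2) 0 0 0 r1.
(* Adding (s - r)^4 to the exponent changes no derivative at r below the fourth. *)
pose X : {poly R} := 'X - r%:P; pose q : {poly R} := p + X * X * X * X.
have X0 : X.[r] = 0 by rewrite /X !hornerE subrr.
have X1 : X^`() = 1 by rewrite derivB derivC derivX subr0.
clearbody X.
have deriv1 : (1 : {poly R})^`() = 0 by rewrite -polyC1 derivC.
have horner1 s : (1 : {poly R}).[s] = 1 by rewrite -polyC1 hornerC.
have hornerRE := (hornerD, hornerM, hornerZ, hornerC, hornerX, horner1, X0).
have derivRE := (derivD, derivM, derivZ, derivC, X1, deriv1).
have simp0 := (mul1r, mulr1, addr0, add0r, mul0r, mulr0).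
have e0 : q.[r] = p.[r] by rewrite /q ?(hornerRE, simp0).
have e1 : q^`().[r] = p^`().[r] by rewrite /q ?(derivRE, simp0) ?(hornerRE, simp0).
have e2 : q^`()^`().[r] = p^`()^`().[r].
  by rewrite /q ?(derivRE, simp0) ?(hornerRE, simp0).
have e3 : q^`()^`()^`().[r] = p^`()^`()^`().[r].
  by rewrite /q ?(derivRE, simp0) ?(hornerRE, simp0).
have e4 : q^`()^`()^`()^`().[r] = p^`()^`()^`()^`().[r] + 24.
  rewrite /q ?(derivRE, simp0) ?(hornerRE, simp0); congr (_ + _); ring.
have pe : exppoly p r = y0 by rewrite /exppoly p0 lnK // posrE.
have qe : exppoly q r = y0 by rewrite /exppoly e0 p0 lnK // posrE.
exists (exppoly p), (exppoly q); split; try exact: admissible_exppoly.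
- by rewrite !exppoly_jet p1 p2 pe; split=> //; field.
- by rewrite !exppoly_jet e1 e2 p1 p2 qe; split=> //; field.
rewrite !derive1n_exppoly pe qe /= !(mul1r, mulr1, deriv1, add0r).
clearbody q; rewrite !(derivD, derivM) !(hornerD, hornerM) e1 e2 e3 e4.
split=> //; rewrite -subr_eq0; apply: contraNneq y0n => h.
have : 24 * y0 = 0 by rewrite -oppr0 -h; ring.
by lra.
Qed.

End ExponentialJets.

(** * The Euler-Lagrange expression in terms of A, B and psi *)

Section EulerLagrangeReduction.
Context {R : realType} (m : nat) (k : R).
Implicit Types (f : R -> R) (r s : R) (L : jetfun R) (P : R -> R -> R -> R).

Lemma derive1_pos_eq (f g : R -> R) r : 0 < r ->
  (forall s, 0 < s -> f s = g s) -> derive1 f r = derive1 g r.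
Proof.
move=> r0 fg; rewrite !derive1E; apply: near_eq_derive.
by near=> s; apply: fg; near: s; exact: lt_nbhsr.
Unshelve. all: by end_near. Qed.

Lemma derive1n2_pos_eq (f g : R -> R) r : 0 < r ->
  (forall s, 0 < s -> f s = g s) -> derive1n 2 f r = derive1n 2 g r.
Proof.
move=> r0 fg; apply: (@derive1_pos_eq (derive1 f) (derive1 g)) => // s s0.
exact: derive1_pos_eq.
Qed.

Definition Af f s : R := - derive1n 2 f s / 2.
Definition Bf f s : R := - derive1 f s / (2 * s).
Definition pf f s : R := (k - f s) / s ^+ 2.
Definition on P f s : R := P (Af f s) (Bf f s) (pf f s).

Definition reduces_to L P := forall r y0 y1 y2, 0 < r -> 0 < y0 ->
  L r y0 y1 y2 = r ^+ m * P (- y2 / 2) (- y1 / (2 * r)) ((k - y0) / r ^+ 2).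

Variables (f : R -> R) (hf : admissible f).

Lemma is_derive_Af s : 0 < s -> is_derive s 1 (Af f) (- derive1n 3 f s / 2).
Proof.
move=> s0; have d2 := admissible_der 2 hf s0.
by rewrite /Af; derive_to; rewrite /=; gen_derive; field.
Qed.

(** With [is_derive_pf] this closes the calculus: along the ansatz only differentiating A introduces
    a new derivative of f. *)
Lemma is_derive_Bf s : 0 < s -> is_derive s 1 (Bf f) ((Af f s - Bf f s) / s).
Proof.
move=> s0; have d1 := admissible_der1 hf s0; have sn : s != 0 by rewrite gt_eqF.
rewrite /Bf /Af; derive_to; first by rewrite mulf_neq0 // pnatr_eq0.
by rewrite /=; gen_derive; field.
Qed.

Lemma is_derive_pf s : 0 < s -> is_derive s 1 (pf f) (2 * (Bf f s - pf f s) / s).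
Proof.
move=> s0; have d0 := admissible_der0 hf s0; have sn : s != 0 by rewrite gt_eqF.
rewrite /pf /Bf; derive_to; first by rewrite expf_neq0.
by rewrite /=; gen_derive; field.
Qed.

Lemma is_derive_on P PA PB Pp s : 0 < s -> chain3 P PA PB Pp ->
  is_derive s 1 (on P f) (on PA f s * (- derive1n 3 f s / 2)
    + on PB f s * ((Af f s - Bf f s) / s) + on Pp f s * (2 * (Bf f s - pf f s) / s)).
Proof.
move=> s0; apply; [exact: is_derive_Af|exact: is_derive_Bf|exact: is_derive_pf].
Qed.

Lemma euler_lagrange_reduced L P PA PB Pp r : chain3 P PA PB Pp -> reduces_to L P ->
  0 < r -> euler_lagrange L f r = - (r ^+ m / r ^+ 2) * on Pp f r
    - derive1 (fun s => - (s ^+ m / (2 * s)) * on PB f s) r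
    + derive1n 2 (fun s => - (s ^+ m / 2) * on PA f s) r.
Proof.
move=> hP hL r0; have E0 s : 0 < s -> derive1 (fun y => L s y (derive1 f s) (derive1n 2 f s)) (f s) =
    - (s ^+ m / s ^+ 2) * on Pp f s.
  move=> s0; apply: derive1_is.
  (* [reduces_to] speaks of positive y0 only, so this partial derivative uses that f s is
     positive. *)
  apply: (is_derive_pos (f := fun y => s ^+ m * P (Af f s) (Bf f s) ((k - y) / s ^+ 2))).
  - exact: admissible_gt0.
  - by move=> y y0; rewrite hL.
  have d : is_derive (f s) 1 (fun y : R => (k - y) / s ^+ 2) (- (s ^+ 2)^-1).
    by derive_to => /=; ring.
  have := hP _ _ _ _ _ _ _ (is_derive_const (Af f s) (f s)) (is_derive_const (Bf f s) (f s)) d.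
  by move=> dP; derive_to; rewrite /= /on /pf; ring.
have E1 s : 0 < s -> derive1 (fun y => L s (f s) y (derive1n 2 f s)) (derive1 f s) =
    - (s ^+ m / (2 * s)) * on PB f s.
  move=> s0; apply: derive1_is.
  rewrite (_ : (fun y => _) = (fun y => s ^+ m * P (Af f s) (- y / (2 * s)) (pf f s))).
    have d : is_derive (derive1 f s) 1 (fun y : R => - y / (2 * s)) (- (2 * s)^-1).
      by derive_to => /=; ring.
    have := hP _ _ _ _ _ _ _ (is_derive_const (Af f s) (derive1 f s)) d
      (is_derive_const (pf f s) (derive1 f s)).
    by move=> dP; derive_to; rewrite /= /on /Bf; ring.
  by apply/funext => y; rewrite hL // admissible_gt0.
have E2 s : 0 < s -> derive1 (fun y => L s (f s) (derive1 f s) y) (derive1n 2 f s) =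
    - (s ^+ m / 2) * on PA f s.
  move=> s0; apply: derive1_is.
  rewrite (_ : (fun y => _) = (fun y => s ^+ m * P (- y / 2) (Bf f s) (pf f s))).
    have d : is_derive (derive1n 2 f s) 1 (fun y : R => - y / 2) (- 2^-1).
      by derive_to => /=; ring.
    have := hP _ _ _ _ _ _ _ d (is_derive_const (Bf f s) (derive1n 2 f s))
      (is_derive_const (pf f s) (derive1n 2 f s)).
    by move=> dP; derive_to; rewrite /= /on /Af; ring.
  by apply/funext => y; rewrite hL // admissible_gt0.
exact: (congr2 +%R (congr2 (fun a b => a - b) (E0 r r0) (derive1_pos_eq r0 E1))
  (derive1n2_pos_eq r0 E2)).
Qed.

End EulerLagrangeReduction.

(** * Total derivatives satisfy the Euler-Lagrange equation *)

Section TotalDerivativeToGQT.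
Context {R : realType} (m n : nat) (k : R).
Local Notation D := m.+2.
Implicit Types (c : density R n.+2) (g q : {poly R}) (A B psi : R) (f : R -> R).

(** For m = 0 the truncated predecessor is harmless, both sides being 0. *)
Lemma natr_expr_pred (s : R) : s != 0 -> m%:R * s ^+ m.-1 = m%:R * s ^+ m / s.
Proof. by move=> s0; case: m => [|m']; rewrite ?mul0r // exprS; field. Qed.

(** Mixed partial derivatives of a binary form commute. *)
Lemma deriv_dhom q : (dhom n.+2 q)^`() = dhom n.+1 q^`().
Proof.
apply/polyP => j; rewrite coef_deriv !coef_dhom coef_deriv -mulrnAr; congr (_ * _).
by rewrite [n.+2%:R]mulrSr [j.+1%:R]mulrSr opprD addrACA subrr addr0.
Qed.

Lemma chain3_total g : chain3 (total m n.+1 g)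
  (fun A B psi => hom n.+1 g^`() B psi)
  (fun A B psi => m%:R * hom n.+1 g^`() B psi + (A - B) * hom n g^`()^`() B psi
     + 2 * (B - psi) * hom n (dhom n.+1 g^`()) B psi
     + 2 * hom n.+1 (dhom n.+2 g) B psi)
  (fun A B psi => (m%:R - 1) * hom n.+1 (dhom n.+2 g) B psi
     + (A - B) * hom n (dhom n.+1 g^`()) B psi
     + 2 * (B - psi) * hom n (dhom n.+1 (dhom n.+2 g)) B psi).
Proof.
move=> x y z s x' y' z' dx dy dz; rewrite /total.
have d0 := is_derive_hom n.+1 g dy dz; have d1 := is_derive_hom n g^`() dy dz.
have d2 := is_derive_hom n (dhom n.+2 g) dy dz.
derive_to; rewrite /= deriv_dhom [m.+1%:R]mulrSr; ring.
Qed.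

Lemma lagrangian_reduced c f r : admissible f -> 0 < r ->
  lagrangian D k c (fun=> 1) f r =
  r ^+ m * reduced m c (Af f r) (Bf f r) (pf k f r).
Proof.
move=> hf r0; have h1 : admissible (fun=> 1 : R).
  move=> s _; split=> //; case=> [|j]; first exact: derivable_cst.
  rewrite /derive1n iterSr (_ : derive1 _ = (fun=> 0)); last first.
    by apply/funext => t; rewrite derive1_cst.
  elim: j => [|j IHj]; first exact: derivable_cst.
  rewrite iterSr (_ : derive1 _ = (fun=> 0)) //.
  by apply/funext => t; rewrite derive1_cst.
have d0 s : derive1 (fun=> 1 : R) s = 0 by rewrite derive1_cst.
have d1 : derive1n 2 (fun=> 1 : R) r = 0.
  rewrite /derive1n /= (_ : derive1 (fun=> 1 : R) = (fun=> 0)) ?derive1_cst //.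
  by apply/funext => t; rewrite d0.
rewrite lagrangian_phi // d0 d1 !(mul0r, mulr0, mul1r, add0r, subr0, divr1).
by rewrite /reduced /Af /Bf /pf !mulNr.
Qed.

(** Let Z be the r-derivative of dL/df'' and W the function differentiated in [dW]. Then dL/df' = Z
    - W and dL/df = - W', so the three terms cancel; of Z only differentiability is needed. *)
Lemma total_GQT c g : (forall A B psi, reduced m c A B psi = total m n.+1 g A B psi) ->
  GQT D k c.
Proof.
move=> cg; exists (fun r y0 y1 y2 => r ^+ m *
  reduced m c (- y2 / 2) (- y1 / (2 * r)) ((k - y0) / r ^+ 2)).
split=> [f r hf r0|f r hf r0]; first exact: lagrangian_reduced.
have rn : r != 0 by rewrite gt_eqF.
rewrite (@euler_lagrange_reduced _ m k f hf _ _ _ _ _ r (chain3_total g) _ r0); last first.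
  by move=> s y0 y1 y2 s0 y00; rewrite cg.
have onhom j q (s : R) : 0 < s -> is_derive s 1 (fun s => hom j.+1 q (Bf f s) (pf k f s))
  (hom j q^`() (Bf f s) (pf k f s) * ((Af f s - Bf f s) / s)
   + hom j (dhom j.+1 q) (Bf f s) (pf k f s) * (2 * (Bf f s - pf k f s) / s)).
  by move=> s0; apply: is_derive_hom; [exact: is_derive_Bf|exact: is_derive_pf].
(* [is_derive_hom] covers positive degrees; degree 0 occurs when n = 0. *)
have ex_hom j q : exists d, is_derive r 1 (fun s => hom j q (Bf f s) (pf k f s)) d.
  case: j => [|j]; last by eexists; exact: onhom.
  exists 0; rewrite (_ : (fun s => _) = (fun=> q`_0)); first exact: is_derive_const.
  by apply/funext => s; rewrite /hom big_ord_recl big_ord0 !mulr1 addr0.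
pose Z (s : R) := - (s ^+ m / (2 * s)) * (m%:R * hom n.+1 g^`() (Bf f s) (pf k f s)
  + hom n g^`()^`() (Bf f s) (pf k f s) * (Af f s - Bf f s)
  + 2 * hom n (dhom n.+1 g^`()) (Bf f s) (pf k f s) * (Bf f s - pf k f s)).
have dL2 (s : R) : 0 < s -> derive1 (fun s => - (s ^+ m / 2) *
    on k (fun A B psi => hom n.+1 g^`() B psi) f s) s = Z s.
  move=> s0; have sn : s != 0 by rewrite gt_eqF.
  apply: derive1_is;  have dh := onhom n g^`() s s0.
  by rewrite /on; derive_to; rewrite /Z /= natr_expr_pred //; field.
have [z Zz] : exists z, is_derive r 1 Z z.
  have r2n : 2 * r != 0 by rewrite mulf_neq0 // pnatr_eq0.
   have dh := onhom n g^`() r r0.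
  have [a da] := ex_hom n g^`()^`(); have [b db] := ex_hom n (dhom n.+1 g^`()).
  have dB := is_derive_Bf hf r0; have dA := is_derive_Af hf r0.
  have dC := is_derive_pf k hf r0.
  by eexists; rewrite /Z; derivation.
have dW : is_derive r 1 (fun s => s ^+ m / s * hom n.+1 (dhom n.+2 g) (Bf f s) (pf k f s))
   (r ^+ m / r ^+ 2 * on k (fun A B psi => (m%:R - 1) * hom n.+1 (dhom n.+2 g) B psi
     + (A - B) * hom n (dhom n.+1 g^`()) B psi
     + 2 * (B - psi) * hom n (dhom n.+1 (dhom n.+2 g)) B psi) f r).
   have dh := onhom n (dhom n.+2 g) r r0.
  by rewrite deriv_dhom in dh; derive_to => //; rewrite /on /= natr_expr_pred //; field.
have -> : derive1n 2 (fun s => - (s ^+ m / 2) *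
    on k (fun A B psi => hom n.+1 g^`() B psi) f s) r = derive1 Z r.
  by apply: derive1_pos_eq.
set L1 := (fun s : R => - (s ^+ m / (2 * s)) * _).
set w := (on k _ f r); have -> : derive1 L1 r = z - r ^+ m / r ^+ 2 * w.
  apply: derive1_is; apply: (is_derive_pos r0 _ (is_derive_sub Zz dW)) => s s0.
  have sn : s != 0 by rewrite gt_eqF.
  by rewrite /L1 /Z /on; field.
by rewrite (derive1_is Zz); ring.
Qed.

End TotalDerivativeToGQT.

(** * Dependence on the fourth derivative of f *)

Section FourthDerivative.
Context {R : realType} (m : nat) (k : R).
Implicit Types (f : R -> R).

Let chain_value (XA XB Xp : R -> R -> R -> R) f (s : R) : R :=
  on k XA f s * (- derive1n 3 f s / 2) + on k XB f s * ((Af f s - Bf f s) / s)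
  + on k Xp f s * (2 * (Bf f s - pf k f s) / s).

Variables (P PA PB Pp PAA PAB PAp : R -> R -> R -> R).
Variables (PBA PBB PBp XA XB Xp YA YB Yp ZA ZB Zp : R -> R -> R -> R).
Hypotheses (hP : chain3 P PA PB Pp) (hA : chain3 PA PAA PAB PAp).
Hypotheses (hB : chain3 PB PBA PBB PBp) (hAA : chain3 PAA XA XB Xp).
Hypotheses (hAB : chain3 PAB YA YB Yp) (hAp : chain3 PAp ZA ZB Zp).

Let dL2 f (s : R) : R := - (m%:R * s ^+ m / s / 2) * on k PA f s
  - s ^+ m / 2 * (on k PAA f s * (- derive1n 3 f s / 2)
     + on k PAB f s * ((Af f s - Bf f s) / s)
     + on k PAp f s * (2 * (Bf f s - pf k f s) / s)).

(** All of the Euler-Lagrange expression except the term in f''''. What matters is that it depends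
    on the 3-jet of f only. *)
Let rest f (r : R) : R :=
  - (r ^+ m / r ^+ 2) * on k Pp f r
  - (- ((m%:R - 1) * r ^+ m / (2 * r ^+ 2)) * on k PB f r
     - r ^+ m / (2 * r) * chain_value PBA PBB PBp f r)
  - m%:R * (m%:R - 1) * r ^+ m / r ^+ 2 / 2 * on k PA f r
  - m%:R * r ^+ m / r * chain_value PAA PAB PAp f r
  - r ^+ m / 2 * (chain_value XA XB Xp f r * (- derive1n 3 f r / 2)
     + chain_value YA YB Yp f r * ((Af f r - Bf f r) / r)
     + on k PAB f r * ((- derive1n 3 f r / 2 - (Af f r - Bf f r) / r) / r
                         - (Af f r - Bf f r) / r ^+ 2)
     + chain_value ZA ZB Zp f r * (2 * (Bf f r - pf k f r) / r)
     + on k PAp f r * (2 * ((Af f r - Bf f r) / r - 2 * (Bf f r - pf k f r) / r) / r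
                         - 2 * (Bf f r - pf k f r) / r ^+ 2)).

Let euler_lagrange_top L f (r : R) : reduces_to m k L P -> admissible f -> 0 < r ->
  euler_lagrange L f r = rest f r + r ^+ m / 4 * on k PAA f r * derive1n 4 f r.
Proof.
move=> hL hf r0; have rn : r != 0 by rewrite gt_eqF.
rewrite (euler_lagrange_reduced hf hP hL r0).
have on_der X X1 X2 X3 (s : R) : 0 < s -> chain3 X X1 X2 X3 ->
    is_derive s 1 (on k X f) (chain_value X1 X2 X3 f s).
  by move=> s0 hX; apply: (is_derive_on _ hf s0 hX).
have r2n : 2 * r != 0 by rewrite mulf_neq0 // pnatr_eq0.
have -> : derive1 (fun s => - (s ^+ m / (2 * s)) * on k PB f s) r =
    - ((m%:R - 1) * r ^+ m / (2 * r ^+ 2)) * on k PB f r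
     - r ^+ m / (2 * r) * chain_value PBA PBB PBp f r.
  apply: derive1_is; have dB := on_der _ _ _ _ r r0 hB.
  by derive_to => //; rewrite /= natr_expr_pred //; field.
have -> : derive1n 2 (fun s => - (s ^+ m / 2) * on k PA f s) r = derive1 (dL2 f) r.
  apply: derive1_pos_eq => // s s0; have sn : s != 0 by rewrite gt_eqF.
  apply: derive1_is; have dA := on_der _ _ _ _ s s0 hA.
  by derive_to; rewrite /= natr_expr_pred // /dL2 /chain_value; gen_derive; field.
have d1 := on_der _ _ _ _ r r0 hA; have d2 := on_der _ _ _ _ r r0 hAA.
have d3 := on_der _ _ _ _ r r0 hAB; have d4 := on_der _ _ _ _ r r0 hAp.
have d5 := is_derive_Af hf r0; have d6 := is_derive_Bf hf r0.
have d7 := is_derive_pf k hf r0; have d8 := admissible_der 3 hf r0.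
have -> : derive1 (dL2 f) r = - m%:R * (m%:R - 1) * r ^+ m / r ^+ 2 / 2 * on k PA f r
  - m%:R * r ^+ m / r * chain_value PAA PAB PAp f r
  - r ^+ m / 2 * (chain_value XA XB Xp f r * (- derive1n 3 f r / 2)
     + on k PAA f r * (- derive1n 4 f r / 2)
     + chain_value YA YB Yp f r * ((Af f r - Bf f r) / r)
     + on k PAB f r * ((- derive1n 3 f r / 2 - (Af f r - Bf f r) / r) / r
                         - (Af f r - Bf f r) / r ^+ 2)
     + chain_value ZA ZB Zp f r * (2 * (Bf f r - pf k f r) / r)
     + on k PAp f r * (2 * ((Af f r - Bf f r) / r - 2 * (Bf f r - pf k f r) / r) / r
                         - 2 * (Bf f r - pf k f r) / r ^+ 2)).
  apply: derive1_is; rewrite /dL2; derive_to => //.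
  by rewrite /= natr_expr_pred // /chain_value; gen_derive; field.
by rewrite /rest; gen_derive; field.
Qed.

(** f'''' arises only from differentiating dL/df'' twice, with the second A-derivative of P as
    coefficient; two functions with equal 3-jets isolate it. *)
Lemma euler_lagrange_fourth L f g (r : R) : reduces_to m k L P ->
  admissible f -> admissible g -> 0 < r ->
  f r = g r -> derive1 f r = derive1 g r -> derive1n 2 f r = derive1n 2 g r ->
  derive1n 3 f r = derive1n 3 g r ->
  euler_lagrange L f r - euler_lagrange L g r =
  r ^+ m / 4 * on k PAA f r * (derive1n 4 f r - derive1n 4 g r).
Proof.
move=> hL hf hg r0 e0 e1 e2 e3; rewrite (euler_lagrange_top hL hf r0) (euler_lagrange_top hL hg r0).
have eA : Af f r = Af g r by rewrite /Af e2.
have eB : Bf f r = Bf g r by rewrite /Bf e1.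
have ep : pf k f r = pf k g r by rewrite /pf e0.
have -> : rest f r = rest g r by rewrite /rest /chain_value /on eA eB ep e3.
by rewrite /on eA eB ep; gen_derive; ring.
Qed.

End FourthDerivative.

(** * Generalized quasi-topological densities are total derivatives *)

Section GQTToTotalDerivative.
Context {R : realType} (m n : nat) (k : R).
Hypothesis hk : - 4 < k.
Local Notation D := m.+2.
Implicit Types (c : density R n.+2) (L : jetfun R) (A B psi : R) (f : R -> R).

Let k4 : 0 < k + 4. Proof. by have := hk; lra. Qed.

Lemma lagrangian_reduces_to c L :
  (forall f r, admissible f -> 0 < r -> lagrangian D k c (fun=> 1) f r = along L f r) ->
  reduces_to m k L (reduced m c).
Proof.
move=> hL r y0 y1 y2 r0 y00; have [f [hf f0 f1 f2]] := admissible_jet r y1 y2 y00.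
have := hL f r hf r0; rewrite lagrangian_reduced // /along f0 f1 f2 => <-.
by rewrite /Af /Bf /pf f0 f1 f2.
Qed.

Lemma jet_at2 A B f : f 2 = k + 4 -> derive1 f 2 = - 4 * B -> derive1n 2 f 2 = - 2 * A ->
  [/\ Af f 2 = A, Bf f 2 = B & pf k f 2 = -1].
Proof. by move=> f0 f1 f2; rewrite /Af /Bf /pf f0 f1 f2; split; field. Qed.

Lemma affine_of_second_derivative (F F1 : R -> R) :
  (forall x : R, is_derive x 1 F (F1 x)) -> (forall x : R, is_derive x 1 F1 0) ->
  forall x, F x = F 0 + x * F1 0.
Proof.
move=> dF dF1 x; have F1c y : F1 y = F1 0 by apply: is_derive_0_is_cst.
have : F x - x * F1 0 = F 0 - 0 * F1 0.
  apply: (@is_derive_0_is_cst _ (fun y => F y - y * F1 0)) => y.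
  by have d := dF y; derive_to; rewrite F1c mulr0 add0r mulr1 subrr.
by rewrite mul0r subr0 => <-; rewrite subrK.
Qed.

(** Functions with equal 3-jets and distinct fourth derivatives show that the second A-derivative
    vanishes on the slice psi = -1. The forms multiplying A^i, i >= 2, hence vanish on the slice,
    and so identically. *)
Lemma GQT_affine c : GQT D k c -> exists p0 p1 : {poly R},
  [/\ (size p0 <= n.+3)%N, (size p1 <= n.+2)%N & forall A B psi,
    reduced m c A B psi = hom n.+2 p0 B psi + A * hom n.+1 p1 B psi].
Proof.
move=> [L [hL EL]]; have rL := lagrangian_reduces_to hL.
set r := index_enum {ffun slot n.+2 -> 'I_D}.
pose a := @nA m n.+2; pose b := @nB m n.+2.
pose e v := (n.+2 - a v - b v)%N.
have P_E : reduced m c = msum r (wt c) a b e.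
  by apply/funext => A; apply/funext => B; apply/funext => psi; rewrite /reduced phi_kmat_msum.
have cP := chain3_msum r (wt c) a b e; rewrite -P_E in cP.
set PA := msum _ _ _ _ _ in cP; set PB := msum _ _ _ _ _ in cP.
have [PBA [PBB [PBp cB]]] := chain3_exists r (fun v => wt c v * (b v)%:R) a (fun v => (b v).-1) e.
have cA := chain3_msum r (fun v => wt c v * (a v)%:R) (fun v => (a v).-1) b e.
rewrite -/PA in cA.
set PAA := msum _ _ _ _ _ in cA; set PAB := msum _ _ _ _ _ in cA; set PAp := msum _ _ _ _ _ in cA.
have [XA [XB [Xp cAA]]] : exists XA XB Xp, chain3 PAA XA XB Xp by exact: chain3_exists.
have [YA [YB [Yp cAB]]] : exists XA XB Xp, chain3 PAB XA XB Xp by exact: chain3_exists.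
have [ZA [ZB [Zp cAp]]] : exists XA XB Xp, chain3 PAp XA XB Xp by exact: chain3_exists.
have r2 : (0 : R) < 2 by [].
have PAA0 A B : PAA A B (-1) = 0.
  have [f [g [hf hg [f0 f1 f2] [g0 g1 g2] [fg3 fg4]]]] :=
    admissible_jet4 2 (- 4 * B) (- 2 * A) k4.
  have e4 := euler_lagrange_fourth cP cA cB cAA cAB cAp rL hf hg r2
    (etrans f0 (esym g0)) (etrans f1 (esym g1)) (etrans f2 (esym g2)) fg3.
  rewrite (EL f 2 hf r2) (EL g 2 hg r2) subr0 in e4.
  have [eA eB ep] := jet_at2 f0 f1 f2.
  move/esym/eqP: e4; rewrite /on eA eB ep !mulf_eq0 subr_eq0 (negPf fg4) orbF.
  by rewrite invr_eq0 pnatr_eq0 orbF expf_eq0 pnatr_eq0 andbF /= => /eqP.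
have affA A B : reduced m c A B (-1) = reduced m c 0 B (-1) + A * PA 0 B (-1).
  apply: (affine_of_second_derivative (F := fun A => reduced m c A B (-1))
    (F1 := fun A => PA A B (-1))) => x.
    have := cP _ _ _ _ _ _ _ (is_derive_var x) (is_derive_const B x) (is_derive_const (-1) x).
    by rewrite !mulr0 mulr1 !addr0.
  have := cA _ _ _ _ _ _ _ (is_derive_var x) (is_derive_const B x) (is_derive_const (-1) x).
  by rewrite !mulr0 mulr1 !addr0 PAA0.
have coefA0 i j : (1 < i <= n.+2)%N -> (j <= n.+2 - i)%N -> (coefA m c i)`_j = 0.
  move=> /andP[i1 i2] hj; rewrite -[RHS](coef0 R j).
  apply: (@hom_inj _ (n.+2 - i) _ _ (-1)) => // B.
  rewrite hom0; pose x l := if (l <= n.+2)%N then hom (n.+2 - l) (coefA m c l) B (-1) else 0.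
  pose y l := if l == 0%N then reduced m c 0 B (-1) else if l == 1%N then PA 0 B (-1) else 0.
  have := @coef_inj_wide _ n.+3 x y _ i; rewrite /x /y i2 ltnS i2 (gtn_eqF i1) (gtn_eqF (ltnW i1)).
  apply=> // A; rewrite [RHS]big_ord_recl [in RHS]big_ord_recl /= [X in _ = _ + (_ + X)]big1 => [|l _]; last by rewrite mul0r.
  rewrite expr0 mulr1 addr0 mulrC -affA /reduced phi_kmat_hom; apply: eq_bigr => l _.
  by rewrite -ltnS ltn_ord mulrC.
have sz i : (i <= n.+2)%N -> (size (coefA m c i) <= (n.+2 - i).+1)%N.
  move=> hi; apply/leq_sizeP => j hj; rewrite coef_sum big1 // => v /eqP vi.
  rewrite coefZ coefXn; case: eqP => [jb|_]; last by rewrite mulr0.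
  have := nAB_le v; rewrite vi -leq_subRL // -jb => jb'.
  by have := leq_ltn_trans jb' hj; rewrite ltnn.
exists (coefA m c 0), (coefA m c 1); split; [exact: sz|exact: (sz 1%N)|move=> A B psi].
rewrite /reduced phi_kmat_hom big_ord_recl [X in _ + X]big_ord_recl expr0 mul1r /=.
rewrite [X in _ + (_ + X)]big1 ?addr0 ?expr1 ?subSS ?subn0 // => l _.
rewrite (@eq_hom _ _ _ 0) ?hom0 ?mulr0 // => j hj; rewrite coefA0 ?poly.coef0 //.
by rewrite /bump !leq0n !add1n; exact: (ltn_ord l).
Qed.

(** Write P = s + A q. If P comes from g, then q = dg/dB and y = 2 dg/dpsi, so Euler's identity
    dictates g = (psi y / 2 + B q) / (n + 2). The Euler-Lagrange equation, in the form [key], is the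
    integrability condition under which this g works. *)
Lemma GQT_total c : GQT D k c -> exists g : {poly R},
  (size g <= n.+3)%N /\ forall A B psi, reduced m c A B psi = total m n.+1 g A B psi.
Proof.
move=> hc; have [s [q [ss sq cE]]] := GQT_affine hc.
have [L [hL EL]] := hc; have rL := lagrangian_reduces_to hL.
have s0 j : (n.+3 <= j)%N -> s`_j = 0 by move/leq_sizeP: ss; apply.
have q0 j : (n.+2 <= j)%N -> q`_j = 0 by move/leq_sizeP: sq; apply.
pose dq := dhom n.+1 q.
have dq0 j : (n.+1 <= j)%N -> dq`_j = 0.
  rewrite coef_dhom leq_eqVlt => /orP[/eqP <-|hj]; first by rewrite subrr mul0r.
  by rewrite q0 ?mulr0.
have dqE : dq = dhom n.+1 q by [].
clearbody dq.
(* Solved from the B-derivative of [total g], with q in place of dg/dB. *)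
pose y : {poly R} := s^`() - m%:R *: q + 'X * q^`() - 2 *: ('X * dq) + 2 *: dq.
have y0 j : (n.+2 <= j)%N -> y`_j = 0.
  case: j => // j hj; rewrite /y !(coefD, coefN, coefZ, coefXM) !coef_deriv /=.
  rewrite s0 // !q0 ?dq0 //; last by rewrite leqW.
  by rewrite !mul0rn !mulr0 oppr0 !addr0.
pose g : {poly R} := (n.+2%:R)^-1 *: (2^-1 *: y + 'X * q).
have N0 : n.+2%:R != 0 :> R by rewrite pnatr_eq0.
have sg : (size g <= n.+3)%N.
  apply/leq_sizeP => j hj; rewrite coefZ coefD coefZ coefXM y0 ?(ltnW hj) //.
  by case: j hj => // j hj; rewrite /= q0 // !mulr0 addr0 mulr0.
exists g; split=> //.
have YE B psi : hom n.+1 y B psi = hom n.+1 s^`() B psi - m%:R * hom n.+1 q B psi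
    + B * hom n q^`() B psi - 2 * (B - psi) * hom n dq B psi.
  rewrite /y !(homB, homD, homZ) -!homMx -(homMy (p := dq)) ?dq0 //; ring.
clearbody y.
(* As for total derivatives, the derivative of [Z] cancels; what remains is an identity in A, B and
   psi at the points reached by a positive f. *)
have key A B psi (r : R) : 0 < r -> 0 < k - r ^+ 2 * psi ->
    A * hom n dq B psi + hom n.+1 (dhom n.+2 s) B psi =
    ((m%:R - 1) * hom n.+1 y B psi + (A - B) * hom n y^`() B psi
     + 2 * (B - psi) * hom n (dhom n.+1 y) B psi) / 2.
  move=> r0 y00; have rn : r != 0 by rewrite gt_eqF.
  have [f [hf f0 f1 f2]] := admissible_jet r (- (2 * r) * B) (- 2 * A) y00.
  have eA : Af f r = A by rewrite /Af f2; field.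
  have eB : Bf f r = B by rewrite /Bf f1; field.
  have ep : pf k f r = psi by rewrite /pf f0; field.
  have cP : chain3 (reduced m c) (fun A B psi => hom n.+1 q B psi)
     (fun A B psi => hom n.+1 s^`() B psi + A * hom n q^`() B psi)
     (fun A B psi => A * hom n dq B psi + hom n.+1 (dhom n.+2 s) B psi).
    move=> x z w t x' z' w' dx dz dw.
    have -> : reduced m c = (fun A B psi => hom n.+2 s B psi + A * hom n.+1 q B psi).
      by apply/funext => ?; apply/funext => ?; apply/funext => ?; rewrite cE.
    have d0 := is_derive_hom n.+1 s dz dw; have d1 := is_derive_hom n q dz dw.
    by derive_to; rewrite /= dqE; ring.
  have := EL f r hf r0; rewrite (euler_lagrange_reduced hf cP rL r0).
  have onhom j p (t : R) : 0 < t -> is_derive t 1 (fun t => hom j.+1 p (Bf f t) (pf k f t))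
    (hom j p^`() (Bf f t) (pf k f t) * ((Af f t - Bf f t) / t)
     + hom j (dhom j.+1 p) (Bf f t) (pf k f t) * (2 * (Bf f t - pf k f t) / t)).
    by move=> t0; apply: is_derive_hom; [exact: is_derive_Bf|exact: is_derive_pf].
  pose Z (t : R) := - (t ^+ m / (2 * t)) * (m%:R * hom n.+1 q (Bf f t) (pf k f t)
    + hom n q^`() (Bf f t) (pf k f t) * (Af f t - Bf f t)
    + 2 * hom n dq (Bf f t) (pf k f t) * (Bf f t - pf k f t)).
  have -> : derive1n 2 (fun t => - (t ^+ m / 2) *
      on k (fun A B psi => hom n.+1 q B psi) f t) r = derive1 Z r.
    apply: derive1_pos_eq => // t t0; have tn : t != 0 by rewrite gt_eqF.
    apply: derive1_is; have dh := onhom n q t t0.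
    by rewrite /on; derive_to; rewrite /Z /= natr_expr_pred // dqE; field.
  pose W (t : R) := t ^+ m / (2 * t) * hom n.+1 y (Bf f t) (pf k f t).
  have r2n : 2 * r != 0 by rewrite mulf_neq0 // pnatr_eq0.
  have dW : is_derive r 1 W (r ^+ m / r ^+ 2 * ((m%:R - 1) * hom n.+1 y B psi
     + (A - B) * hom n y^`() B psi + 2 * (B - psi) * hom n (dhom n.+1 y) B psi) / 2).
    have dh := onhom n y r r0; rewrite /W; derive_to => //.
    by rewrite /= natr_expr_pred // eA eB ep; field.
  have [z Zz] : exists z, is_derive r 1 Z z.
    have ex_hom j p : exists d, is_derive r 1 (fun t => hom j p (Bf f t) (pf k f t)) d.
      case: j => [|j]; last by eexists; exact: onhom.
      exists 0; rewrite (_ : (fun t => _) = (fun=> p`_0)); first exact: is_derive_const.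
      by apply/funext => t; rewrite /hom big_ord_recl big_ord0 !mulr1 addr0.
    have dh := onhom n q r r0.
    have [a da] := ex_hom n q^`(); have [b db] := ex_hom n dq.
    have dB := is_derive_Bf hf r0; have dA := is_derive_Af hf r0.
    have dC := is_derive_pf k hf r0.
    by eexists; rewrite /Z; derivation.
  set L1 := (fun t : R => - (t ^+ m / (2 * t)) * _).
  have -> : derive1 L1 r = z - r ^+ m / r ^+ 2 * ((m%:R - 1) * hom n.+1 y B psi
     + (A - B) * hom n y^`() B psi + 2 * (B - psi) * hom n (dhom n.+1 y) B psi) / 2.
    apply: derive1_is; apply: (is_derive_pos r0 _ (is_derive_sub Zz dW)) => t t0.
    have tn : t != 0 by rewrite gt_eqF.
    by rewrite /L1 /Z /W /on YE; field.
  have c0 : r ^+ m / r ^+ 2 != 0 by rewrite mulf_neq0 ?invr_eq0 ?expf_neq0.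
  rewrite (derive1_is Zz) /on eA eB ep; move: (r ^+ m / r ^+ 2) c0 => u u0.
  set X := (A * _ + _); set Y := (_ * hom n.+1 y B psi + _ + _) => e.
  apply: (mulfI u0); apply/eqP; rewrite -subr_eq0; apply/eqP.
  by rewrite -[RHS]oppr0 -e; field.
have hom_dB B psi : hom n.+1 g^`() B psi =
    n.+2%:R^-1 * (psi * hom n y^`() B psi / 2 + hom n.+1 q B psi + B * hom n q^`() B psi).
  rewrite derivZ derivD derivZ derivM derivX mul1r !(homZ, homD) -homMx.
  by rewrite -(homMy (p := y^`())) ?coef_deriv ?y0 ?mul0rn //; field.
have hom_dp B psi : hom n.+1 (dhom n.+2 g) B psi =
    n.+2%:R^-1 * ((hom n.+1 y B psi + psi * hom n (dhom n.+1 y) B psi) / 2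
       + B * hom n dq B psi).
  have -> : dhom n.+2 g = n.+2%:R^-1 *: (2^-1 *: (y + dhom n.+1 y) + 'X * dq).
    apply/polyP => j; rewrite dqE !(coefZ, coefD, coef_dhom, coefXM).
    have -> : n.+1%:R = n.+2%:R - 1 :> R by rewrite [n.+2%:R]mulrSr addrK.
    case: j => [|j] /=; first by field.
    by rewrite [j.+1%:R]mulrSr; field.
  rewrite homZ homD homZ homD -homMx -(homMy (p := dhom n.+1 y)); first by field.
  by rewrite coef_dhom subrr mul0r.
have homE B psi : hom n.+2 g B psi =
    n.+2%:R^-1 * (psi * hom n.+1 y B psi / 2 + B * hom n.+1 q B psi).
  by rewrite !(homZ, homD) -homMx -(homMy (p := y)) ?y0 //; field.
have total_on_domain A B psi (r : R) : 0 < r -> 0 < k - r ^+ 2 * psi ->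
    reduced m c A B psi = total m n.+1 g A B psi.
  move=> r0 rp; have e := key A B psi r r0 rp.
  have es := hom_euler n.+1 s B psi; have eq := hom_euler n q B psi.
  have eSB : hom n.+1 s^`() B psi = hom n.+1 y B psi + m%:R * hom n.+1 q B psi
      - B * hom n q^`() B psi + 2 * (B - psi) * hom n dq B psi by rewrite YE; ring.
  have eSp : hom n.+1 (dhom n.+2 s) B psi = ((m%:R - 1) * hom n.+1 y B psi
      + (A - B) * hom n y^`() B psi + 2 * (B - psi) * hom n (dhom n.+1 y) B psi) / 2
      - A * hom n dq B psi by rewrite -e; ring.
  rewrite -dqE in eq; rewrite cE /total homE hom_dB hom_dp; apply: (mulfI N0).
  have -> : n.+2%:R * (hom n.+2 s B psi + A * hom n.+1 q B psi) =
      n.+2%:R * hom n.+2 s B psi + A * (n.+1%:R * hom n.+1 q B psi + hom n.+1 q B psi).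
    by rewrite [n.+2%:R]mulrSr; ring.
  by rewrite -es -eq eSB eSp [m.+1%:R]mulrSr; field.
have r2 : (0 : R) < 2 by [].
clearbody g.
(* The part of [total g] free of A. Comparison at A = 0 and A = 1 on psi = -1 then extends to all
   arguments. *)
pose t : {poly R} := (m.+1%:R *: g - 'X * g^`()) + 2 *: ('X * dhom n.+2 g) - 2 *: dhom n.+2 g.
have totalE A B psi : total m n.+1 g A B psi = hom n.+2 t B psi + A * hom n.+1 g^`() B psi.
  have dg0 : (dhom n.+2 g)`_n.+2 = 0 by rewrite coef_dhom subrr mul0r.
  rewrite /t /total; move: (dhom n.+2 g) dg0 => dg dg0.
  by rewrite !(homB, homD, homZ) -!homMx -(@homMy _ n.+1 dg) //; ring.
have eqn A B : hom n.+2 s B (-1) + A * hom n.+1 q B (-1) =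
    hom n.+2 t B (-1) + A * hom n.+1 g^`() B (-1).
  by rewrite -cE -totalE; apply: (total_on_domain _ _ _ 2 r2); have := k4; lra.
have es B : hom n.+2 s B (-1) = hom n.+2 t B (-1).
  by have := eqn 0 B; rewrite !mul0r !addr0.
have eq B : hom n.+1 q B (-1) = hom n.+1 g^`() B (-1).
  by have := eqn 1 B; rewrite es !mul1r => /addrI.
have m1 : (-1 : R) != 0 by rewrite oppr_eq0 oner_eq0.
move=> A B psi; rewrite cE totalE; congr (_ + _ * _); apply: eq_hom => j hj.
  exact: (hom_inj m1 es).
exact: (hom_inj m1 eq).
Qed.

End GQTToTotalDerivative.

(** * The integrated equation *)

Section IntegratedUnique.
Context {R : realType} (D : nat) (k : R) (n : nat).
Implicit Types (c : density R n.+1) (T F : jetfun R) (f : R -> R).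

(** The exponential pulls the half-line back to the real line. *)
Lemma zero_derivative_pos_const (h : R -> R) :
  (forall s : R, 0 < s -> is_derive s 1 h 0) -> forall r s, 0 < r -> 0 < s -> h r = h s.
Proof.
move=> dh r s r0 s0; rewrite -(lnK (x := r)) ?posrE // -(lnK (x := s)) ?posrE //.
apply: (@is_derive_0_is_cst _ (fun t => h (expR t))) => t; rewrite -[X in is_derive _ _ _ X](mul0r (expR t)).
exact: (is_derive_compose (dh _ (expR_gt0 t)) (is_derive_expR t)).
Qed.

Lemma double_sum_axis (e : nat -> nat -> R) (t : R) (N : nat) :
  \sum_(i < N.+1) \sum_(j < N.+1 | (2 <= i + j)%N) e i j * t ^+ i * 0 ^+ j =
  \sum_(i < N.+1 | (2 <= i)%N) e i 0%N * t ^+ i.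
Proof.
rewrite [RHS]big_mkcond; apply: eq_bigr => i _.
rewrite big_mkcond big_ord_recl /= addn0 expr0 mulr1 big1 ?addr0 // => j _.
by rewrite expr0n /= mulr0 if_same.
Qed.

Lemma axis_polynomial (x0 x1 t : R) (e : nat -> R) (N : nat) :
  x0 + t * x1 + \sum_(i < N.+2 | (2 <= i)%N) e i * t ^+ i =
  \sum_(i < N.+2) (if i == 0%N :> nat then x0 else if i == 1%N :> nat then x1 else e i) * t ^+ i.
Proof.
rewrite big_mkcond big_ord_recl [X in _ + (_ + X)]big_ord_recl /= add0r add0r.
rewrite [RHS]big_ord_recl [X in _ = _ + X]big_ord_recl /= expr0 mulr1 expr1 addrA [t * _]mulrC.
by congr (_ + _).
Qed.

(* Testing with N = 1, N' = a, N'' = 0 and with N = 1, N' = 0, N'' = a at r. *)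
Lemma integrated_coefficients c (T0 T1 T2 T0' T1' T2' : jetfun R) (E E' : nat -> nat -> jetfun R) :
  let expands T0 T1 T2 (E : nat -> nat -> jetfun R) :=
    forall N f r, admissible N -> admissible f -> 0 < r ->
          lagrangian D k c N f r =
            N r * derive1 (along T0 f) r + derive1 N r * along T1 f r
            + derive1n 2 N r * along T2 f r
            + N r * \sum_(i < n.+2) \sum_(j < n.+2 | (2 <= i + j)%N)
                along (E i j) f r * (derive1 N r / N r) ^+ i
                                  * (derive1n 2 N r / N r) ^+ j in
  expands T0 T1 T2 E -> expands T0' T1' T2' E' ->
  forall f r, admissible f -> 0 < r ->
  [/\ derive1 (along T0 f) r = derive1 (along T0' f) r,
      along T1 f r = along T1' f r & along T2 f r = along T2' f r].
Proof.
move=> expands h h' f r hf r0.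
have lag1 T0a T1a T2a Ea t : expands T0a T1a T2a Ea -> forall N, admissible N ->
    N r = 1 -> derive1 N r = t -> derive1n 2 N r = 0 ->
    lagrangian D k c N f r = \sum_(i < n.+2) (if i == 0%N :> nat then derive1 (along T0a f) r
      else if i == 1%N :> nat then along T1a f r else along (Ea i 0%N) f r) * t ^+ i.
  move=> ha N hN N0 N1 N2; rewrite (ha N f r hN hf r0) N0 N1 N2 !divr1 !mul1r mul0r addr0.
  rewrite (double_sum_axis (fun i j => along (Ea i j) f r)).
  by rewrite (axis_polynomial _ _ _ (fun i => along (Ea i 0%N) f r)).
have lag2 T0a T1a T2a Ea t : expands T0a T1a T2a Ea -> forall N, admissible N ->
    N r = 1 -> derive1 N r = 0 -> derive1n 2 N r = t ->
    lagrangian D k c N f r = \sum_(i < n.+2) (if i == 0%N :> nat then derive1 (along T0a f) r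
      else if i == 1%N :> nat then along T2a f r else along (Ea 0%N i) f r) * t ^+ i.
  move=> ha N hN N0 N1 N2; rewrite (ha N f r hN hf r0) N0 N1 N2 !divr1 !mul1r mul0r addr0.
  rewrite (exchange_big_dep predT) //= -(axis_polynomial _ _ _ (fun i => along (Ea 0%N i) f r)).
  congr (_ + _); rewrite -(double_sum_axis (fun j i => along (Ea i j) f r)).
  apply: eq_bigr => i _; apply: eq_big => [j|j _]; first by rewrite addnC.
  by rewrite mulrAC.
pose ax (T0a T1a : R) (e : nat -> R) (i : nat) : R :=
  if i == 0%N then T0a else if i == 1%N then T1a else e i.
have c1 : forall i, (i < n.+2)%N ->
    ax (derive1 (along T0 f) r) (along T1 f r) (fun i => along (E i 0%N) f r) i =
    ax (derive1 (along T0' f) r) (along T1' f r) (fun i => along (E' i 0%N) f r) i.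
  apply: coef_inj_wide => t; have [N [hN N0 N1 N2]] := admissible_jet r t 0 (@ltr01 R).
  by rewrite /ax -(lag1 _ _ _ _ _ h N hN N0 N1 N2) -(lag1 _ _ _ _ _ h' N hN N0 N1 N2).
have c2 : forall i, (i < n.+2)%N ->
    ax (derive1 (along T0 f) r) (along T2 f r) (fun i => along (E 0%N i) f r) i =
    ax (derive1 (along T0' f) r) (along T2' f r) (fun i => along (E' 0%N i) f r) i.
  apply: coef_inj_wide => t; have [N [hN N0 N1 N2]] := admissible_jet r 0 t (@ltr01 R).
  by rewrite /ax -(lag2 _ _ _ _ _ h N hN N0 N1 N2) -(lag2 _ _ _ _ _ h' N hN N0 N1 N2).
split; [exact: (c1 0%N)|exact: (c1 1%N)|exact: (c2 1%N)].
Qed.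

(** Testing with N determines T1, T2 and the derivative of T0. Two choices of T0 differ by a
    constant along each f, and an f interpolating arbitrary jets at two distinct radii shows that
    this constant is universal. *)
Lemma integrated_unique c F F' : integrated D k c F -> integrated D k c F' ->
  exists C, forall r y0 y1 y2, 0 < r -> 0 < y0 -> F r y0 y1 y2 = F' r y0 y1 y2 + C.
Proof.
move=> [T0 [T1 [T2 [E [dT hE hF]]]]] [T0' [T1' [T2' [E' [dT' hE' hF']]]]].
have co := integrated_coefficients hE hE'.
pose d r y0 y1 y2 := T0 r y0 y1 y2 - T0' r y0 y1 y2.
have dc f r s : admissible f -> 0 < r -> 0 < s -> along d f r = along d f s.
  move=> hf; apply: (zero_derivative_pos_const (h := along d f)) => t t0.
  have [a _] := dT f t hf t0; have [a' _] := dT' f t hf t0.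
  have [e _ _] := co f t hf t0.
  have := is_derive_sub (derivable_is a) (derivable_is a').
  by rewrite e subrr.
have dJ r y0 y1 y2 s z0 z1 z2 : 0 < r -> 0 < s -> 0 < y0 -> 0 < z0 -> r != s ->
    d r y0 y1 y2 = d s z0 z1 z2.
  move=> r0 s0 y00 z00 rs.
  have [f [hf [f0 f1 f2] [g0 g1 g2]]] := admissible_interpolation y1 y2 z1 z2 rs y00 z00.
  by have := dc f r s hf r0 s0; rewrite /along f0 f1 f2 g0 g1 g2.
exists (d 1 1 0 0) => r y0 y1 y2 r0 y00.
have -> : d 1 1 0 0 = d r y0 y1 y2.
  (* Interpolation needs distinct radii; two jets at r = 1 are compared through r = 2. *)
  have [r1|r1] := eqVneq r 1; last by rewrite (dJ r y0 y1 y2 1 1 0 0).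
  have n2 : (1 : R) != 2 by rewrite -subr_eq0; apply/eqP; lra.
  rewrite (dJ 1 1 0 0 2 1 0 0) // (dJ r y0 y1 y2 2 1 0 0) // r1 //.
have [f [hf f0 f1 f2]] := admissible_jet r y1 y2 y00.
have [_ e1 _] := co f r hf r0; have := hF f r hf r0; have := hF' f r hf r0.
have -> : derive1 (along T2 f) r = derive1 (along T2' f) r.
  by apply: derive1_pos_eq => // s s0; have [_ _] := co f s hf s0.
by rewrite e1 /along f0 f1 f2 /d => -> ->; ring.
Qed.

End IntegratedUnique.

(** * The integrated equation of a total derivative *)

Section IntegratedEquation.
Context {R : realType} (m n : nat) (k : R).
Local Notation D := m.+2.
Implicit Types (c : density R n.+2) (g : {poly R}) (A B psi : R) (f : R -> R).

Definition total_dB g A B psi : R :=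
  m%:R * hom n.+1 g^`() B psi + (A - B) * hom n g^`()^`() B psi
  + 2 * (B - psi) * hom n (dhom n.+1 g^`()) B psi + 2 * hom n.+1 (dhom n.+2 g) B psi.

Definition jetT0 g : jetfun R := fun r y0 y1 y2 =>
  r ^+ m * r * hom n.+2 g (- y1 / (2 * r)) ((k - y0) / r ^+ 2).
(** N' / N shifts A by 3 r B and [Bt] by - f / r; the derivative in [Bt] alone is half of
    [total_dB]. In [jetT2], N'' / N shifts A by - f. *)
Definition jetT1 g : jetfun R := fun r y0 y1 y2 =>
  let A := - y2 / 2 in let B := - y1 / (2 * r) in let psi := (k - y0) / r ^+ 2 in
  r ^+ m * (3 * r * B * hom n.+1 g^`() B psi - y0 / r / 2 * total_dB g A B psi).
Definition jetT2 g : jetfun R := fun r y0 y1 y2 =>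
  - y0 * r ^+ m * hom n.+1 g^`() (- y1 / (2 * r)) ((k - y0) / r ^+ 2).
Definition jetF g : jetfun R := fun r y0 y1 y2 =>
  let A := - y2 / 2 in let B := - y1 / (2 * r) in let psi := (k - y0) / r ^+ 2 in
  jetT0 g r y0 y1 y2 - jetT1 g r y0 y1 y2
  + (2 * r * B * r ^+ m * hom n.+1 g^`() B psi
     - y0 * r ^+ m / r * (m%:R * hom n.+1 g^`() B psi + (A - B) * hom n g^`()^`() B psi
         + 2 * (B - psi) * hom n (dhom n.+1 g^`()) B psi)).

Lemma is_derive_jetT0 g f (r : R) : admissible f -> 0 < r ->
  is_derive r 1 (along (jetT0 g) f) (r ^+ m * total m n.+1 g (Af f r) (Bf f r) (pf k f r)).
Proof.
move=> hf r0; have rn : r != 0 by rewrite gt_eqF.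
have dh := is_derive_hom n.+1 g (is_derive_Bf hf r0) (is_derive_pf k hf r0).
rewrite /along /jetT0 -/(Bf f _) -/(pf k f _); derive_to.
by rewrite /= natr_expr_pred // /total [m.+1%:R]mulrSr; field.
Qed.

Lemma is_derive_jetT2 g f (r : R) : admissible f -> 0 < r ->
  is_derive r 1 (along (jetT2 g) f)
    (2 * r * Bf f r * r ^+ m * hom n.+1 g^`() (Bf f r) (pf k f r)
     - f r * r ^+ m / r * (m%:R * hom n.+1 g^`() (Bf f r) (pf k f r)
         + (Af f r - Bf f r) * hom n g^`()^`() (Bf f r) (pf k f r)
         + 2 * (Bf f r - pf k f r) * hom n (dhom n.+1 g^`()) (Bf f r) (pf k f r))).
Proof.
move=> hf r0; have rn : r != 0 by rewrite gt_eqF.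
have dh := is_derive_hom n g^`() (is_derive_Bf hf r0) (is_derive_pf k hf r0).
have df := admissible_der0 hf r0.
have ef : derive1 f r = - (2 * r * Bf f r) by rewrite /Bf; gen_derive; field.
rewrite /along /jetT2 -/(Bf f _) -/(pf k f _); derive_to.
by rewrite /= -/(Bf f r) -/(pf k f r) natr_expr_pred // ef; field.
Qed.

Section Coefficients.
Variables (c : density R n.+2) (g : {poly R}).
Hypothesis cg : forall A B psi, reduced m c A B psi = total m n.+1 g A B psi.
Variables (A B psi : R).
Let K : 'I_D -> 'I_D -> R := kmat A B B psi.
Let EA : 'I_D -> 'I_D -> R := kmat 1 0 0 0.
Let Et : 'I_D -> 'I_D -> R := kmat 0 1 0 0.
Let Er : 'I_D -> 'I_D -> R := kmat 0 0 1 0.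

Let shift X t : phi c (fun a b => K a b + t * X a b) = (phiP c K X).[t].
Proof. by rewrite horner_phiP. Qed.

Lemma coef1_A : (phiP c K EA)`_1 = hom n.+1 g^`() B psi.
Proof.
have -> : phiP c K EA = (total m n.+1 g A B psi)%:P + hom n.+1 g^`() B psi *: 'X.
  apply: horner_inj => t; rewrite -shift.
  rewrite (@eq_phi _ _ _ _ _ (kmat (A + t) B B psi)); last first.
    by move=> a b _; rewrite /K /EA kmatD !mulr0 mulr1 !addr0.
  have := cg (A + t) B psi; rewrite /reduced => ->.
  by rewrite !hornerE /total; ring.
by rewrite coef_linfactor.
Qed.

(** Exchanging t and r equates the derivatives in [Bt] and [Br]; their sum is the B-derivative of
    [total g]. *)
Lemma coef1_t : (phiP c K Et)`_1 = total_dB g A B psi / 2.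
Proof.
have swap : phiP c K Et = phiP c K Er.
  apply: horner_inj => t; rewrite -!shift.
  rewrite (@eq_phi _ _ _ _ _ (kmat A (B + t) B psi)); last first.
    by move=> a b _; rewrite /K /Et kmatD !mulr0 mulr1 !addr0.
  rewrite phi_kmat_swap; apply: eq_phi => a b _.
  by rewrite /K /Er kmatD !mulr0 mulr1 !addr0.
have both : (phiP c K (fun a b => 1 * Et a b + 1 * Er a b))`_1 = total_dB g A B psi.
  set p := phiP _ _ _; have -> : p`_1 = derive1 (horner p) 0.
    by rewrite (derive1_is (is_derive_poly p 0)) horner_coef0 coef_deriv mulr1n.
  have -> : horner p = (fun t => total m n.+1 g A (B + t) psi).
    apply/funext => t; rewrite -cg /reduced /p -shift; apply: eq_phi => a b _.
    by rewrite /K /Et /Er /kmat; do !case: ifP => _; ring.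
  apply: derive1_is; refine (is_derive_cast (@chain3_total R m n g _ _ _ _ _ _ _
    (is_derive_const A 0) (is_derive_addl B 0) (is_derive_const psi 0)) _).
  by rewrite !mulr0 mulr1 addr0 add0r addr0.
by rewrite -both coef1_phiPD -swap; field.
Qed.

End Coefficients.

Lemma split_low_degree (e : nat -> nat -> R) (N : nat) :
  \sum_(i < N.+2) \sum_(j < N.+2) e i j = e 0%N 0%N + e 1%N 0%N + e 0%N 1%N
  + \sum_(i < N.+2) \sum_(j < N.+2 | (2 <= i + j)%N) e i j.
Proof.
rewrite (eq_bigr (fun i : 'I_N.+2 => \sum_(j < N.+2 | (i + j < 2)%N) e i j
  + \sum_(j < N.+2 | (2 <= i + j)%N) e i j)); last first.
  move=> i _; rewrite (bigID (fun j : 'I_N.+2 => (i + j < 2)%N)) /=; congr (_ + _).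
  by apply: eq_bigl => j; rewrite -leqNgt.
rewrite big_split; congr (_ + _) => /=.
rewrite big_ord_recl big_ord_recl [X in _ + (_ + X)]big1 => [|i _]; last first.
  by rewrite big1.
have S0 : \sum_(j < N.+2 | (0 + j < 2)%N) e 0%N j = e 0%N 0%N + e 0%N 1%N.
  by rewrite big_mkcond 2!big_ord_recl /= big1 ?addr0.
have S1 : \sum_(j < N.+2 | (1 + j < 2)%N) e 1%N j = e 1%N 0%N.
  by rewrite big_mkcond big_ord_recl /= big1 ?addr0.
by rewrite S0 S1 addr0 addrAC.
Qed.

Lemma phiE_axis1 c (K X Y : 'I_D -> 'I_D -> R) i : (i < n.+3)%N ->
  phiE c K X Y i 0 = (phiP c K X)`_i.
Proof.
move=> hi; have -> : phiP c K X = \poly_(i < n.+3) phiE c K X Y i 0.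
  apply: horner_inj => t; rewrite horner_phiP horner_poly.
  have := phi_expand2 c K X Y t 0; rewrite (_ : (fun a b => _) = (fun a b => K a b + t * X a b)).
    move=> ->; apply: eq_bigr => l _; rewrite big_ord_recl expr0 mulr1 big1 ?addr0 // => j _.
    by rewrite expr0n mulr0.
  by apply/funext => a; apply/funext => b; rewrite mul0r addr0.
by rewrite coef_poly hi.
Qed.

Lemma phiE_axis2 c (K X Y : 'I_D -> 'I_D -> R) i : (i < n.+3)%N ->
  phiE c K X Y 0 i = (phiP c K Y)`_i.
Proof.
move=> hi; have -> : phiP c K Y = \poly_(i < n.+3) phiE c K X Y 0 i.
  apply: horner_inj => t; rewrite horner_phiP horner_poly.
  have := phi_expand2 c K X Y 0 t; rewrite (_ : (fun a b => _) = (fun a b => K a b + t * Y a b)).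
    move=> ->; rewrite big_ord_recl [X in _ + X]big1 ?addr0 => [|l _].
      by apply: eq_bigr => j _; rewrite expr0 mulr1.
    by rewrite big1 // => j _; rewrite expr0n mulr0 mul0r.
  by apply/funext => a; apply/funext => b; rewrite mul0r addr0.
by rewrite coef_poly hi.
Qed.

(** The curvature matrix is exactly affine in u = N' / N and w = N'' / N. The Lagrangian is thus N
    times a polynomial in u and w, whose terms of degree at most one give T0, T1 and T2. *)
Lemma integrated_total c g :
  (forall A B psi, reduced m c A B psi = total m n.+1 g A B psi) ->
  integrated D k c (jetF g).
Proof.
move=> cg.
pose K r y0 y1 y2 : 'I_D -> 'I_D -> R :=
  kmat (- y2 / 2) (- y1 / (2 * r)) (- y1 / (2 * r)) ((k - y0) / r ^+ 2).
pose X r y0 y1 : 'I_D -> 'I_D -> R := fun a b =>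
  3 * r * (- y1 / (2 * r)) * kmat 1 0 0 0 a b + (- (y0 / r)) * kmat 0 1 0 0 a b.
(* The null second term gives [Y] the shape that [coef1_phiPD] expects. *)
pose Y y0 : 'I_D -> 'I_D -> R := fun a b => (- y0) * kmat 1 0 0 0 a b + 0 * kmat 1 0 0 0 a b.
exists (jetT0 g), (jetT1 g), (jetT2 g), (fun i j r y0 y1 y2 =>
  r ^+ m * phiE c (K r y0 y1 y2) (X r y0 y1) (Y y0) i j).
split=> [f r hf r0|N f r hN hf r0|f r hf r0].
- have [d0 _] := is_derive_jetT0 g hf r0; have [d2 _] := is_derive_jetT2 g hf r0.
  by [].
- have rn : r != 0 by rewrite gt_eqF.
  have Nn := admissible_neq0 hN r0; have fn := admissible_neq0 hf r0.
  set u := derive1 N r / N r; set w := derive1n 2 N r / N r.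
  rewrite lagrangian_phi //.
  pose K0 := K r (f r) (derive1 f r) (derive1n 2 f r).
  pose X0 := X r (f r) (derive1 f r); pose Y0 := Y (f r).
  rewrite (@eq_phi _ _ _ _ _ (fun a b => K0 a b + u * X0 a b + w * Y0 a b)); last first.
    move=> a b _; rewrite /K0 /X0 /Y0 /K /X /Y /kmat /u /w.
    by gen_derive; do !case: ifP => _; field; rewrite ?Nn ?rn.
  rewrite phi_expand2 (split_low_degree (fun i j => phiE c K0 X0 Y0 i j * u ^+ i * w ^+ j)).
  rewrite !expr0 !expr1 !mulr1.
  rewrite !mulrDr -!mulrA; congr (_ + _ + _ + _).
  + rewrite (derive1_is (is_derive_jetT0 g hf r0)); congr (_ * (_ * _)).
    rewrite phiE_axis1 // -horner_coef0 horner_phiP -cg; apply: eq_phi => a b _.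
    by rewrite mul0r addr0 /K0 /K /Af /Bf /pf.
  + rewrite phiE_axis1 // coef1_phiPD (coef1_A cg) (coef1_t cg) /along /jetT1 /u.
    by gen_derive; field; rewrite ?Nn ?rn.
  + rewrite phiE_axis2 // coef1_phiPD (coef1_A cg) /along /jetT2 /w.
    by gen_derive; field; rewrite ?Nn ?rn.
  rewrite !mulr_sumr; apply: eq_bigr => i _; rewrite !mulr_sumr; apply: eq_bigr => j _.
  by rewrite /along !mulrA.
- rewrite (derive1_is (is_derive_jetT2 g hf r0)) /along /jetF /Af /Bf /pf.
  by [].
Qed.

End IntegratedEquation.

(** * The integrated equation as a linear function of g *)

Section IntegratedForms.
Context {R : realType} (m n : nat) (k : R).
Hypothesis hk : - 4 < k.
Implicit Types (g : {poly R}).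
Local Notation jF := (jetF m n k).

Lemma dhomD N (p q : {poly R}) : dhom N (p + q) = dhom N p + dhom N q.
Proof. by apply/polyP => j; rewrite !(coefD, coef_dhom) mulrDr. Qed.

Lemma dhomZ N a (p : {poly R}) : dhom N (a *: p) = a *: dhom N p.
Proof. by apply/polyP => j; rewrite !(coefZ, coef_dhom) mulrCA. Qed.

Lemma jetFD g h r y0 y1 y2 : jF (g + h) r y0 y1 y2 = jF g r y0 y1 y2 + jF h r y0 y1 y2.
Proof.
by rewrite /jetF /jetT0 /jetT1 /total_dB !(derivD, dhomD) !homD; ring.
Qed.

Lemma jetFZ a g r y0 y1 y2 : jF (a *: g) r y0 y1 y2 = a * jF g r y0 y1 y2.
Proof.
by rewrite /jetF /jetT0 /jetT1 /total_dB !(derivZ, dhomZ) !homZ; ring.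
Qed.

(** f'' enters only through - f r^m A / (2 r) times the second B-derivative of the form of g, which
    must therefore vanish on psi = -1. *)
Lemma jetF_no_second_derivative g : (size g <= n.+3)%N ->
  (forall r y0 y1 y2 z2, 0 < r -> 0 < y0 -> jF g r y0 y1 y2 = jF g r y0 y1 z2) ->
  (size g <= 2)%N.
Proof.
move=> sg hF; have k4 : 0 < k + 4 by have := hk; lra.
have r2 : (0 : R) < 2 by [].
have h0 B : hom n g^`()^`() B (-1) = 0.
  (* The values - 2 and 0 of f'' correspond to A = 1 and A = 0. *)
  have := hF 2 (k + 4) (- 4 * B) (- 2) 0 r2 k4.
  rewrite /jetF /jetT0 /jetT1 /total_dB.
  have -> : - (- 4 * B) / (2 * 2) = B by field.
  have -> : (k - (k + 4)) / 2 ^+ 2 = -1 by field.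
  move/eqP; rewrite -subr_eq0 => /eqP e.
  have c0 : (k + 4) * 2 ^+ m / 4 != 0.
    by rewrite !mulf_neq0 ?invr_eq0 ?expf_neq0 ?pnatr_eq0 // gt_eqF.
  by apply: (mulfI c0); rewrite mulr0 -[RHS]oppr0 -e; field.
have m1 : (-1 : R) != 0 by rewrite oppr_eq0 oner_eq0.
apply/leq_sizeP => j hj; have [jn|jn] := leqP n.+3 j; first by move/leq_sizeP: sg => ->.
case: j hj jn => [|[|j]] // _ jn.
have e : (g^`()^`())`_j = 0.
  rewrite -[RHS](poly.coef0 R j); apply: (hom_inj m1 _ (n := n)) => [B|].
    by rewrite h0 hom0.
  by move: jn; rewrite !ltnS.
move/eqP: e; rewrite !coef_deriv -mulrnA mulrn_eq0 muln_eq0 /= => /eqP //.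
Qed.

Lemma hom_linear N a b x y : hom N.+1 (a%:P + b *: 'X) x y = a * y ^+ N.+1 + b * x * y ^+ N :> R.
Proof.
rewrite /hom big_ord_recl [X in _ + X]big_ord_recl big1 => [|i _].
  by rewrite !coefE /= subn0 subn1 /=; ring.
by rewrite !coefE /= mulr0 addr0 !mul0r.
Qed.

Lemma size2_linear g : (size g <= 2)%N -> g = (g`_0)%:P + g`_1 *: 'X.
Proof.
move=> sg; apply/polyP => -[|[|j]]; rewrite !coefE /= ?mulr0 ?addr0 ?mulr1 ?add0r //.
by move/leq_sizeP: sg => ->.
Qed.

(** The terms with an explicit factor f add up to a multiple of the constraint on g. *)
Lemma jetF_linear g r y0 y1 y2 : (size g <= 2)%N -> 0 < r ->
  m.+2%:R * g^`().[1] = 2 * n.+2%:R * g.[1] ->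
  jF g r y0 y1 y2 = g`_0 * (r ^+ m * r * ((k - y0) / r ^+ 2) ^+ n.+2).
Proof.
move=> sg r0; rewrite (size2_linear sg); move: (g`_0) (g`_1) => a b.
have rn : r != 0 by rewrite gt_eqF.
have d1 : (a%:P + b *: 'X)^`() = b%:P + 0 *: 'X :> {poly R}.
  by rewrite derivD derivC derivZ derivX add0r scale0r addr0 -mul_polyC mulr1.
have d2 : (b%:P + 0 *: 'X)^`() = 0 :> {poly R}.
  by rewrite derivD derivC derivZ derivX scale0r addr0.
have e1 : dhom n.+2 (a%:P + b *: 'X) = (n.+2%:R * a)%:P + (n.+1%:R * b) *: 'X.
  apply/polyP => -[|[|j]]; rewrite !(coef_dhom, coefE) /=; first by ring.
    by rewrite [n.+2%:R]mulrSr; ring.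
  by ring.
have e2 x y : hom n (dhom n.+1 (b%:P + 0 *: 'X)) x y = n.+1%:R * b * y ^+ n.
  have -> : dhom n.+1 (b%:P + 0 *: 'X) = (n.+1%:R * b)%:P.
    by apply/polyP => -[|j]; rewrite !(coef_dhom, coefE) /=; ring.
  rewrite /hom big_ord_recl big1 => [|i _]; first by rewrite coefC subn0 mulr1 addr0.
  by rewrite coefC /= !mul0r.
move=> e; rewrite d1 !hornerE /= in e.
have -> : (a%:P + b *: 'X)`_0 = a by rewrite !coefE /= mulr0 addr0.
rewrite /jetF /jetT0 /jetT1 /total_dB d1 d2 hom0 e1 e2 !hom_linear.
move: ((k - y0) / r ^+ 2) => psi; move: (- y1 / (2 * r)) (- y2 / 2) => B A.
apply/eqP; rewrite -subr_eq0; apply/eqP.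
transitivity (y0 * r ^+ m / r * psi ^+ n.+1 / 2
   * (2 * n.+2%:R * (a + b) - m.+2%:R * b)); last by rewrite -e; ring.
rewrite [m.+2%:R]mulrSr [m.+1%:R]mulrSr [n.+2%:R]mulrSr [n.+1%:R]mulrSr !exprS.
by field.
Qed.

(** Once g is linear, taking f = k + r^2, so that psi = -1, leaves g(0) r^(m + 1) up to sign; the
    radii 2 and 3 force g(0) = 0. *)
Lemma jetF_constant g C : (size g <= n.+3)%N ->
  m.+2%:R * g^`().[1] = 2 * n.+2%:R * g.[1] ->
  (forall r y0 y1 y2, 0 < r -> 0 < y0 -> jF g r y0 y1 y2 = C) ->
  (size g <= 2)%N /\ g`_0 = 0.
Proof.
move=> sg e hF; have s2 : (size g <= 2)%N.
  by apply: jetF_no_second_derivative => // r y0 y1 y2 z2 r0 y00; rewrite !hF.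
split=> //; have hg r : 0 < r -> 0 < k + r ^+ 2 -> g`_0 * (r ^+ m.+1 * (-1) ^+ n.+2) = C.
  move=> r0 kr; have rn : r != 0 by rewrite gt_eqF.
  rewrite -(hF r (k + r ^+ 2) 0 0 r0 kr) jetF_linear //.
  have -> : (k - (k + r ^+ 2)) / r ^+ 2 = -1 by field.
  by rewrite exprSr.
have h2 : g`_0 * (2 ^+ m.+1 * (-1) ^+ n.+2) = C by apply: hg => //; have := hk; lra.
have h3 : g`_0 * (3 ^+ m.+1 * (-1) ^+ n.+2) = C by apply: hg => //; have := hk; lra.
move/eqP: h3; rewrite -h2 -subr_eq0 -mulrBr -mulrBl mulf_eq0.
move=> /orP[/eqP //|]; rewrite mulf_eq0 => /orP[|]; last first.
  by rewrite expf_eq0 oppr_eq0 oner_eq0 andbF.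
rewrite subr_eq0 => /eqP e3.
have : (2 : R) ^+ m.+1 < 3 ^+ m.+1 by rewrite ltrXn2r // ltr_nat.
by rewrite e3 ltxx.
Qed.

End IntegratedForms.

(** * Realizable reduced densities *)

Section LabelledContraction.
Context {R : realType} {D : nat}.
Implicit Types (K : 'I_D -> 'I_D -> R).

Definition Rm K a b c d : R :=
  K a b * (((a == c) && (b == d))%:R - ((a == d) && (b == c))%:R).

(* The contraction in which the slot x carries the summation index e x. *)
Definition labsum {n : nat} {J : finType} (e : slot n -> J) K : R :=
  \sum_(w : {ffun J -> 'I_D}) \prod_(l < n)
    Rm K (w (e (sl l 0))) (w (e (sl l 1))) (w (e (sl l 2))) (w (e (sl l 3))).

(** The contracted pair containing a slot: (l, false) for the images of (l, 0) and (l, 1), and (l,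
    true) for those of (l, 2) and (l, 3). *)
Definition perm_label {n : nat} (s : {perm slot n}) (x : slot n) : 'I_n * bool :=
  let y := (s^-1)%g x in (y.1, (1 < y.2)%N).

Lemma ord4P (j : 'I_4) : [\/ j = inord 0, j = inord 1, j = inord 2 | j = inord 3].
Proof.
by case: j => [[|[|[|[|]]]]] //= h; [apply: Or41|apply: Or42|apply: Or43|apply: Or44];
  apply/val_inj; rewrite /= inordK.
Qed.

Lemma perm_label_pair n (s : {perm slot n}) l :
  [/\ perm_label s (s (sl l 0)) = (l, false), perm_label s (s (sl l 1)) = (l, false),
      perm_label s (s (sl l 2)) = (l, true) & perm_label s (s (sl l 3)) = (l, true)].
Proof. by rewrite /perm_label !permK /sl /= !inordK. Qed.

(** The contraction deltas restrict the sum to index assignments that are constant on contracted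
    pairs. *)
Lemma ctr_labsum n (s : {perm slot n}) K : ctr s K = labsum (perm_label s) K.
Proof.
pose lift (w : {ffun 'I_n * bool -> 'I_D}) : {ffun slot n -> 'I_D} :=
  [ffun x => w (perm_label s x)].
pose restrict (v : {ffun slot n -> 'I_D}) : {ffun 'I_n * bool -> 'I_D} :=
  [ffun p => v (s (sl p.1 (if p.2 then 2 else 0)))].
have lr v : pairing s v = (lift (restrict v) == v)%:R.
  have [/eqP e|ne] := boolP (lift (restrict v) == v).
    rewrite /pairing big1 // => l _; rewrite -e !ffunE.
    by have [-> -> -> ->] := perm_label_pair s l; rewrite !eqxx mulr1.
  apply/eqP; apply: contraNT ne => /prodf_neq0 h; apply/eqP/ffunP => x.
  rewrite -(permKV s x); case: ((s^-1)%g x) => l j; rewrite !ffunE /perm_label permK /=.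
  have := h l isT; rewrite mulf_eq0 negb_or !pnatr_eq0 !eqb0 !negbK => /andP[/eqP h1 /eqP h2].
  by case: (ord4P j) => ->; rewrite inordK //= -?[(l, inord 1)]/(sl l 1) ?h1 ?h2.
rewrite /ctr /labsum.
rewrite (eq_bigr (fun v => if lift (restrict v) == v then
   \prod_l Rm K (v (sl l 0)) (v (sl l 1)) (v (sl l 2)) (v (sl l 3)) else 0)); last first.
  move=> v _; rewrite lr; case: eqP => _; last by rewrite mulr0 mul0r.
  rewrite mulr1 -big_split; apply: eq_bigr => l _.
  by rewrite /Rm /rdelta mulrC.
rewrite -big_mkcond (reindex_onto lift restrict) => [|v /eqP //].
apply: eq_big => [w|w _]; last by apply: eq_bigr => l _; rewrite !ffunE.
have rl : restrict (lift w) = w.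
  apply/ffunP => -[l b]; rewrite !ffunE; have [e0 _ e2 _] := perm_label_pair s l.
  by case: b; rewrite ?e0 ?e2.
by rewrite rl !eqxx.
Qed.

Lemma labsum_bij n (J J' : finType) (e : slot n -> J) (h : J -> J') (h' : J' -> J) K :
  cancel h h' -> cancel h' h -> labsum (fun x => h (e x)) K = labsum e K.
Proof.
move=> hK h'K; rewrite /labsum.
rewrite (reindex (fun w : {ffun J -> 'I_D} => [ffun j => w (h' j)] : {ffun J' -> 'I_D})).
  apply: eq_bigr => w _; apply: eq_bigr => l _; by rewrite !ffunE !hK.
exists (fun w : {ffun J' -> 'I_D} => [ffun j => w (h j)]) => w _; apply/ffunP => j.
  by rewrite !ffunE hK.
by rewrite !ffunE h'K.
Qed.

Definition two_fibred {n : nat} {J : finType} (e : slot n -> J) :=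
  forall j, #|[pred x | e x == j]| = 2%N.

(** Match labels with pairs (l, b) by a bijection and order each fibre by letting the slot returned
    by [pick] come first. This sends slots bijectively to positions; the inverse is the
    permutation. *)
Lemma two_fibred_perm n (J : finType) (e : slot n -> J) : two_fibred e ->
  exists s : {perm slot n}, forall K, ctr s K = labsum e K.
Proof.
move=> he.
have cJ : #|J| = #|{: 'I_n * bool}|.
  have : #|{: slot n}| = (#|J| * 2)%N.
    rewrite -sum1_card (partition_big e predT) //= -sum_nat_const; apply: eq_bigr => j _.
    by rewrite sum1_card he.
  by rewrite !card_prod card_bool !card_ord; lia.
pose h j : 'I_n * bool := enum_val (cast_ord cJ (enum_rank j)).
pose h' p : J := enum_val (cast_ord (esym cJ) (enum_rank p)).
have hK : cancel h h' by move=> j; rewrite /h /h' enum_valK cast_ordK enum_rankK.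
have h'K : cancel h' h by move=> p; rewrite /h /h' enum_valK cast_ordKV enum_rankK.
pose first x := Some x == [pick y | e y == e x].
pose t (x : slot n) : slot n := ((h (e x)).1, inord
  (if (h (e x)).2 then (if first x then 2 else 3) else if first x then 0 else 1)).
have t_inj : injective t.
  move=> x y [e1 /(congr1 val) e2]; move: e2.
  have lt4 z : ((if (h (e z)).2 then if first z then 2 else 3 else
     if first z then 0 else 1) < 4)%N by case: (h _).2; case: (first _).
  rewrite /= !inordK // => e2.
  have [e3 fxy] : (h (e x)).2 = (h (e y)).2 /\ first x = first y.
    by move: e2; case: (h (e x)).2; case: (h (e y)).2; case: (first x); case: (first y).
  have exy : e x = e y.
    by apply: (can_inj hK); rewrite [LHS]surjective_pairing e1 e3 -surjective_pairing.
  have [fx|fx] := boolP (first x).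
    have fy := fx; rewrite fxy in fy; move/eqP: fx; move/eqP: fy.
    by rewrite exy => <- [].
  have fy := fx; rewrite fxy in fy.
  move: fx fy; rewrite /first exy; case: pickP => [z /eqP ez|/(_ y)]; last by rewrite eqxx.
  move=> xz yz; apply/eqP; apply: contraT => xy.
  (* Two distinct slots that both fail to be first would make three slots with one label. *)
  have : (#|z |: [set x; y]| <= #|[pred x | e x == e y]|)%N.
    apply: subset_leq_card; apply/fintype.subsetP => u; rewrite !inE.
    by move=> /or3P[] /eqP ->; rewrite ?exy ?ez.
  have zx : z != x by apply: contraNneq xz => ->.
  have zy : z != y by apply: contraNneq yz => ->.
  by rewrite he cardsU1 cards2 !inE negb_or zx zy xy.
exists ((perm t_inj)^-1)%g => K; rewrite ctr_labsum -(labsum_bij _ _ hK h'K).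
apply: eq_bigr => w _; apply: eq_bigr => l _.
suff le x : perm_label ((perm t_inj)^-1)%g x = h (e x) by rewrite !le.
rewrite /perm_label invgK permE /t /= inordK; last by case: (h _).2; case: (first _).
by rewrite [RHS]surjective_pairing; congr (_, _); case: (h _).2; case: (first x).
Qed.

End LabelledContraction.

(** * Products of contractions *)

Section ProductContraction.
Context {R : realType} {D : nat}.
Implicit Types (K : 'I_D -> 'I_D -> R).

Lemma card_slot n (P : pred (slot n)) : #|P| = (\sum_x (P x : nat))%N.
Proof. by rewrite -sum1_card big_mkcond; apply: eq_bigr => x _; rewrite unfold_in; case: (P x). Qed.

Lemma two_fibred_perm_label n (s : {perm slot n}) : two_fibred (perm_label s).
Proof.
move=> [l b]; rewrite card_slot (reindex_inj (@perm_inj _ s)) /=.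
rewrite (sum_slot (fun x => perm_label s (s x) == (l, b) : nat)) -!big_split /=.
rewrite (bigD1 l) //= big1 => [|l' /negbTE ll'].
  by have [-> -> -> ->] := perm_label_pair s l; rewrite !xpair_eqE eqxx; case: b.
by have [-> -> -> ->] := perm_label_pair s l'; rewrite !xpair_eqE ll'.
Qed.

Lemma sum_slot_split n1 n2 (F : slot (n1 + n2) -> nat) :
  (\sum_x F x = \sum_(x : slot n1) F (lshift n2 x.1, x.2)
              + \sum_(x : slot n2) F (rshift n1 x.1, x.2))%N.
Proof.
rewrite !sum_slot !big_split_ord /sl /=; do !move: (bigop _ _ _) => ?; lia.
Qed.

(** The disjoint union of the two labellings is again two to one, and its sum over index assignments
    factors. *)
Lemma ctr_mul n1 n2 (s1 : {perm slot n1}) (s2 : {perm slot n2}) :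
  exists s : {perm slot (n1 + n2)}, forall K, ctr s K = ctr s1 K * ctr s2 K.
Proof.
pose e (x : slot (n1 + n2)) : 'I_n1 * bool + 'I_n2 * bool :=
  match fintype.split x.1 with inl l => inl (perm_label s1 (l, x.2))
                     | inr l => inr (perm_label s2 (l, x.2)) end.
have el l j : e (sl (lshift n2 l) j) = inl (perm_label s1 (sl l j)).
  by rewrite /e /= (unsplitK (inl _ l)).
have er l j : e (sl (rshift n1 l) j) = inr (perm_label s2 (sl l j)).
  by rewrite /e /= (unsplitK (inr _ l)).
have he : two_fibred e.
  move=> j; rewrite card_slot (sum_slot_split (fun x => e x == j : nat)).
  rewrite (eq_bigr (fun x => inl (perm_label s1 x) == j : nat)); last first.
    by case=> l i _; rewrite /e /= (unsplitK (inl _ l)).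
  rewrite [X in (_ + X)%N](eq_bigr (fun x => inr (perm_label s2 x) == j : nat)); last first.
    by case=> l i _; rewrite /e /= (unsplitK (inr _ l)).
  case: j => u.
    by rewrite [X in (_ + X)%N]big1 // addn0 -card_slot two_fibred_perm_label.
  by rewrite big1 // add0n -card_slot two_fibred_perm_label.
have [s hs] := two_fibred_perm (R := R) (D := D) he; exists s => K.
rewrite hs !ctr_labsum /labsum mulr_suml.
under [RHS]eq_bigr do rewrite mulr_sumr.
rewrite pair_bigA /=.
pose join (p : {ffun 'I_n1 * bool -> 'I_D} * {ffun 'I_n2 * bool -> 'I_D}) :=
  [ffun j => match j with inl u => p.1 u | inr u => p.2 u end] :
  {ffun 'I_n1 * bool + 'I_n2 * bool -> 'I_D}.
rewrite (reindex join); last first.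
  exists (fun w : {ffun 'I_n1 * bool + 'I_n2 * bool -> 'I_D} => ([ffun u => w (inl u)], [ffun u => w (inr u)])) => [[w1 w2]|w] _.
    by congr (_, _); apply/ffunP => u; rewrite !ffunE.
  by apply/ffunP => -[u|u]; rewrite !ffunE.
apply: eq_bigr => -[w1 w2] _; rewrite big_split_ord; congr (_ * _); apply: eq_bigr => l _.
  by rewrite !el !ffunE.
by rewrite !er !ffunE.
Qed.

End ProductContraction.

(** * Explicit contractions written as words *)

Section ContractionWords.
Context {R : realType} {d : nat}.
Local Notation D := d.+1.
Implicit Types (K : 'I_D -> 'I_D -> R) (L : seq (seq nat)).

Fixpoint isum m (F : seq 'I_D -> R) : R :=
  if m is m'.+1 then \sum_a isum m' (fun u => F (a :: u)) else F [::].

Lemma isum_ffun m (F : seq 'I_D -> R) : \sum_(w : {ffun 'I_m -> 'I_D}) F (codom w) = isum m F.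
Proof.
elim: m F => [|m IH] F /=.
  rewrite (big_pred1 [ffun=> ord0]) => [|w].
    by congr F; apply: size0nil; rewrite size_codom card_ord.
  by apply/esym/eqP/ffunP => -[].
under [RHS]eq_bigr do rewrite -IH.
rewrite pair_bigA /=.
pose cons (p : 'I_D * {ffun 'I_m -> 'I_D}) : {ffun 'I_m.+1 -> 'I_D} :=
  [ffun i => if unlift ord0 i is Some j then p.2 j else p.1].
rewrite (reindex cons); last first.
  exists (fun w : {ffun 'I_m.+1 -> 'I_D} => (w ord0, [ffun j => w (lift ord0 j)])).
    by move=> [a w] _; congr (_, _); [|apply/ffunP => j];
      rewrite !ffunE ?unlift_none ?liftK.
  by move=> w _; apply/ffunP => i; rewrite !ffunE; case: unliftP => [j|] ->; rewrite ?ffunE.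
apply: eq_bigr => -[a w] _; congr F.
rewrite !codomE enum_ordSl /= !ffunE unlift_none; congr (_ :: _).
by rewrite -map_comp; apply: eq_map => j; rewrite /= ffunE liftK.
Qed.

Definition wprod K L (u : seq 'I_D) : R :=
  foldr (fun q P => Rm K (nth ord0 u (nth 0%N q 0)) (nth ord0 u (nth 0%N q 1))
                         (nth ord0 u (nth 0%N q 2)) (nth ord0 u (nth 0%N q 3)) * P) 1 L.

(* A word lists, for each Riemann tensor, the labels of its four indices; each
   label occurs twice and is summed over. *)
Definition word p L : bool :=
  all (fun q => (size q == 4%N) && all (gtn p) q) L &&
  all (fun j => count_mem j (flatten L) == 2%N) (iota 0 p).

Lemma wordP n p L : size L = n -> word p.+1 L ->
  exists s : {perm slot n}, forall K, ctr s K = isum p.+1 (wprod K L).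
Proof.
move=> sL /andP[/allP Lb /allP L2].
pose lab (x : slot n) := nth 0%N (nth [::] L x.1) x.2.
pose e (x : slot n) : 'I_p.+1 := inord (lab x).
have lab_lt x : (lab x < p.+1)%N.
  have lx : (x.1 < size L)%N by rewrite sL.
  have /andP[/eqP s4 /allP] := Lb _ (mem_nth [::] lx).
  by apply; apply: mem_nth; rewrite s4.
have he : two_fibred e.
  move=> j; rewrite card_slot (sum_slot (fun x => e x == j : nat)).
  have ej x : (e x == j) = (lab x == j) by rewrite -val_eqE /= inordK.
  have jp : nat_of_ord j \in iota 0 p.+1 by rewrite mem_iota /=.
  rewrite -[RHS](eqP (L2 _ jp)) !(eq_bigr _ (fun l _ => congr1 nat_of_bool (ej _))).
  have sumL i : (i < 4)%N -> (\sum_(l < n) (lab (sl l i) == j) = \sum_(q <- L) (nth 0 q i == j))%N.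
    by move=> i4; rewrite (big_nth [::]) big_mkord sL; apply: eq_bigr => l _; rewrite /lab /= inordK.
  rewrite !sumL // -!big_split /= count_flatten sumnE big_map big_seq [RHS]big_seq.
  apply: eq_bigr => q /Lb /andP[/eqP s4 _].
  by case: q s4 => [|a [|b [|c [|f []]]]] //= _; rewrite addn0 !addnA.
have [s hs] := two_fibred_perm (R := R) (D := D) he; exists s => K.
rewrite hs -isum_ffun; apply: eq_bigr => w _.
have eqL : wprod K L (codom w) = \prod_(q <- L)
   Rm K (nth ord0 (codom w) (nth 0%N q 0)) (nth ord0 (codom w) (nth 0%N q 1))
        (nth ord0 (codom w) (nth 0%N q 2)) (nth ord0 (codom w) (nth 0%N q 3)).
  by rewrite /wprod unlock.
rewrite eqL (big_nth [::]) big_mkord sL; apply: eq_bigr => l _.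
have we i : (i < 4)%N -> w (e (sl l i)) = nth ord0 (codom w) (nth 0%N (nth [::] L l) i).
  move=> i4; have := lab_lt (sl l i); rewrite /lab /= inordK // => lt.
  rewrite codomE (nth_map ord0) ?size_enum_ord //; congr (w _); apply/val_inj.
  by rewrite /= nth_enum_ord // (inordK (lab_lt _)) /lab /= inordK.
by rewrite !we.
Qed.

End ContractionWords.

Section WordRules.
Context {R : realType} {d : nat}.
Local Notation D := d.+1.
Variable K : 'I_D -> 'I_D -> R.
Hypotheses (K0 : forall a, K a a = 0) (KC : forall a b, K a b = K b a).
Implicit Types (a b c : 'I_D).

Definition ric a : R := \sum_c K a c.

Lemma ric_delta a b : \sum_c Rm K a c b c = (a == b)%:R * ric a.
Proof.
rewrite /Rm /ric mulr_sumr; apply: eq_bigr => c _.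
rewrite eqxx andbT; case: (a =P c) => [->|_]; first by rewrite K0 mulr0 mul0r.
by rewrite subr0 mulrC.
Qed.

Lemma sum_ric a (X : 'I_D -> R) : \sum_b \sum_c Rm K a c b c * X b = ric a * X a.
Proof.
under eq_bigr do rewrite -mulr_suml ric_delta.
rewrite (bigD1 a) //= eqxx mul1r big1 ?addr0 // => b.
by rewrite eq_sym => /negbTE ->; rewrite !mul0r.
Qed.

(** On bivectors the curvature acts as K times antisymmetrization. *)
Lemma sum_Rm a b (X : 'I_D -> 'I_D -> R) :
  \sum_c \sum_d Rm K a b c d * X c d = K a b * (X a b - X b a).
Proof.
have dl (u v : 'I_D) : \sum_c \sum_d ((u == c) && (v == d))%:R * X c d = X u v.
  rewrite (bigD1 u) //= (bigD1 v) //= !eqxx mul1r big1 => [|e].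
    by rewrite addr0 big1 ?addr0 // => c; rewrite eq_sym => /negbTE ->; rewrite big1 // => e; rewrite mul0r.
  by rewrite eq_sym => /negbTE ->; rewrite mul0r.
rewrite mulrBr -{1}(dl a b) -(dl b a) !mulr_sumr -sumrB; apply: eq_bigr => c _.
rewrite !mulr_sumr -sumrB; apply: eq_bigr => e _.
rewrite /Rm [(a == e) && _]andbC; ring.
Qed.

Lemma Rm_abab a b : Rm K a b a b = K a b.
Proof.
rewrite /Rm !eqxx; case: (a =P b) => [->|_]; first by rewrite K0 mul0r.
by rewrite subr0 mulr1.
Qed.

Lemma Rm_abba a b : Rm K a b b a = - K a b.
Proof.
rewrite /Rm !eqxx; case: (a =P b) => [->|_]; first by rewrite K0 mul0r oppr0.
by rewrite sub0r mulrN1.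
Qed.

Ltac nest := rewrite /=; do ?[rewrite ?mulr_sumr; apply: eq_bigr => ? _]; rewrite ?mulr1 //.

Lemma word_R : isum 2 (wprod K [:: [:: 0; 1; 0; 1]%N]) = \sum_a ric a.
Proof.
by rewrite /=; apply: eq_bigr => a _; apply: eq_bigr => b _; rewrite mulr1 Rm_abab.
Qed.

Lemma word_Ric2 : isum 4 (wprod K [:: [:: 0; 2; 1; 2]; [:: 0; 3; 1; 3]]%N) = \sum_a ric a ^+ 2.
Proof.
transitivity (\sum_a \sum_b \sum_c Rm K a c b c * \sum_e Rm K a e b e); first by nest.
by apply: eq_bigr => a _; rewrite sum_ric ric_delta eqxx mul1r.
Qed.

Lemma word_Riem2 : isum 4 (wprod K [:: [:: 0; 1; 2; 3]; [:: 0; 1; 2; 3]]%N) =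
  \sum_a \sum_b 2 * K a b ^+ 2.
Proof.
transitivity (\sum_a \sum_b \sum_c \sum_e Rm K a b c e * Rm K a b c e); first by nest.
apply: eq_bigr => a _; apply: eq_bigr => b _.
by rewrite sum_Rm Rm_abab Rm_abba; ring.
Qed.

Lemma word_Ric3 : isum 6 (wprod K [:: [:: 0; 2; 1; 2]; [:: 1; 4; 3; 4]; [:: 0; 5; 3; 5]]%N) =
  \sum_a ric a ^+ 3.
Proof.
transitivity (\sum_a \sum_b \sum_c Rm K a c b c *
  \sum_u \sum_v Rm K b v u v * \sum_w Rm K a w u w); first by nest.
by apply: eq_bigr => a _; rewrite !sum_ric ric_delta eqxx mul1r.
Qed.

Lemma word_RicRicRiem :
  isum 6 (wprod K [:: [:: 0; 2; 1; 2]; [:: 3; 5; 4; 5]; [:: 0; 3; 1; 4]]%N) =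
  \sum_a \sum_b ric a * ric b * K a b.
Proof.
transitivity (\sum_a \sum_b \sum_c Rm K a c b c *
  \sum_u \sum_v \sum_w Rm K u w v w * Rm K a u b v); first by nest.
apply: eq_bigr => a _; rewrite sum_ric mulr_sumr; apply: eq_bigr => u _.
by rewrite sum_ric Rm_abab; ring.
Qed.

Lemma word_RicRiem2 :
  isum 6 (wprod K [:: [:: 0; 2; 1; 2]; [:: 0; 3; 4; 5]; [:: 1; 3; 4; 5]]%N) =
  \sum_a \sum_b 2 * ric a * K a b ^+ 2.
Proof.
transitivity (\sum_a \sum_b \sum_c Rm K a c b c *
  \sum_u \sum_v \sum_w Rm K a u v w * Rm K b u v w); first by nest.
apply: eq_bigr => a _; rewrite sum_ric mulr_sumr; apply: eq_bigr => u _.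
by rewrite sum_Rm Rm_abab Rm_abba; ring.
Qed.

Lemma word_Riem3 :
  isum 6 (wprod K [:: [:: 0; 1; 2; 3]; [:: 2; 3; 4; 5]; [:: 4; 5; 0; 1]]%N) =
  \sum_a \sum_b 4 * K a b ^+ 3.
Proof.
transitivity (\sum_a \sum_b \sum_c \sum_u Rm K a b c u *
  \sum_v \sum_w Rm K c u v w * Rm K v w a b); first by nest.
apply: eq_bigr => a _; apply: eq_bigr => b _.
by rewrite sum_Rm !sum_Rm !Rm_abab !Rm_abba (KC b a); ring.
Qed.

Lemma word_Ric2RicRiem :
  isum 8 (wprod K [:: [:: 0; 2; 1; 2]; [:: 1; 4; 3; 4]; [:: 5; 7; 6; 7]; [:: 0; 5; 3; 6]]%N) =
  \sum_a \sum_b ric a ^+ 2 * ric b * K a b.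
Proof.
transitivity (\sum_a \sum_b \sum_c Rm K a c b c * \sum_u \sum_v Rm K b v u v *
  \sum_x \sum_y \sum_z Rm K x z y z * Rm K a x u y); first by nest.
apply: eq_bigr => a _; rewrite !sum_ric !mulr_sumr; apply: eq_bigr => x _.
by rewrite sum_ric Rm_abab; ring.
Qed.

Lemma word_RicRiem3 :
  isum 8 (wprod K [:: [:: 0; 2; 1; 2]; [:: 0; 3; 4; 5]; [:: 4; 5; 6; 7]; [:: 6; 7; 1; 3]]%N) =
  \sum_a \sum_b 4 * ric a * K a b ^+ 3.
Proof.
transitivity (\sum_a \sum_b \sum_c Rm K a c b c * \sum_u \sum_v \sum_w Rm K a u v w *
  \sum_x \sum_y Rm K v w x y * Rm K x y b u); first by nest.
apply: eq_bigr => a _; rewrite sum_ric mulr_sumr; apply: eq_bigr => u _.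
by rewrite sum_Rm !sum_Rm !Rm_abab !Rm_abba (KC u a); ring.
Qed.

End WordRules.

(** * Functions of A, B and psi that are values of densities *)

Section Realizable.
Context {R : realType} (m : nat).
Local Notation D := m.+2.
Implicit Types (A B psi : R) (P Q : R -> R -> R -> R).

Definition realizable n P := exists c : density R n, forall A B psi,
  phi (D := D) c (kmat A B B psi) = P A B psi.

Lemma eq_realizable n P Q : (forall A B psi, P A B psi = Q A B psi) ->
  realizable n P -> realizable n Q.
Proof. by move=> PQ [c hc]; exists c => A B psi; rewrite hc. Qed.

Lemma realizableZD n (x y : R) P Q : realizable n P -> realizable n Q ->
  realizable n (fun A B psi => x * P A B psi + y * Q A B psi).
Proof.
by move=> [c hc] [c' hc']; exists (x *: c + y *: c') => A B psi; rewrite phiZD hc hc'.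
Qed.

Lemma realizableZ n (x : R) P : realizable n P -> realizable n (fun A B psi => x * P A B psi).
Proof.
move=> hP; apply: eq_realizable (realizableZD x 0 hP hP) => A B psi; by rewrite mul0r addr0.
Qed.

Lemma realizableD n P Q : realizable n P -> realizable n Q ->
  realizable n (fun A B psi => P A B psi + Q A B psi).
Proof.
move=> hP hQ; apply: eq_realizable (realizableZD 1 1 hP hQ) => A B psi; by rewrite !mul1r.
Qed.

Lemma realizable0 n : realizable n (fun _ _ _ => 0).
Proof.
exists 0 => A B psi; rewrite phi_ctr big1 // => s _; by rewrite ffunE mul0r.
Qed.

Lemma realizable_sum n (I : finType) (F : I -> R -> R -> R -> R) :
  (forall i, realizable n (F i)) -> realizable n (fun A B psi => \sum_i F i A B psi).
Proof.
move=> hF; elim: (index_enum I) => [|i r IH].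
  by apply: eq_realizable (realizable0 n) => A B psi; rewrite big_nil.
by apply: eq_realizable (realizableD (hF i) IH) => A B psi; rewrite big_cons.
Qed.

Lemma phi_delta n (s : {perm slot n}) (K : 'I_D -> 'I_D -> R) :
  phi [ffun t => (t == s)%:R] K = ctr s K.
Proof.
rewrite phi_ctr (bigD1 s) //= ffunE eqxx mul1r big1 ?addr0 // => t /negbTE ts.
by rewrite ffunE ts mul0r.
Qed.

Lemma realizable_ctr n (s : {perm slot n}) :
  realizable n (fun A B psi => ctr s (kmat A B B psi : 'I_D -> 'I_D -> R)).
Proof. by exists [ffun t => (t == s)%:R] => A B psi; rewrite phi_delta. Qed.

Lemma realizableM n1 n2 P Q : realizable n1 P -> realizable n2 Q ->
  realizable (n1 + n2) (fun A B psi => P A B psi * Q A B psi).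
Proof.
move=> [c hc] [c' hc']; set K := fun A B psi => kmat A B B psi : 'I_D -> 'I_D -> R.
apply: (@eq_realizable _ (fun A B psi =>
    \sum_s \sum_t (c s * c' t) * (ctr s (K A B psi) * ctr t (K A B psi)))).
  move=> A B psi; rewrite -hc -hc' !phi_ctr mulr_suml; apply: eq_bigr => s _.
  by rewrite mulr_sumr; apply: eq_bigr => t _; rewrite mulrACA.
apply: realizable_sum => s; apply: realizable_sum => t.
have [u hu] := ctr_mul (R := R) (D := D) s t; apply: realizableZ.
by apply: eq_realizable (realizable_ctr u) => A B psi; rewrite hu.
Qed.

Lemma realizable_one : realizable 0 (fun _ _ _ => 1).
Proof.
apply: eq_realizable (realizable_ctr 1%g) => A B psi.
rewrite /ctr (big_pred1 [ffun=> ord0]) => [|v]; first by rewrite /pairing !big_ord0 !mul1r.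
by apply/esym/eqP/ffunP => -[[]].
Qed.

Definition kval A B psi (s t : bool) : R := if s && t then A else if s || t then B else psi.

Definition is_tr (a : 'I_D) : bool := (a <= 1)%N.

(** [kmat] with the zero diagonal that the word rules require; off the diagonal an entry depends
    only on the types of its indices. *)
Definition koff A B psi (a b : 'I_D) : R :=
  if a == b then 0 else kval A B psi (is_tr a) (is_tr b).

Lemma koff0 A B psi a : koff A B psi a a = 0.
Proof. by rewrite /koff eqxx. Qed.

Lemma koffC A B psi a b : koff A B psi a b = koff A B psi b a.
Proof. by rewrite /koff eq_sym /kval andbC orbC. Qed.

Lemma realizable_word n p (L : seq (seq nat)) : size L = n -> word p.+1 L ->
  realizable n (fun A B psi => isum p.+1 (wprod (koff A B psi) L)).
Proof.
move=> sL wL; have [s hs] := wordP (R := R) (d := m.+1) sL wL.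
exists [ffun t => (t == s)%:R] => A B psi; rewrite -hs -phi_delta.
apply: eq_phi => a b /negbTE ab; rewrite /koff ab /kmat /kval /is_tr.
by case: a b {ab} => [[|[|a]] ha] [[|[|b]] hb].
Qed.

Lemma sum_tr (h : bool -> R) : \sum_a h (is_tr a) = 2 * h true + m%:R * h false.
Proof.
rewrite !big_ord_recl /= (eq_bigr (fun _ => h false)) // sumr_const card_ord -mulr_natl.
by ring.
Qed.

(** Supplying the missing diagonal term reduces the sum to a count of index types. *)
Lemma sum_koff A B psi (F : R -> bool -> R) a : (forall t, F 0 t = 0) ->
  \sum_b F (koff A B psi a b) (is_tr b) =
    if is_tr a then F A true + m%:R * F B false
    else 2 * F B true + (m%:R - 1) * F psi false.
Proof.
move=> F0; pose h t := F (kval A B psi (is_tr a) t) t.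
have : \sum_b F (koff A B psi a b) (is_tr b) + h (is_tr a) = \sum_b h (is_tr b).
  rewrite (bigD1 a) //= koff0 F0 add0r [RHS](bigD1 a) //= addrC; congr (_ + _).
  by apply: eq_bigr => b; rewrite eq_sym /koff => /negbTE ->.
move/(canRL (addrK _)) ->; rewrite sum_tr /h /kval; case: (is_tr a) => /=; ring.
Qed.

Lemma sum2_koff A B psi (F : R -> bool -> bool -> R) : (forall s t, F 0 s t = 0) ->
  \sum_a \sum_b F (koff A B psi a b) (is_tr a) (is_tr b) =
    2 * (F A true true + m%:R * F B true false)
    + m%:R * (2 * F B false true + (m%:R - 1) * F psi false false).
Proof.
move=> F0; rewrite -[RHS](sum_tr (fun s => if s then F A true true + m%:R * F B true false
   else 2 * F B false true + (m%:R - 1) * F psi false false)).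
apply: eq_bigr => a _; rewrite (sum_koff _ _ _ (F := F ^~ (is_tr a))) //.
by case: (is_tr a).
Qed.

Definition ricval A B psi (t : bool) : R :=
  if t then A + m%:R * B else 2 * B + (m%:R - 1) * psi.

Lemma ric_koff A B psi a : ric (koff A B psi) a = ricval A B psi (is_tr a).
Proof. exact: (sum_koff _ _ _ (F := fun x _ => x)). Qed.

End Realizable.

(** * Monomials in the scalar curvature and the two amplitudes *)

Section Monomials.
Context {R : realType} (m : nat).
Implicit Types (A B psi : R).
Local Notation x := (m%:R : R).
Local Notation ric := (ricval m).

Lemma realizable_R : realizable m 1 (fun A B psi => 2 * ric A B psi true + x * ric A B psi false).
Proof.
apply: eq_realizable (realizable_word m (erefl _) (erefl _ : word 2 [:: [:: 0; 1; 0; 1]%N])) => A B psi.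
rewrite word_R; last exact: koff0.
by rewrite (eq_bigr _ (fun a _ => ric_koff A B psi a)) (sum_tr m (ricval m A B psi)).
Qed.

Lemma realizable_Ric2 :
  realizable m 2 (fun A B psi => 2 * ric A B psi true ^+ 2 + x * ric A B psi false ^+ 2).
Proof.
apply: eq_realizable (realizable_word m (erefl _)
  (erefl _ : word 4 [:: [:: 0; 2; 1; 2]; [:: 0; 3; 1; 3]]%N)) => A B psi.
rewrite word_Ric2; last exact: koff0.
rewrite (eq_bigr (fun a => ricval m A B psi (is_tr a) ^+ 2)) => [|a _]; last by rewrite ric_koff.
exact: (sum_tr m (fun t => ricval m A B psi t ^+ 2)).
Qed.

Lemma realizable_Riem2 : realizable m 2 (fun A B psi =>
  2 * (2 * A ^+ 2 + 4 * x * B ^+ 2 + x * (x - 1) * psi ^+ 2)).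
Proof.
apply: eq_realizable (realizable_word m (erefl _)
  (erefl _ : word 4 [:: [:: 0; 1; 2; 3]; [:: 0; 1; 2; 3]]%N)) => A B psi.
rewrite word_Riem2; last exact: koff0.
rewrite (sum2_koff m A B psi (F := fun y _ _ => 2 * y ^+ 2)) => [|_ _]; ring.
Qed.

Lemma realizable_Ric3 :
  realizable m 3 (fun A B psi => 2 * ric A B psi true ^+ 3 + x * ric A B psi false ^+ 3).
Proof.
apply: eq_realizable (realizable_word m (erefl _)
  (erefl _ : word 6 [:: [:: 0; 2; 1; 2]; [:: 1; 4; 3; 4]; [:: 0; 5; 3; 5]]%N)) => A B psi.
rewrite word_Ric3; last exact: koff0.
rewrite (eq_bigr (fun a => ricval m A B psi (is_tr a) ^+ 3)) => [|a _]; last by rewrite ric_koff.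
exact: (sum_tr m (fun t => ricval m A B psi t ^+ 3)).
Qed.

Lemma realizable_RicRicRiem : realizable m 3 (fun A B psi =>
  2 * ric A B psi true ^+ 2 * A + 4 * x * ric A B psi true * ric A B psi false * B
  + x * (x - 1) * ric A B psi false ^+ 2 * psi).
Proof.
apply: eq_realizable (realizable_word m (erefl _)
  (erefl _ : word 6 [:: [:: 0; 2; 1; 2]; [:: 3; 5; 4; 5]; [:: 0; 3; 1; 4]]%N)) => A B psi.
rewrite word_RicRicRiem; last exact: koff0.
under eq_bigr do under eq_bigr do rewrite !ric_koff.
rewrite (sum2_koff m A B psi (F := fun y s t => ric A B psi s * ric A B psi t * y)) => [|s t];
  [ring|exact: mulr0].
Qed.

Lemma realizable_RicRiem2 : realizable m 3 (fun A B psi =>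
  2 * (2 * ric A B psi true * A ^+ 2
       + 2 * x * (ric A B psi true + ric A B psi false) * B ^+ 2
       + x * (x - 1) * ric A B psi false * psi ^+ 2)).
Proof.
apply: eq_realizable (realizable_word m (erefl _)
  (erefl _ : word 6 [:: [:: 0; 2; 1; 2]; [:: 0; 3; 4; 5]; [:: 1; 3; 4; 5]]%N)) => A B psi.
rewrite word_RicRiem2; last exact: koff0.
under eq_bigr do under eq_bigr do rewrite ric_koff.
rewrite (sum2_koff m A B psi (F := fun y s t => 2 * ric A B psi s * y ^+ 2)) => [|s t]; ring.
Qed.

Lemma realizable_Riem3 : realizable m 3 (fun A B psi =>
  4 * (2 * A ^+ 3 + 4 * x * B ^+ 3 + x * (x - 1) * psi ^+ 3)).
Proof.
apply: eq_realizable (realizable_word m (erefl _)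
  (erefl _ : word 6 [:: [:: 0; 1; 2; 3]; [:: 2; 3; 4; 5]; [:: 4; 5; 0; 1]]%N)) => A B psi.
rewrite word_Riem3; [|exact: koff0|exact: koffC].
rewrite (sum2_koff m A B psi (F := fun y _ _ => 4 * y ^+ 3)) => [|_ _]; ring.
Qed.

Lemma realizable_Ric2RicRiem : realizable m 4 (fun A B psi =>
  2 * ric A B psi true ^+ 3 * A
  + 2 * x * ric A B psi true * ric A B psi false * (ric A B psi true + ric A B psi false) * B
  + x * (x - 1) * ric A B psi false ^+ 3 * psi).
Proof.
apply: eq_realizable (realizable_word m (erefl _) (erefl _ : word 8
  [:: [:: 0; 2; 1; 2]; [:: 1; 4; 3; 4]; [:: 5; 7; 6; 7]; [:: 0; 5; 3; 6]]%N)) => A B psi.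
rewrite word_Ric2RicRiem; last exact: koff0.
under eq_bigr do under eq_bigr do rewrite !ric_koff.
rewrite (sum2_koff m A B psi (F := fun y s t => ric A B psi s ^+ 2 * ric A B psi t * y)) => [|s t];
  [ring|exact: mulr0].
Qed.

Lemma realizable_RicRiem3 : realizable m 4 (fun A B psi =>
  4 * (2 * ric A B psi true * A ^+ 3
       + 2 * x * (ric A B psi true + ric A B psi false) * B ^+ 3
       + x * (x - 1) * ric A B psi false * psi ^+ 3)).
Proof.
apply: eq_realizable (realizable_word m (erefl _) (erefl _ : word 8
  [:: [:: 0; 2; 1; 2]; [:: 0; 3; 4; 5]; [:: 4; 5; 6; 7]; [:: 6; 7; 1; 3]]%N)) => A B psi.
rewrite word_RicRiem3; [|exact: koff0|exact: koffC].
under eq_bigr do under eq_bigr do rewrite ric_koff.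
rewrite (sum2_koff m A B psi (F := fun y s t => 4 * ric A B psi s * y ^+ 3)) => [|s t]; ring.
Qed.

(* The scalar curvature, and the amplitudes of the traceless Ricci tensor and
   of the Weyl tensor: these tensors have one independent component each. *)
Definition scal A B psi : R := 2 * A + 4 * x * B + x * (x - 1) * psi.
Definition tric A B psi : R := A + (x - 2) * B - (x - 1) * psi.
Definition weyl A B psi : R := A - 2 * B + psi.

Definition mono a b c A B psi : R :=
  scal A B psi ^+ a * tric A B psi ^+ b * weyl A B psi ^+ c.

Definition realizable_mono a b c := realizable m (a + b + c) (mono a b c).

Lemma realizable_monoM a b c a' b' c' : realizable_mono a b c -> realizable_mono a' b' c' ->
  realizable_mono (a + a') (b + b') (c + c').
Proof.
move=> h h'; rewrite /realizable_mono (_ : _ + _ = (a + b + c) + (a' + b' + c'))%N; last lia.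
apply: eq_realizable (realizableM h h') => A B psi.
by rewrite /mono !exprD; ring.
Qed.

Hypothesis m3 : (3 <= m)%N.

Lemma mono100 : realizable_mono 1 0 0.
Proof.
by apply: eq_realizable realizable_R => A B psi; rewrite /mono /scal /ricval !expr0 !mulr1 expr1; ring.
Qed.

Let x3 : 3 <= x. Proof. by rewrite ler_nat. Qed.

Ltac expand := move=> A B psi; rewrite /mono /scal /tric /weyl /ricval !expr0 ?expr1;
  move: x x3 => y y3.

Ltac nonzero := repeat (apply/andP; split); apply: lt0r_neq0; nra.

(** The square of the Ricci tensor is scal^2 / (m + 2) + 2 m tric^2 / (m + 2). All later
    coefficients arise likewise: expand an invariant in monomials, subtract those already realized,
    divide by the coefficient of the new one. *)
Lemma mono020 : realizable_mono 0 2 0.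
Proof.
apply: eq_realizable (realizableZ ((x + 2) / (2 * x)) (realizableD realizable_Ric2
  (realizableZ (- (1 / (x + 2))) (realizable_monoM mono100 mono100)))).
expand; field; nonzero.
Qed.

Lemma mono002 : realizable_mono 0 0 2.
Proof.
apply: eq_realizable (realizableZ ((x + 1) / (2 * (x - 1))) (realizableD
  (realizableZ 2^-1 realizable_Riem2) (realizableD
  (realizableZ (- (1 / ((x + 1) * (x + 2)))) (realizable_monoM mono100 mono100))
  (realizableZ (- (4 / (x + 2))) mono020)))).
expand; field; nonzero.
Qed.

(** The coefficient 2 m (m - 2) / (m + 2)^2 of tric^3 is nonzero for D >= 5. At m = 2 both Ricci
    eigenvalues have multiplicity two, and odd traces of the traceless part cancel. *)
Lemma mono030 : realizable_mono 0 3 0.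
Proof.
apply: eq_realizable (realizableZ ((x + 2) ^+ 2 / (2 * x * (x - 2))) (realizableD
  realizable_Ric3 (realizableD
  (realizableZ (- (1 / (x + 2) ^+ 2)) (realizable_monoM mono100 (realizable_monoM mono100 mono100)))
  (realizableZ (- (6 * x / (x + 2) ^+ 2)) (realizable_monoM mono100 mono020))))).
expand; field; nonzero.
Qed.

Lemma mono021 : realizable_mono 0 2 1.
Proof.
apply: eq_realizable (realizableZ ((x + 1) / (2 * (x - 1))) (realizableD
  realizable_RicRicRiem (realizableD (realizableD
  (realizableZ (- (1 / (x + 2) ^+ 2)) (realizable_monoM mono100 (realizable_monoM mono100 mono100)))
  (realizableZ (- ((4 * x + 2) * x / ((x + 1) * (x + 2) ^+ 2))) (realizable_monoM mono100 mono020)))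
  (realizableZ (4 * (x - 2) / (x + 2) ^+ 2) mono030)))).
expand; field; nonzero.
Qed.

Lemma mono012 : realizable_mono 0 1 2.
Proof.
apply: eq_realizable (realizableZ (x * (x + 2) / (2 * (x - 1) * (x - 2))) (realizableD
  (realizableZ 2^-1 realizable_RicRiem2) (realizableD (realizableD (realizableD (realizableD
  (realizableZ (- (1 / ((x + 1) * (x + 2) ^+ 2)))
    (realizable_monoM mono100 (realizable_monoM mono100 mono100)))
  (realizableZ (- ((8 * x + 4) / ((x + 1) * (x + 2) ^+ 2))) (realizable_monoM mono100 mono020)))
  (realizableZ (- (2 * (x - 1) / ((x + 1) * (x + 2)))) (realizable_monoM mono100 mono002)))
  (realizableZ (- (2 * (x - 2) ^+ 2 / (x * (x + 2) ^+ 2))) mono030))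
  (realizableZ (- (4 * (x - 1) / (x * (x + 1)))) mono021)))).
expand; field; nonzero.
Qed.

Lemma mono003 : realizable_mono 0 0 3.
Proof.
apply: eq_realizable (realizableZ (x ^+ 2 * (x + 1) ^+ 2 /
    (2 * (x * (x - 1) * (x - 2) + 2) * (x - 1)))
  (realizableD (realizableZ 4^-1 realizable_Riem3)
  (realizableD (realizableD (realizableD (realizableD (realizableD
  (realizableZ (- (1 / ((x + 1) ^+ 2 * (x + 2) ^+ 2)))
    (realizable_monoM mono100 (realizable_monoM mono100 mono100)))
  (realizableZ (- (12 / ((x + 1) * (x + 2) ^+ 2))) (realizable_monoM mono100 mono020)))
  (realizableZ (- (6 * (x - 1) / ((x + 1) ^+ 2 * (x + 2)))) (realizable_monoM mono100 mono002)))
  (realizableZ (- (4 * (x - 2) ^+ 2 / (x ^+ 2 * (x + 2) ^+ 2))) mono030))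
  (realizableZ (- (12 * (x - 1) / (x ^+ 2 * (x + 1)))) mono021))
  (realizableZ (- (12 * (x - 1) * (x - 2) / (x ^+ 2 * (x + 2)))) mono012)))).
expand; field; nonzero.
Qed.

(** Products of squares give only even exponents in degree 4, so tric^3 weyl needs a contraction of
    its own; likewise [mono013]. *)
Lemma mono031 : realizable_mono 0 3 1.
Proof.
apply: eq_realizable (realizableZ ((x + 1) * (x + 2) / (2 * (x - 1) * (x - 2)))
  (realizableD realizable_Ric2RicRiem
  (realizableD (realizableD (realizableD (realizableD
  (realizableZ (- (1 / (x + 2) ^+ 3)) (realizable_monoM (realizable_monoM mono100 mono100)
    (realizable_monoM mono100 mono100)))
  (realizableZ (- ((8 * x + 4) * x / ((x + 1) * (x + 2) ^+ 3)))
    (realizable_monoM (realizable_monoM mono100 mono100) mono020)))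
  (realizableZ (- ((2 * x ^+ 2 - 8 * x - 8) * (x - 2) / ((x + 1) * (x + 2) ^+ 3)))
    (realizable_monoM mono100 mono030)))
  (realizableZ (- (4 * (x - 1) / ((x + 1) * (x + 2)))) (realizable_monoM mono100 mono021)))
  (realizableZ (- (16 * (x - 1) / (x + 2) ^+ 3)) (realizable_monoM mono020 mono020))))).
expand; field; nonzero.
Qed.

Lemma mono013 : realizable_mono 0 1 3.
Proof.
apply: eq_realizable (realizableZ (x ^+ 2 * (x + 1) * (x + 2) /
    (2 * ((x - 1) ^+ 2 + 2) * (x - 1) * (x - 2)))
  (realizableD (realizableZ 4^-1 realizable_RicRiem3)
  (realizableD (realizableD (realizableD (realizableD (realizableD (realizableD (realizableD
  (realizableD (realizableD
  (realizableZ (- (1 / ((x + 1) ^+ 2 * (x + 2) ^+ 3)))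
    (realizable_monoM (realizable_monoM mono100 mono100) (realizable_monoM mono100 mono100)))
  (realizableZ (- ((18 * x + 12) / ((x + 1) ^+ 2 * (x + 2) ^+ 3)))
    (realizable_monoM (realizable_monoM mono100 mono100) mono020)))
  (realizableZ (- (6 * (x - 1) / ((x + 1) ^+ 2 * (x + 2) ^+ 2)))
    (realizable_monoM (realizable_monoM mono100 mono100) mono002)))
  (realizableZ (- ((10 * x + 4) * (x - 2) ^+ 2 / (x ^+ 2 * (x + 1) * (x + 2) ^+ 3)))
    (realizable_monoM mono100 mono030)))
  (realizableZ (- ((24 * x + 12) * (x - 1) / (x ^+ 2 * (x + 1) ^+ 2 * (x + 2))))
    (realizable_monoM mono100 mono021)))
  (realizableZ (- ((18 * x + 12) * (x - 1) * (x - 2) / (x ^+ 2 * (x + 1) * (x + 2) ^+ 2)))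
    (realizable_monoM mono100 mono012)))
  (realizableZ (- ((2 * x ^+ 3 - 6 * x ^+ 2 + 4 * x + 4) * (x - 1) /
      (x ^+ 2 * (x + 1) ^+ 2 * (x + 2)))) (realizable_monoM mono100 mono003)))
  (realizableZ (- ((2 * x ^+ 3 - 4 * x ^+ 2 + 56 * x - 48) / (x ^+ 2 * (x + 2) ^+ 3)))
    (realizable_monoM mono020 mono020)))
  (realizableZ (- (18 * (x - 1) * (x - 2) / (x ^+ 2 * (x + 1) * (x + 2)))) mono031))
  (realizableZ (- ((12 * x ^+ 4 - 6 * x ^+ 3 - 30 * x ^+ 2 + 48 * x + 72) * (x - 1) /
      (x ^+ 2 * (x + 1) ^+ 2 * (x + 2) ^+ 2))) (realizable_monoM mono020 mono002))))).
expand; field; nonzero.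
Qed.

End Monomials.

(** * Filtration by order of vanishing at constant curvature *)

Section OrderedSpan.
Context {R : realType} (m : nat).
Implicit Types (A B psi : R) (P Q : R -> R -> R -> R).
Local Notation x := (m%:R : R).

(* Forms of degree n in curvature that vanish to order j at constant curvature. *)
Inductive ordspan j n : (R -> R -> R -> R) -> Prop :=
| ordspan_mono a b c : (a + b + c)%N = n -> (j <= b + c)%N -> ordspan j n (mono m a b c)
| ordspan0 : ordspan j n (fun _ _ _ => 0)
| ordspanZD y z P Q : ordspan j n P -> ordspan j n Q ->
    ordspan j n (fun A B psi => y * P A B psi + z * Q A B psi)
| eq_ordspan P Q : ordspan j n P -> (forall A B psi, P A B psi = Q A B psi) -> ordspan j n Q.

Lemma ordspanW j j' n P : (j' <= j)%N -> ordspan j n P -> ordspan j' n P.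
Proof.
move=> jj; elim=> [a b c abc bc||y z {}P Q _ hP _ hQ|{}P Q _ hP PQ].
- by apply: ordspan_mono => //; lia.
- exact: ordspan0.
- exact: ordspanZD.
- exact: eq_ordspan PQ.
Qed.

Lemma ordspanM j j' n n' P Q : ordspan j n P -> ordspan j' n' Q ->
  ordspan (j + j') (n + n') (fun A B psi => P A B psi * Q A B psi).
Proof.
move=> hP hQ; elim: hP => [a b c abc bc||y z {}P P' _ hP _ hP'|{}P P' _ hP PP'].
- elim: hQ => [a' b' c' abc' bc'||y z {}Q Q' _ hQ _ hQ'|{}Q Q' _ hQ QQ'].
  + apply: (@eq_ordspan _ _ (mono m (a + a') (b + b') (c + c'))).
      by apply: ordspan_mono; lia.
    by move=> A B psi; rewrite /mono !exprD; ring.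
  + by apply: eq_ordspan (ordspan0 _ _) _ => A B psi; rewrite mulr0.
  + by apply: eq_ordspan (ordspanZD y z hQ hQ') _ => A B psi; ring.
  + by apply: eq_ordspan hQ _ => A B psi; rewrite QQ'.
- by apply: eq_ordspan (ordspan0 _ _) _ => A B psi; rewrite mul0r.
- by apply: eq_ordspan (ordspanZD y z hP hP') _ => A B psi; ring.
- by apply: eq_ordspan hP _ => A B psi; rewrite PP'.
Qed.

Lemma ordspanX j P k : ordspan j 1 P -> ordspan (k * j) k (fun A B psi => P A B psi ^+ k).
Proof.
move=> hP; elim: k => [|k IH].
  by apply: eq_ordspan (@ordspan_mono 0 0 0 0 0 _ _) _ => // A B psi; rewrite /mono !expr0 !mulr1.
by apply: eq_ordspan (ordspanM hP IH) _ => A B psi; rewrite exprS.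
Qed.

Lemma ordspanD j n P Q : ordspan j n P -> ordspan j n Q ->
  ordspan j n (fun A B psi => P A B psi + Q A B psi).
Proof. by move=> hP hQ; apply: eq_ordspan (ordspanZD 1 1 hP hQ) _ => A B psi; rewrite !mul1r. Qed.

Lemma ordspanZ j n y P : ordspan j n P -> ordspan j n (fun A B psi => y * P A B psi).
Proof.
by move=> hP; apply: eq_ordspan (ordspanZD y 0 hP hP) _ => A B psi; rewrite mul0r addr0.
Qed.

Lemma realizable_mono_a00 a : realizable_mono (R := R) m a 0 0.
Proof.
elim: a => [|a IH].
  by apply: eq_realizable (realizable_one m) => A B psi; rewrite /mono !expr0 !mulr1.
exact: (realizable_monoM (mono100 m) IH).
Qed.

Hypothesis m3 : (3 <= m)%N.

(** Beyond degree 4 some square splits off, and the remaining degree is at least 3, so the exponents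
    (1, 1) are never met. *)
Lemma realizable_mono_0bc b c : (2 <= b + c)%N -> (b, c) != (1, 1)%N ->
  realizable_mono (R := R) m 0 b c.
Proof.
have [N] := ubnP (b + c)%N; elim: N b c => // N IH b c bcN bc2 bc.
have [bc4|bc4] := leqP (b + c) 4.
  have h := realizable_monoM.
  case: b c bc4 bc2 bc {bcN} => [|[|[|[|[|b]]]]] [|[|[|[|[|c]]]]] //= _ _ _.
  - exact: mono002.
  - exact: mono003.
  - exact: (h _ _ _ _ _ _ _ _ (mono002 m3) (mono002 m3)).
  - exact: mono012.
  - exact: mono013.
  - exact: mono020.
  - exact: mono021.
  - exact: (h _ _ _ _ _ _ _ _ (mono020 m3) (mono002 m3)).
  - exact: mono030.
  - exact: mono031.
  - exact: (h _ _ _ _ _ _ _ _ (mono020 m3) (mono020 m3)).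
have [b2|b2] := leqP 2 b.
  rewrite -(subnKC b2) -[c]add0n; apply: (realizable_monoM (mono020 m3)).
  by apply: IH; [lia|lia|apply/eqP => -[]; lia].
have c2 : (2 <= c)%N by lia.
rewrite -(subnKC c2) -[b]add0n; apply: (realizable_monoM (mono002 m3)).
by apply: IH; [lia|lia|apply/eqP => -[]; lia].
Qed.

Lemma realizable_mono_abc a b c : (2 <= b + c)%N -> (b, c) != (1, 1)%N ->
  realizable_mono (R := R) m a b c.
Proof.
move=> bc2 bc; rewrite -[a]addn0 -[b]add0n -[c]add0n.
exact: (realizable_monoM (realizable_mono_a00 a) (realizable_mono_0bc bc2 bc)).
Qed.

Lemma ordspan_realizable n P : ordspan 3 n P -> realizable m n P.
Proof.
elim=> [a b c <- bc||y z {}P Q _ hP _ hQ|{}P Q _ hP PQ].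
- by apply: realizable_mono_abc; [lia|apply/eqP => -[]; lia].
- exact: realizable0.
- exact: realizableZD.
- exact: eq_realizable hP.
Qed.

Let x3 : 3 <= x. Proof. by rewrite ler_nat. Qed.

(** The sectional curvature of the constant curvature space with the same scalar curvature; [sigma]
    is the deviation of psi from it. *)
Definition kappa A B psi : R := scal m A B psi / ((x + 2) * (x + 1)).
Definition sigma A B psi : R := psi - kappa A B psi.

Lemma ordspan_curv : ordspan 0 1 (scal m).
Proof. by apply: eq_ordspan (@ordspan_mono 0 1 1 0 0 _ _) _ => // A B psi; rewrite /mono expr1 !mulr1. Qed.

Lemma ordspan_tric : ordspan 1 1 (tric m).
Proof. by apply: eq_ordspan (@ordspan_mono 1 1 0 1 0 _ _) _ => // A B psi; rewrite /mono expr1 mul1r mulr1. Qed.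

Lemma ordspan_weyl : ordspan 1 1 (@weyl R).
Proof. by apply: eq_ordspan (@ordspan_mono 1 1 0 0 1 _ _) _ => // A B psi; rewrite /mono expr1 !mul1r. Qed.

Ltac nonzero := move: x x3 => y y3; field;
  repeat (apply/andP; split); apply: lt0r_neq0; nra.

Lemma ordspan_kappa : ordspan 0 1 kappa.
Proof.
by apply: eq_ordspan (ordspanZ ((x + 2) * (x + 1))^-1 ordspan_curv) _ => A B psi; rewrite mulrC.
Qed.

Lemma sigmaE A B psi : sigma A B psi =
  - (4 / (x * (x + 2))) * tric m A B psi + 2 / (x * (x + 1)) * weyl A B psi.
Proof. rewrite /sigma /kappa /scal /tric /weyl; nonzero. Qed.

Lemma ordspan_sigma : ordspan 1 1 sigma.
Proof.
by apply: eq_ordspan (ordspanZD _ _ ordspan_tric ordspan_weyl) _ => A B psi; rewrite sigmaE.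
Qed.

Lemma ordspan_psi : ordspan 0 1 (fun _ _ psi => psi).
Proof.
apply: eq_ordspan (ordspanD ordspan_kappa (ordspanW _ ordspan_sigma)) _ => // A B psi.
by rewrite /sigma addrC subrK.
Qed.

Lemma BpsiE A B psi : B - psi = x^-1 * tric m A B psi + - x^-1 * weyl A B psi.
Proof. rewrite /tric /weyl; nonzero. Qed.

Lemma ordspan_Bpsi : ordspan 1 1 (fun _ B psi => B - psi).
Proof. by apply: eq_ordspan (ordspanZD _ _ ordspan_tric ordspan_weyl) _ => A B psi; rewrite (BpsiE A). Qed.

Lemma ordspan_AB : ordspan 1 1 (fun A B _ => A - B).
Proof.
apply: eq_ordspan (ordspanZD x^-1 ((x - 1) / x) ordspan_tric ordspan_weyl) _ => A B psi.
rewrite /tric /weyl; nonzero.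
Qed.

End OrderedSpan.

(** * Realization of the reduced densities *)

Section RealizableTotals.
Context {R : realType} (m : nat).
Hypothesis m3 : (3 <= m)%N.
Implicit Types (A B psi : R) (P Q : R -> R -> R -> R).
Local Notation x := (m%:R : R).
Local Notation span := (ordspan (R := R) m).

Let x3 : 3 <= x. Proof. by rewrite ler_nat. Qed.

Lemma homC n (y : R) (a b : R) : hom n y%:P a b = y * b ^+ n.
Proof.
rewrite /hom big_ord_recl /= coefC /= expr0 mulr1 subn0 big1 ?addr0 // => j _.
by rewrite coefC /= !mul0r.
Qed.

Lemma hom_XsubX j k (a b : R) : hom (j + k) (('X - 1) ^+ j) a b = (a - b) ^+ j * b ^+ k.
Proof.
elim: j => [|j IH]; first by rewrite !expr0 homC.
have c0 : ((('X - 1) ^+ j : {poly R})`_(j + k).+1 = 0).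
  by apply: nth_default; rewrite size_exp_XsubC; lia.
by rewrite exprS mulrBl mul1r homB addSn -homMx -homMy // IH exprS; ring.
Qed.

Lemma ordspanX0 P k : span 0 1 P -> span 0 k (fun A B psi => P A B psi ^+ k).
Proof. by move/(ordspanX k); rewrite muln0. Qed.

Lemma ordspan_vpsi j k : span j (j + k) (fun A B psi => (B - psi) ^+ j * psi ^+ k).
Proof.
have := ordspanX j (ordspan_Bpsi (R := R) m3); rewrite muln1 => h.
by have := ordspanM h (ordspanX0 k (ordspan_psi (R := R) m3)); rewrite addn0.
Qed.

(** Differentiating (X - 1)^j costs a factor B - psi, but in [total] each derivative comes with A -
    B or B - psi, both of first order, so every term keeps order j. *)
Lemma realizable_total_XsubX n j : (3 <= j <= n.+1)%N ->
  realizable m n.+1 (total m n (('X - 1) ^+ j : {poly R})).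
Proof.
case: j => // j /andP[j3 jn]; have [k nE] : exists k, n = (j + k)%N by exists (n - j)%N; lia.
apply: (ordspan_realizable m3); rewrite nE {n nE jn}.
have dE : (('X - 1) ^+ j.+1 : {poly R})^`() = j.+1%:R *: ('X - 1) ^+ j.
  by rewrite deriv_exp derivB derivX derivC subr0 mul1r scaler_nat.
have dhE : dhom (j + k).+1 (('X - 1) ^+ j.+1 : {poly R}) =
    k%:R *: ('X - 1) ^+ j.+1 - j.+1%:R *: ('X - 1) ^+ j.
  rewrite /dhom dE -addSn natrD scalerDl exprS -!mul_polyC; ring.
have h1 := ordspanZ (x + 1) (ordspan_vpsi j.+1 k).
have h2 := ordspanZ j.+1%:R (ordspanM (ordspan_AB (R := R) m3) (ordspan_vpsi j k)).
have h3 := ordspanZ (- (2 * j.+1%:R)) (ordspanM (ordspan_Bpsi (R := R) m3) (ordspan_vpsi j k)).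
have h4 : span j.+1 (j.+1 + k) (fun A B psi => 2 * (B - psi) * (k%:R * hom (j + k) (('X - 1) ^+ j.+1) B psi)).
  case: k {dhE h1 h2 h3} => [|k].
    by apply: eq_ordspan (ordspan0 _ _ _) _ => A B psi; rewrite !mul0r mulr0.
  have := ordspanZ (2 * k.+1%:R) (ordspanM (ordspan_Bpsi (R := R) m3) (ordspan_vpsi j.+1 k)).
  rewrite (_ : j.+1 + k.+1 = 1 + (j.+1 + k))%N; last lia.
  move/(ordspanW (leqnSn j.+1)) => h; apply: eq_ordspan h _ => A B psi.
  by rewrite -addSnnS hom_XsubX; ring.
apply: eq_ordspan (ordspanW j3 (ordspanD (ordspanD h1 h2) (ordspanD h3 h4))) _ => A B psi.
rewrite /total dE dhE homB !homZ -addSn !hom_XsubX mulrSr.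
by move: (hom _ _ _ _) => h; ring.
Qed.

(** Here and in the next two lemmas: Taylor expansion of powers of psi about [kappa], with
    remainders of order 1, 2 and 3. *)
Lemma ordspan_expansion0 n : span 1 n (fun A B psi => psi ^+ n - kappa m A B psi ^+ n).
Proof.
elim: n => [|n IH]; first by apply: eq_ordspan (ordspan0 _ _ _) _ => A B psi; rewrite subrr.
have h := ordspanM (ordspan_sigma (R := R) m3) (ordspanX0 n (ordspan_kappa (R := R) m)).
apply: eq_ordspan (ordspanD (ordspanM (ordspan_psi (R := R) m3) IH) h) _ => A B psi.
by rewrite /sigma !exprS; ring.
Qed.

Lemma ordspan_expansion1 n : span 2 n.+1 (fun A B psi => psi ^+ n.+1 -
  kappa m A B psi ^+ n.+1 - n.+1%:R * (sigma m A B psi * kappa m A B psi ^+ n)).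
Proof.
elim: n => [|n IH].
  apply: eq_ordspan (ordspan0 _ _ _) _ => A B psi; rewrite /sigma; ring.
have s2 := ordspanM (ordspan_sigma (R := R) m3) (ordspan_sigma (R := R) m3).
have h := ordspanZ n.+1%:R (ordspanM s2 (ordspanX0 n (ordspan_kappa (R := R) m))).
apply: eq_ordspan (ordspanD (ordspanM (ordspan_psi (R := R) m3) IH) h) _ => A B psi.
by rewrite /sigma [n.+2%:R]mulrSr !exprS; ring.
Qed.

Lemma ordspan_expansion2 n : span 3 n.+2 (fun A B psi => psi ^+ n.+2 -
  kappa m A B psi ^+ n.+2 - n.+2%:R * (sigma m A B psi * kappa m A B psi ^+ n.+1)
  - n.+2%:R * n.+1%:R / 2 * (sigma m A B psi ^+ 2 * kappa m A B psi ^+ n)).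
Proof.
elim: n => [|n IH].
  by apply: eq_ordspan (ordspan0 _ _ _) _ => A B psi; rewrite /sigma; field.
have s3 := ordspanM (ordspan_sigma (R := R) m3) (ordspanM (ordspan_sigma (R := R) m3) (ordspan_sigma (R := R) m3)).
have h := ordspanZ (n.+2%:R * n.+1%:R / 2) (ordspanM s3 (ordspanX0 n (ordspan_kappa (R := R) m))).
apply: eq_ordspan (ordspanD (ordspanM (ordspan_psi (R := R) m3) IH) h) _ => A B psi.
by rewrite /sigma [n.+3%:R]mulrSr [n.+2%:R]mulrSr !exprS; field.
Qed.

(* The solution of degree at most 1 of the constraint D g'(1) = 2 N g(1) at
   order N = n.+2. *)
Definition qt_poly n : {poly R} := m.+2%:R%:P + (2 * n.+2%:R) *: ('X - 1).

Lemma total_qt_poly n A B psi : total m n.+1 (qt_poly n) A B psi =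
  (x + 2) * (x + 1) * (psi ^+ n.+2 - n.+2%:R * (sigma m A B psi * psi ^+ n.+1))
  + 4 * n.+2%:R * n.+1%:R * (B - psi) ^+ 2 * psi ^+ n.
Proof.
have dE : (qt_poly n)^`() = (2 * n.+2%:R)%:P.
  by rewrite derivD derivC add0r derivZ derivB derivX derivC subr0 alg_polyC.
have dhE : dhom n.+2 (qt_poly n) =
    (n.+2%:R * x)%:P + (2 * n.+2%:R * n.+1%:R) *: ('X - 1).
  rewrite /dhom dE /qt_poly [m.+2%:R]mulrSr [m.+1%:R]mulrSr [n.+2%:R]mulrSr -!mul_polyC.
  by move: (n.+1%:R : R) x => u y; rewrite !(polyCD, polyCM) polyC1; ring.
have h1 k (a b : R) : hom k.+1 ('X - 1) a b = (a - b) * b ^+ k.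
  by have := hom_XsubX 1 k a b; rewrite !expr1.
rewrite /total dhE dE /qt_poly !homD !homZ !homC !h1 [m.+2%:R]mulrSr [m.+1%:R]mulrSr.
rewrite sigmaE // /tric /weyl [n.+2%:R]mulrSr !exprS.
move: x x3 (n.+1%:R : R) (psi ^+ n) => y y3 u p; field.
by repeat (apply/andP; split); apply: lt0r_neq0; nra.
Qed.

(** With N = n.+2, the first order terms of psi^N and N sigma psi^(N - 1) cancel. Modulo order three
    there remain a multiple of kappa^N and N (N - 1) kappa^(N - 2) times 4 (B - psi)^2 - E sigma^2 /
    2, which contains only squares of the amplitudes. *)
Lemma realizable_total_qt n : realizable m n.+2 (total m n.+1 (qt_poly n)).
Proof.
have E0 : (x + 2) * (x + 1) != 0 by apply: lt0r_neq0; apply: mulr_gt0; move: x x3 => y y3; lra.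
pose E := (x + 2) * (x + 1); rewrite -/E in E0.
have k0 := ordspanX0 n (ordspan_kappa (R := R) m).
(* [h2], [h1], [h0] are the third order remainders of the three terms in [total_qt_poly]. *)
have h2 := ordspanZ E (ordspan_expansion2 n).
have h1 := ordspanZ (- E * n.+2%:R) (ordspanM (ordspan_sigma (R := R) m3) (ordspan_expansion1 n)).
have v2 := ordspanM (ordspan_Bpsi (R := R) m3) (ordspan_Bpsi (R := R) m3).
have h0 := ordspanZ (4 * n.+2%:R * n.+1%:R) (ordspanM v2 (ordspan_expansion0 n)).
have hO := ordspan_realizable m3 (ordspanD h2 (ordspanD h1 h0)).
have z2 := realizable_mono_abc (R := R) m3 n (erefl : (2 <= 2 + 0)%N) (erefl : (2, 0)%N != (1, 1)%N).
have w2 := realizable_mono_abc (R := R) m3 n (erefl : (2 <= 0 + 2)%N) (erefl : (0, 2)%N != (1, 1)%N).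
have := realizable_mono_a00 (R := R) m n.+2.
rewrite /realizable_mono !addn0 addn2 in z2 w2 *.
move=> k2.
have hc := realizableD (realizableZ (E / E ^+ n.+2) k2)
  (realizableD (realizableZ (n.+2%:R * n.+1%:R / E ^+ n * (4 / x ^+ 2 - 8 * (x + 1) / (x ^+ 2 * (x + 2)))) z2)
               (realizableZ (n.+2%:R * n.+1%:R / E ^+ n * (4 / x ^+ 2 - 2 * (x + 2) / (x ^+ 2 * (x + 1)))) w2)).
apply: eq_realizable (realizableD hO hc) => A B psi.
rewrite total_qt_poly -/E.
(* The product tric weyl is absent: the two squares contribute - 8 / x^2 and 8 / x^2. *)
have key : (4 / x ^+ 2 - 8 * (x + 1) / (x ^+ 2 * (x + 2))) * tric m A B psi ^+ 2
    + (4 / x ^+ 2 - 2 * (x + 2) / (x ^+ 2 * (x + 1))) * weyl A B psi ^+ 2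
    = 4 * (B - psi) ^+ 2 - E / 2 * sigma m A B psi ^+ 2.
  rewrite (BpsiE m3 A) sigmaE // /E.
  move: x x3 (tric _ _ _ _) (weyl _ _ _) => y y3 z w; field.
  by repeat (apply/andP; split); apply: lt0r_neq0; nra.
have ck : scal m A B psi = E * kappa m A B psi by rewrite /kappa -/E mulrC divfK.
have mE a b c : mono m a b c A B psi =
    E ^+ a * kappa m A B psi ^+ a * (tric m A B psi ^+ b * weyl A B psi ^+ c).
  by rewrite /mono ck exprMn mulrA.
rewrite !mE !expr0 !mulr1 mul1r {mE ck}.
transitivity (E * (psi ^+ n.+2 - n.+2%:R * (sigma m A B psi * psi ^+ n.+1))
  + n.+2%:R * n.+1%:R * kappa m A B psi ^+ n * (E / 2 * sigma m A B psi ^+ 2 - 4 * (B - psi) ^+ 2)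
  + 4 * n.+2%:R * n.+1%:R * (B - psi) ^+ 2 * psi ^+ n
  + n.+2%:R * n.+1%:R * kappa m A B psi ^+ n *
    ((4 / x ^+ 2 - 8 * (x + 1) / (x ^+ 2 * (x + 2))) * tric m A B psi ^+ 2
    + (4 / x ^+ 2 - 2 * (x + 2) / (x ^+ 2 * (x + 1))) * weyl A B psi ^+ 2)); last first.
  rewrite key; ring.
move: (4 / _ - _) (4 / _ - _) => c1 c2.
have En : E ^+ n != 0 by rewrite expf_neq0.
rewrite !exprS; move: E0 En; clearbody E; move: (E ^+ n) => en.
move: (kappa _ _ _ _) (sigma _ _ _ _) => k s E0 en0; move: (k ^+ n) (psi ^+ n) => kn pn; field.
by rewrite E0 en0.
Qed.

End RealizableTotals.

(** * Classification *)

Section Classification.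
Context {R : realType} (m n : nat) (k : R).
Hypothesis hk : - 4 < k.
Local Notation D := m.+2.
Implicit Types (c : density R n.+2) (g h : {poly R}) (a b y : R).

Definition represents c g := forall A B psi, reduced m c A B psi = total m n.+1 g A B psi.

Lemma represents0 : represents 0 0.
Proof.
move=> A B psi; rewrite /reduced phi_ctr big1 => [|s _]; last by rewrite ffunE mul0r.
by rewrite /total /dhom !deriv0 scaler0 mulr0 subr0 !hom0 !mulr0 !addr0.
Qed.

Lemma representsZD y z c c' g h : represents c g -> represents c' h ->
  represents (y *: c + z *: c') (y *: g + z *: h).
Proof.
move=> cg ch A B psi; have := cg A B psi; have := ch A B psi.
rewrite /reduced phiZD => -> ->.
rewrite /total derivD !derivZ dhomD !dhomZ; move: (dhom _ g) (dhom _ h) => u v.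
by rewrite !homD !homZ; ring.
Qed.

Lemma representsD c c' g h : represents c g -> represents c' h -> represents (c + c') (g + h).
Proof. by move=> cg ch; rewrite -[c]scale1r -[c']scale1r -[g]scale1r -[h]scale1r; apply: representsZD. Qed.

Lemma representsZ y c g : represents c g -> represents (y *: c) (y *: g).
Proof.
by move=> cg; have := representsZD y 0 cg represents0; rewrite !scaler0 !addr0.
Qed.

Lemma represents_combination p b (a : 'I_p -> R) c (d : 'I_p -> density R n.+2) g (h : 'I_p -> {poly R}) :
  represents c g -> (forall i, represents (d i) (h i)) ->
  represents (b *: c + \sum_i a i *: d i) (b *: g + \sum_i a i *: h i).
Proof.
move=> cg dh; apply: representsD; first exact: representsZ.
apply: (big_ind2 represents) => [|c1 g1 c2 g2|i _].
- exact: represents0.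
- exact: representsD.
- exact: representsZ.
Qed.

Lemma represents_constraint c g : (size g <= n.+3)%N -> represents c g ->
  g^`()^`().[1] = 0 /\ m.+2%:R * g^`().[1] = 2 * n.+2%:R * g.[1].
Proof. by move=> sg cg; apply: (reduced_total_constraints sg cg). Qed.

Lemma eq_integrated c (F F' : jetfun R) :
  (forall r y0 y1 y2, 0 < r -> F r y0 y1 y2 = F' r y0 y1 y2) ->
  integrated D k c F -> integrated D k c F'.
Proof.
move=> FF [T0 [T1 [T2 [E [h1 h2 h3]]]]]; exists T0, T1, T2, E; split=> // f r hf r0.
by rewrite -h3 // /along FF.
Qed.

Lemma QT_size c g : (size g <= n.+3)%N -> represents c g -> QT D k c -> (size g <= 2)%N.
Proof.
move=> sg cg [_ [F [iF [u hu]]]].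
have [C hC] := integrated_unique iF (integrated_total k cg).
apply: (jetF_no_second_derivative hk sg) => r y0 y1 y2 z2 r0 y00.
apply: (@addIr _ C); apply: etrans (esym (hC r y0 y1 y2 r0 y00)) _.
exact: etrans (hu r y0 y1 y2 r0 y00) (etrans (esym (hu r y0 y1 z2 r0 y00)) (hC r y0 y1 z2 r0 y00)).
Qed.

Lemma size_QT c g : represents c g -> (size g <= 2)%N -> QT D k c.
Proof.
move=> cg sg; split; first exact: total_GQT cg.
exists (jetF m n k g); split; first exact: integrated_total.
exists (fun r y0 => g`_0 * (r ^+ m * r * ((k - y0) / r ^+ 2) ^+ n.+2)) => r y0 y1 y2 r0 _.
apply: jetF_linear => //.
by have [] := represents_constraint (leq_trans sg (_ : 2 <= n.+3)%N) cg.
Qed.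

Lemma trivial_size c g : (size g <= n.+3)%N -> represents c g -> trivial_equation D k c ->
  (size g <= 2)%N /\ g`_0 = 0.
Proof.
move=> sg cg tc; have [C hC] := integrated_unique (integrated_total k cg) tc.
have [_ e] := represents_constraint sg cg.
apply: (@jetF_constant _ m n k hk g C sg e) => r y0 y1 y2 r0 y00.
by rewrite (hC r y0 y1 y2 r0 y00) add0r.
Qed.

(** By linearity and uniqueness up to constants, [jetF] of g - y h is constant. *)
Lemma equivalent_size c c' g h : (size g <= n.+3)%N -> (size h <= n.+3)%N ->
  represents c g -> represents c' h -> equivalent D k c c' ->
  exists2 y : R, y != 0 & (size (g - y *: h)%R <= 2)%N.
Proof.
move=> sg sh cg ch [F1 [F2 [y [i1 i2 y0 hF]]]]; exists y => //.
have [C1 hC1] := integrated_unique (integrated_total k cg) i1.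
have [C2 hC2] := integrated_unique (integrated_total k ch) i2.
have [_ e1] := represents_constraint sg cg; have [_ e2] := represents_constraint sh ch.
have [] := @jetF_constant _ m n k hk (g - y *: h) (C1 - y * C2); last by [].
- rewrite -[- (y *: h)]scaleNr; apply: (leq_trans (size_polyD _ _)); rewrite geq_max sg.
  exact: leq_trans (size_scale_leq _ _) sh.
- rewrite derivB derivZ !hornerE mulrBr e1 mulrCA e2; ring.
- move=> r z0 z1 z2 r0 z00; rewrite -scaleNr jetFD jetFZ.
  by rewrite (hC1 r z0 z1 z2 r0 z00) (hC2 r z0 z1 z2 r0 z00) (hF r z0 z1 z2 r0 z00); ring.
Qed.

Definition gen_poly i : {poly R} := ('X - 1) ^+ (i + 3).

Definition combination p b (a : 'I_p -> R) : {poly R} :=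
  b *: qt_poly m n + \sum_i a i *: gen_poly i.

Lemma size_gen_poly i : size (gen_poly i) = i.+4.
Proof. by rewrite size_exp_XsubC addn3. Qed.

Lemma size_qt_poly : (size (qt_poly m n : {poly R}) <= 2)%N.
Proof.
apply: (leq_trans (size_polyD _ _)); rewrite geq_max (leq_trans (size_polyC_leq1 _)) //.
by rewrite (leq_trans (size_scale_leq _ _)) // size_XsubC.
Qed.

Lemma qt_poly_coef0 : (qt_poly m n : {poly R})`_0 = m.+2%:R - 2 * n.+2%:R.
Proof. by rewrite coefD coefC coefZ coefB coefX coef1 /=; ring. Qed.

Lemma size_combination b (a : 'I_n -> R) : (size (combination b a) <= n.+3)%N.
Proof.
apply: (leq_trans (size_polyD _ _)); rewrite geq_max; apply/andP; split.
  by rewrite (leq_trans (size_scale_leq _ _)) // (leq_trans size_qt_poly).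
apply: (leq_trans (size_sum _ _ _)); apply/bigmax_leqP => i _.
by rewrite (leq_trans (size_scale_leq _ _)) // size_gen_poly !ltnS ltn_ord.
Qed.

(** Centred at X = 1 the candidates become D + 2 N X and the monomials X^j, j >= 3, with N = n.+2,
    so coefficients can be read off. *)
Lemma combination_shift p b (a : 'I_p -> R) : combination b a \Po ('X + 1) =
  b *: (m.+2%:R%:P + (2 * n.+2%:R) *: 'X) + \sum_i a i *: 'X^(i + 3).
Proof.
have e : ('X - 1) \Po ('X + 1) = 'X :> {poly R}.
  by rewrite comp_polyB comp_polyX -[1 in LHS]polyC1 comp_polyC addrK.
rewrite /combination comp_polyD comp_polyZ comp_polyD comp_polyC comp_polyZ e.
congr (_ + _); rewrite raddf_sum; apply: eq_bigr => i _.
by rewrite /= comp_polyZ rmorphXn /= e.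
Qed.

Lemma combination_size2 p b (a : 'I_p -> R) :
  (size (combination b a) <= 2)%N -> forall i, a i = 0.
Proof.
move=> h i; have : (size (combination b a \Po ('X + 1))%R <= 2)%N.
  by rewrite size_comp_poly2 // size_XaddC.
have i3 : (2 <= i + 3)%N by rewrite addn3.
move/leq_sizeP => /(_ (i + 3)%N i3); rewrite combination_shift coefD coefZ coefD coefC coefZ coefX.
rewrite !addn3 /= mulr0 addr0 mulr0 add0r coef_sum (bigD1 i) //= coefZ coefXn addn3 eqxx mulr1.
rewrite big1 ?addr0 => [-> //|j ji].
have ij : i != j :> nat by rewrite eq_sym.
by rewrite coefZ coefXn addn3 !eqSS (negbTE ij) mulr0.
Qed.

(** The constraints say that g(X + 1) has no X^2 term and that its constant term fixes its linear
    one; the other coefficients are free. *)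
Lemma GQT_combination c : GQT D k c -> exists b (a : 'I_n -> R), represents c (combination b a).
Proof.
move=> /(GQT_total hk) [g [sg cg]]; have [e2 e1] := represents_constraint sg cg.
pose h := g \Po ('X + 1).
have dX1 : ('X + 1 : {poly R})^`() = 1 by rewrite derivD derivX -polyC1 derivC addr0.
have h0 : h`_0 = g.[1] by rewrite -horner_coef0 horner_comp !hornerE.
have h1 : h`_1 = g^`().[1].
  have <- : h^`()`_0 = h`_1 by rewrite coef_deriv.
  by rewrite -horner_coef0 /h deriv_comp dX1 mulr1 horner_comp !hornerE.
have h2 : h`_2 = 0.
  have : h^`()^`()`_0 = 0.
    by rewrite -horner_coef0 /h deriv_comp dX1 mulr1 deriv_comp dX1 mulr1 horner_comp !hornerE.
  by rewrite !coef_deriv => /eqP; rewrite -mulrnA mulrn_eq0 /= => /eqP.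
exists (g.[1] / m.+2%:R), (fun i => h`_(i + 3)).
suff <- : g = combination (g.[1] / m.+2%:R) (fun i : 'I_n => h`_(i + 3)) by [].
have inj : injective (fun p : {poly R} => p \Po ('X + 1)).
  move=> p1 p2 /(congr1 (fun p => p \Po ('X - 1))); rewrite -!comp_polyA.
  have -> : ('X + 1) \Po ('X - 1) = 'X :> {poly R}.
    by rewrite comp_polyD comp_polyX -polyC1 comp_polyC subrK.
  by rewrite !comp_polyXr.
apply: inj => /=; rewrite combination_shift -/h; apply/polyP => j.
have sh : (size h <= n.+3)%N by rewrite /h size_comp_poly2 // size_XaddC.
rewrite coefD coefZ coefD coefC coefZ coefX coef_sum.
have m0 : m.+2%:R != 0 :> R by rewrite pnatr_eq0.
case: j => [|[|[|j]]].
- rewrite big1 => [|i _]; last by rewrite coefZ coefXn addn3 mulr0.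
  by rewrite /= h0 mulr0 !addr0 divfK.
- rewrite big1 => [|i _]; last by rewrite coefZ coefXn addn3 mulr0.
  by rewrite /= h1 mulr1 add0r addr0 mulrAC [_ * (2 * _)]mulrC -e1; field.
- rewrite big1 => [|i _]; last by rewrite coefZ coefXn addn3 mulr0.
  by rewrite /= h2 mulr0 !addr0 mulr0.
rewrite /= mulr0 addr0 mulr0 add0r; have [jn|jn] := ltnP j n.
  rewrite (bigD1 (Ordinal jn)) //= coefZ coefXn addn3 eqxx mulr1 big1 ?addr0 // => i ij.
  have ji : j != i :> nat by rewrite eq_sym.
  by rewrite coefZ coefXn addn3 !eqSS (negbTE ji) mulr0.
rewrite big1 => [|i _]; last first.
  by rewrite coefZ coefXn addn3 !eqSS gtn_eqF ?mulr0 // (leq_trans (ltn_ord i)).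
by move/leq_sizeP: sh => ->.
Qed.

(** The coefficient of A is a nonzero constant times psi^(n + 1), so the values at A = 0 and A = 1
    cannot both vanish. *)
Lemma represents_qt_nonvanishing c : represents c (qt_poly m n) -> nonvanishing D k c.
Proof.
move=> cq; have k4 : 0 < k + 4 by have := hk; lra.
have : total m n.+1 (qt_poly m n) 1 0 (-1) - total m n.+1 (qt_poly m n) 0 0 (-1) != 0 :> R.
  rewrite /total [X in X != 0](_ : _ = hom n.+1 (qt_poly m n)^`() 0 (-1)); last by ring.
  rewrite derivD derivC add0r derivZ derivB derivX -polyC1 derivC subr0 alg_polyC homC.
  by rewrite mulf_neq0 ?mulf_neq0 ?pnatr_eq0 // expf_neq0 // oppr_eq0 oner_eq0.
rewrite -!cq => ne.
have nv a : reduced m c a 0 (-1) != 0 -> nonvanishing D k c.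
  move=> ra; have [f [hf f0 f1 f2]] : exists f : R -> R, [/\ admissible f, f 2 = k + 4,
    derive1 f 2 = - 4 * 0 & derive1n 2 f 2 = - 2 * a] by apply: admissible_jet.
  have [eA eB ep] := jet_at2 f0 f1 f2; have r2 : (0 : R) < 2 by lra.
  exists f, 2; split=> //; rewrite lagrangian_reduced // eA eB ep.
  by rewrite mulf_neq0 // expf_neq0 // lt0r_neq0.
have [r1|/nv //] := eqVneq (reduced m c 1 0 (-1)) 0.
by apply: (nv 0); apply: contraNneq ne => ->; rewrite r1 subrr.
Qed.

(** [qt_poly] takes the value D - 2 N at 0, N = n.+2, so its equation (D - 2 N) r^(m + 1) psi^N is
    void exactly when D = 2 N; hence the condition on b. *)
Lemma represents_combination_trivial c b (a : 'I_n -> R) : represents c (combination b a) ->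
  trivial_equation D k c -> (m.+2 <> (2 * n.+2)%N -> b = 0) /\ forall i, a i = 0.
Proof.
move=> cg /(trivial_size (size_combination b a) cg) [s2 c0]; have a0 := combination_size2 s2.
split=> // mn; move: c0; rewrite /combination big1 => [|i _]; last by rewrite a0 scale0r.
rewrite addr0 coefZ qt_poly_coef0 => /eqP; rewrite mulf_eq0 => /orP[/eqP //|].
by rewrite subr_eq0 -natrM eqr_nat => /eqP.
Qed.

Lemma QT_equivalent c q : represents q (qt_poly m n) -> QT D k c ->
  trivial_equation D k c \/ equivalent D k c q.
Proof.
move=> rq qc; have [b [a cg]] := GQT_combination qc.1.
have a0 := combination_size2 (QT_size (size_combination b a) cg qc).
have {cg} cg : represents c (b *: qt_poly m n).
  by move: cg; rewrite /combination big1 ?addr0 // => i _; rewrite a0 scale0r.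
have iF := integrated_total k cg; have iq := integrated_total k rq.
have [b0|b0] := eqVneq b 0.
  left; apply: eq_integrated iF => r y0 y1 y2 r0.
  by rewrite b0 jetFZ mul0r.
by right; exists (jetF m n k (b *: qt_poly m n)), (jetF m n k (qt_poly m n)), b; split=> // r y0 y1 y2 _ _;
  rewrite jetFZ.
Qed.

End Classification.

(** Sums of inequivalent densities can give new equivalence classes, so the count is expressed by
    generators: n - 1 densities whose combinations exhaust the integrated equations, with their
    independence and the place of the quasi-topological ones among the combinations. *)
Theorem mainTheorem6 (R : realType) (D n : nat) (k : R)
    (hD : (5 <= D)%N) (hn : (2 <= n)%N) (hk : k \in [:: 1; 0; -1]) :
  exists (q : density R n) (g : 'I_(n - 2) -> density R n),
    (* one quasi-topological density and n - 2 genuine ones *)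
    (QT D k q /\ nonvanishing D k q) /\
    (forall i, genuine D k (g i)) /\
    (* the n - 1 densities are inequivalent, and linearly independent *)
    (forall i, ~ equivalent D k q (g i)) /\
    (forall i j, i != j -> ~ equivalent D k (g i) (g j)) /\
    (forall (b : R) (a : 'I_(n - 2) -> R),
       trivial_equation D k (b *: q + \sum_i a i *: g i) ->
       (D <> (2 * n)%N -> b = 0) /\ forall i, a i = 0) /\
    (* no combination involving the genuine densities is quasi-topological *)
    (forall (b : R) (a : 'I_(n - 2) -> R), (exists i, a i != 0) ->
       genuine D k (b *: q + \sum_i a i *: g i)) /\
    (* there are no further quasi-topological densities *)
    (forall c : density R n, QT D k c ->
       trivial_equation D k c \/ equivalent D k c q) /\
    (* there are no further generalized quasi-topological densities *)
    (forall c : density R n, GQT D k c ->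
       exists (b : R) (a : 'I_(n - 2) -> R),
         same_equation D k c (b *: q + \sum_i a i *: g i)).
Proof.
have {}hk : - 4 < k by move: hk; rewrite !inE => /or3P[] /eqP ->; lra.
case: D hD => [|[|m]] // m3; case: n hn => [|[|N]] // _.
have -> : (N.+2 - 2 = N)%N by rewrite !subSS subn0.
have {}m3 : (3 <= m)%N by [].
have [q rq] : exists q : density R N.+2, represents m q (qt_poly m N).
  exact: realizable_total_qt.
have /choice [g rg] : forall i : 'I_N, exists c : density R N.+2, represents m c (gen_poly i).
  move=> i; apply: realizable_total_XsubX => //.
  by rewrite addn3 /= !ltnS ltn_ord.
have rc b (a : 'I_N -> R) : represents m (b *: q + \sum_i a i *: g i) (combination m N b a).
  exact: represents_combination.
have sq : (size (qt_poly m N : {poly R}) <= N.+3)%N by rewrite (leq_trans (size_qt_poly _ _)).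
have sg (i : 'I_N) : (size (gen_poly i : {poly R}) <= N.+3)%N by rewrite size_gen_poly !ltnS ltn_ord.
(* A combination with coefficient - y on one genuine generator; size at most 2 would force y = 0. *)
have not_small y (i : 'I_N) : y != 0 -> ~ (size (qt_poly m N - y *: gen_poly i : {poly R})%R <= 2)%N.
  move=> y0 h.
  have := @combination_size2 R m N N 1 (fun j => if j == i then - y else 0).
  rewrite /combination scale1r (bigD1 i) //= eqxx big1 => [|j /negbTE ->]; last by rewrite scale0r.
  rewrite addr0 scaleNr => /(_ h i); rewrite eqxx => /eqP; by rewrite oppr_eq0 (negbTE y0).
exists q, g; split; [|split; [|split; [|split; [|split; [|split; [|split]]]]]].
- split; first exact: (size_QT k rq (size_qt_poly _ _)).
  exact: represents_qt_nonvanishing hk _ rq.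
- move=> i; split; first exact: total_GQT (rg i).
  by move/(QT_size hk (sg i) (rg i)); rewrite size_gen_poly.
- by move=> i /(equivalent_size hk sq (sg i) rq (rg i)) [y y0 /(not_small _ _ y0)].
- move=> i j ij /(equivalent_size hk (sg i) (sg j) (rg i) (rg j)) [y _ h].
  have := @combination_size2 R m N N 0 (fun l => if l == i then 1 else if l == j then - y else 0).
  rewrite /combination scale0r add0r (bigD1 i) //= eqxx scale1r (bigD1 j) /=; last by rewrite eq_sym.
  rewrite eq_sym (negbTE ij) eqxx big1 => [|l /andP[/negbTE -> /negbTE ->]]; last by rewrite scale0r.
  by rewrite addr0 scaleNr => /(_ h i); rewrite eqxx => /eqP; rewrite oner_eq0.
- by move=> b a; apply: (represents_combination_trivial hk (rc b a)).
- move=> b a [i ai]; split; first exact: total_GQT (rc b a).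
  move/(QT_size hk (size_combination m b a) (rc b a))/combination_size2/(_ i) => ai0.
  by rewrite ai0 eqxx in ai.
- by move=> c; apply: QT_equivalent hk _ _ rq.
- move=> c /(GQT_combination hk) [b [a cg]]; exists b, a, (jetF m N k (combination m N b a)).
  by split; [exact: integrated_total cg|exact: integrated_total (rc b a)].
Qed.
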